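(* The robust recoverable spanning tree problem with interval second-stage costs (RR ST under scenario set $\mathcal{U}^m$), defined below, can be solved in polynomial time: there is a polynomial-time algorithm which, given the input, outputs a spanning tree $X\in\Phi$ attaining the minimum in $$\min_{X\in \Phi} \Big(\sum_{e\in X} C_e + \max_{S\in \mathcal{U}^m}\min_{Y\in \Phi^k_{X}} \sum_{e\in Y} c_e^S\Big),$$ together with a spanning tree $Y\in\Phi^k_X$ attaining the inner minimum for the worst-case scenario.
   Context: Input: a connected graph $G=(V,E)$ with $|V|=n$, $|E|=m$; for each edge $e\in E$ a nonnegative first-stage cost $C_e$ and a second-stage uncertainty interval $[c_e,c_e+d_e]$ with $c_e\ge 0$, $d_e\geq 0$; and a recovery parameter $k\in\{0,\dots,n-1\}$ (all part of the input). $\Phi$ is the set of all spanning trees of $G$. For $X\in\Phi$, the recovery set is $\Phi^k_X=\{Y\in\Phi : |Y\setminus X|\le k\}$. A scenario is a vector $S=(c^S_e)_{e\in E}$ of second-stage costs, and $\mathcal{U}^m=\prod_{e\in E}[c_e,c_e+d_e]$ is the set of all scenarios. *)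

(* Defs.v *)
From HB Require Import structures.
From mathcomp Require Import all_boot all_order all_algebra.
From mathcomp Require Import boolp classical_sets reals.
Set Implicit Arguments.
Unset Strict Implicit.
Unset Printing Implicit Defensive.

Import Order.TTheory GRing.Theory Num.Theory.

(* Random access machines in the style of S. A. Cook and R. A. Reckhow (Time
   bounded random access machines, 1973) and C. H. Papadimitriou (Computational
   Complexity, 1994, Section 2.6): infinitely many registers R_0, R_1, ...
   holding natural numbers, a read-only randomly accessible input sequence and
   a write-only output sequence.  Every instruction counts as one step.  As
   there is no multiplication, one step lengthens the largest number by at most
   one bit (up to the constants of the program), so that running times
   polynomial in the bit length of the input are the same as on Turing
   machines. *)
Inductive instr : Type :=
  | iconst of nat & nat
  | iadd of nat & nat & nat
  | isub of nat & nat & nat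
  | ihalf of nat & nat
  | iload of nat & nat
  | istore of nat & nat
  | ijpos of nat & nat
  | iread of nat & nat
  | iprint of nat.

Definition program : Type := seq instr.

Record config : Type := Config {
  pc : nat;
  regs : nat -> nat;
  out : seq nat
}.

Definition init_config : config := Config 0 (fun=> 0) [::].

Definition upd (r : nat -> nat) (i x : nat) : nat -> nat :=
  fun j => if j == i then x else r j.

Definition exec_instr (w : seq nat) (ins : instr) (s : config) : config :=
  let: Config pc r o := s in
  match ins with
  | iconst i c => Config pc.+1 (upd r i c) o
  | iadd i j l => Config pc.+1 (upd r i (r j + r l)) o
  | isub i j l => Config pc.+1 (upd r i (r j - r l)) o
  | ihalf i j => Config pc.+1 (upd r i (r j)./2) o
  | iload i j => Config pc.+1 (upd r i (r (r j))) o
  | istore i j => Config pc.+1 (upd r (r i) (r j)) o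
  | ijpos i q => Config (if 0 < r i then q else pc.+1) r o
  | iread i j => Config pc.+1 (upd r i (nth 0 w (r j))) o
  | iprint i => Config pc.+1 r (rcons o (r i))
  end.

Definition step (p : program) (w : seq nat) (s : config) : config :=
  if onth p (pc s) is Some ins then exec_instr w ins s else s.

Definition halted (p : program) (s : config) : bool := size p <= pc s.

Definition outputs_within (p : program) (w : seq nat) (t : nat) (o : seq nat) :
    Prop :=
  let s := iter t (step p w) init_config in halted p s /\ out s = o.

Definition bit_length (x : nat) : nat := (trunc_log 2 x).+1.

Definition input_size (w : seq nat) : nat := \sum_(x <- w) bit_length x.

Definition poly_time_solvable (I : Type) (enc : I -> seq nat)
    (solution : I -> seq nat -> Prop) : Prop :=
  exists (p : program) (a b : nat), forall i : I,
    exists (t : nat) (o : seq nat),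
      [/\ t <= a * input_size (enc i) ^ b + a,
          outputs_within p (enc i) t o
        & solution i o].

(* Finite undirected graphs with vertex set 'I_n and edge set 'I_m, given by
   the (arbitrarily ordered) end points of each edge.  Parallel edges and loops
   are not excluded. *)
Section Graph.
Variables (n m : nat) (ends : 'I_m -> 'I_n * 'I_n).

Definition joins (e : 'I_m) (u v : 'I_n) : bool :=
  (ends e == (u, v)) || (ends e == (v, u)).

Definition adj (X : {set 'I_m}) : rel 'I_n :=
  fun u v => [exists e, (e \in X) && joins e u v].

Definition connected_by (X : {set 'I_m}) : Prop :=
  forall u v : 'I_n, connect (adj X) u v.

(* A walk from u is the sequence of its successive (edge, next vertex) pairs. *)
Fixpoint walk (X : {set 'I_m}) (u : 'I_n) (s : seq ('I_m * 'I_n)) : bool :=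
  if s is (e, v) :: s' then [&& e \in X, joins e u v & walk X v s'] else true.

Definition is_cycle (X : {set 'I_m}) (u : 'I_n) (s : seq ('I_m * 'I_n)) :
    bool :=
  [&& s != [::], walk X u s, last u (unzip2 s) == u,
      uniq (unzip1 s) & uniq (unzip2 s)].

Definition acyclic (X : {set 'I_m}) : Prop := forall u s, ~~ is_cycle X u s.

Definition spanning_tree (X : {set 'I_m}) : Prop :=
  connected_by X /\ acyclic X.

End Graph.

Local Open Scope ring_scope.
Local Open Scope classical_set_scope.

Record rr_instance : Type := RRInstance {
  nv : nat;
  ne : nat;
  ends : 'I_ne -> 'I_nv * 'I_nv;
  first_cost : 'I_ne -> rat;
  low_cost : 'I_ne -> rat;
  deviation : 'I_ne -> rat;
  rec_param : nat;
  graph_connected : connected_by ends [set: 'I_ne]%SET;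
  first_cost_ge0 : forall e, 0 <= first_cost e;
  low_cost_ge0 : forall e, 0 <= low_cost e;
  deviation_ge0 : forall e, 0 <= deviation e;
  rec_param_lt : (rec_param < nv)%N
}.

Definition encode_rat (x : rat) : seq nat := [:: `|numq x|%N; `|denq x|%N].

Definition encode_instance (I : rr_instance) : seq nat :=
  [:: nv I; ne I; rec_param I] ++
  flatten [seq [:: nat_of_ord (ends e).1; nat_of_ord (ends e).2]
               ++ encode_rat (first_cost e)
               ++ encode_rat (low_cost e)
               ++ encode_rat (deviation e) | e <- enum 'I_(ne I)].

Definition encode_set (m : nat) (X : {set 'I_m}) : seq nat :=
  [seq nat_of_bool (e \in X) | e <- enum 'I_m].

Section Problem.
Variables (R : realType) (I : rr_instance).
Implicit Types (X Y : {set 'I_(ne I)}) (S : 'I_(ne I) -> R).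

Definition Phi : set {set 'I_(ne I)} := [set X | spanning_tree (@ends I) X].

Definition recovery_set X : set {set 'I_(ne I)} :=
  [set Y | Phi Y /\ (#|Y :\: X| <= rec_param I)%N].

Definition scenarios : set ('I_(ne I) -> R) :=
  [set S | forall e, ratr (low_cost e) <= S e
                     <= ratr (low_cost e) + ratr (deviation e)].

Definition first_stage_cost X : R := \sum_(e in X) ratr (first_cost e).

Definition second_stage_cost S Y : R := \sum_(e in Y) S e.

(* For X in Phi, the infimum is over a finite nonempty set (X belongs to its
   own recovery set). *)
Definition recovery_cost X S : R :=
  inf [set second_stage_cost S Y | Y in recovery_set X].

Definition robust_cost X : R :=
  first_stage_cost X + sup [set recovery_cost X S | S in scenarios].

Definition worst_case X S : Prop :=
  scenarios S /\ forall S', scenarios S' -> recovery_cost X S' <= recovery_cost X S.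

Definition optimal_first_stage X : Prop :=
  Phi X /\ forall X', Phi X' -> robust_cost X <= robust_cost X'.

Definition optimal_recovery X S Y : Prop :=
  recovery_set X Y /\
  forall Y', recovery_set X Y' -> second_stage_cost S Y <= second_stage_cost S Y'.

(* The worst-case scenario need not be unique: there must be one, and Y must
   be optimal for each of them. *)
Definition rr_solution (o : seq nat) : Prop :=
  exists X Y,
    [/\ o = encode_set X ++ encode_set Y,
        optimal_first_stage X,
        exists S, worst_case X S
      & forall S, worst_case X S -> optimal_recovery X S Y].

End Problem.

(* Main.v *)
Require Import Defs.
From mathcomp Require Import all_boot all_order all_algebra.
From mathcomp Require Import reals.
From mathcomp Require Import zify ring.
Set Implicit Arguments.
Unset Strict Implicit.
Unset Printing Implicit Defensive.

Import Order.TTheory GRing.Theory Num.Theory.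

(* Since every cost of a scenario is at most its value in the top scenario
   [low + deviation], the top scenario is a worst case for every X, and an
   optimal recovery for it is optimal in every other worst case.  The problem is
   therefore to minimise C(X) + D(Y) over pairs of spanning trees with
   |Y \ X| <= k, where D = low + deviation.

   A pair (X, Y) is optimal for |Y \ X| = k as soon as there are potentials
   0 <= delta <= lambda with X a minimum spanning tree for C - delta, Y one for
   D + delta, delta = 0 on X \ Y and delta = lambda on Y \ X.  For k = 0 such
   potentials exist for X = Y a minimum spanning tree for C + D.  From k to k + 1
   one computes longest paths in the exchange graph, whose arcs are the single
   exchanges in X and in Y; they are the new potentials, and exchanging along a
   longest path with the fewest arcs keeps X and Y trees, keeps them optimal, and
   increases |Y \ X| by one.  When all distances vanish, lambda = 0 and the pair
   is optimal for every larger k.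

   The machine program is compiled from a language whose loops all run up to
   the value of a fixed variable, here the input size, so that its running time
   is polynomial by construction. *)

(** * Matroids given by a closure operator *)

(** Several exchanges that are legal one by one may destroy a tree when carried out together. A
    longest path with the fewest arcs has no shortcut, and this yields an order in which every
    exchange leaves the fundamental circuits of the remaining ones intact. Gain and number of arcs
    are packed into one number: an arc of gain g has length N * g - 1 with N above the number of
    edges, so a single Bellman-Ford computation optimises both, and d / N rounded up is the gain.
    The previous potentials, scaled by N, bound all distances, so cycles need no separate treatment.
    Interior elements of the path enter or leave both trees together; only its ends change X \ Y and
    Y \ X, and their new potentials, 0 and lambda, are the ones required there. The machine knows
    only natural numbers and has no product, so rational costs are multiplied by all denominators
    through shift-and-add. The loop bound must itself be computed: a loop over the input word sums
    the bit lengths, and the length of the word is obtained from the number of edges without a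
    loop. *)

Section Pregeometry.
Variables (E : finType) (cl : {set E} -> {set E}).
Implicit Types (A B X Y T : {set E}) (e f g : E) (L : seq (E * E)).

(** The spanning closure of a matroid, with the Steinitz exchange property. Spanning, rather than
    rank or independence, is what the machine tests directly, by comparing component labels. *)
Definition pregeometry : Prop :=
  [/\ forall A, A \subset cl A,
      forall A B, A \subset cl B -> cl A \subset cl B
    & forall A e f, f \in cl (e |: A) -> f \notin cl A -> e \in cl (f |: A)].

Definition base X : Prop :=
  cl X = [set: E] /\ forall e, e \in X -> e \notin cl (X :\ e).

Hypothesis clP : pregeometry.

Lemma cl_sub A : A \subset cl A. Proof. by case: clP. Qed.

Lemma cl_trans A B : A \subset cl B -> cl A \subset cl B.
Proof. by case: clP => _ h _; apply: h. Qed.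

Lemma cl_exchange A e f :
  f \in cl (e |: A) -> f \notin cl A -> e \in cl (f |: A).
Proof. by case: clP => _ _; apply. Qed.

Lemma clS A B : A \subset B -> cl A \subset cl B.
Proof. by move=> sAB; apply: cl_trans; apply: subset_trans (cl_sub B). Qed.

Lemma mem_clS A B e : A \subset B -> e \in cl A -> e \in cl B.
Proof. by move=> sAB; apply: (subsetP (clS sAB)). Qed.

Lemma mem_cl A e : e \in A -> e \in cl A.
Proof. exact: (subsetP (cl_sub A)). Qed.

Lemma mem_cl_trans A B e : A \subset cl B -> e \in cl A -> e \in cl B.
Proof. by move=> sAB; apply: (subsetP (cl_trans sAB)). Qed.

Lemma setU1_cl A B e : e \in cl B -> A \subset B -> e |: A \subset cl B.
Proof.
move=> eB sAB; apply/subsetP => x; rewrite in_setU1 => /predU1P[-> //|xA].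
by apply: mem_cl; apply: (subsetP sAB).
Qed.

Lemma base_out X e f : base X -> f \notin cl (X :\ e) -> e \in X.
Proof.
move=> [spX _] nf; apply: contraNT nf => eX.
suff -> : X :\ e = X by rewrite spX inE.
by apply/setDidPl; rewrite disjoint_sym disjoints1.
Qed.

Lemma base_in X e f : f \notin cl (X :\ e) -> f != e -> f \notin X.
Proof.
move=> nf fe; apply: contra nf => fX; apply: mem_cl.
by rewrite in_setD1 fe.
Qed.

Lemma base_exchange X e f :
  base X -> f \notin cl (X :\ e) -> base (f |: X :\ e).
Proof.
move=> bX nf; have eX := base_out bX nf; case: bX => spX inX.
have fX : f \in cl (e |: X :\ e) by rewrite setD1K // spX inE.
have ecl : e \in cl (f |: X :\ e) by apply: cl_exchange.
split.
  apply/eqP; rewrite eqEsubset subsetT -spX; apply: cl_trans.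
  by rewrite -{1}(setD1K eX); apply/subsetP => x;
     rewrite in_setU1 => /predU1P[-> //|xX]; apply: mem_cl;
     rewrite in_setU1 xX orbT.
move=> g; rewrite in_setU1 => /predU1P[->|gX].
  by apply: contra nf; apply: mem_clS; apply/subsetP => x;
     rewrite !inE => /andP[/negbTE->].
have [-> |gf] := eqVneq g f.
  by apply: contra nf; apply: mem_clS; apply/subsetP => x;
     rewrite !inE => /andP[/negbTE->].
have gX' := gX; move: gX'; rewrite in_setD1 => /andP[ge gX'].
apply/negP => gcl.
have eq1 : (f |: X :\ e) :\ g = f |: (X :\ e) :\ g.
  by apply/setP => x; rewrite !inE; case: (eqVneq x f) => [->|//] /=;
     rewrite eq_sym gf.
have : f \in cl (g |: (X :\ e) :\ g).
  apply: cl_exchange; first by rewrite -eq1.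
  apply: contra (inX g gX'); apply: mem_clS.
  by apply/subsetP => x; rewrite !inE => /and3P[-> _ ->].
by rewrite setD1K //; apply/negP.
Qed.

(** If [g] were spanned after the exchange, the exchange property would put [f] in the span of [g]
    and a part of [X :\ e], all inside [cl (X :\ e)]. *)
Lemma cl_exchange_out X e f e' g :
    f \notin cl (X :\ e) -> g \in cl (X :\ e) -> g \notin cl (X :\ e') ->
  g \notin cl ((f |: X :\ e) :\ e').
Proof.
move=> nf ge nge'; apply/negP => gcl.
have : f \in cl (g |: X :\ e :\ e').
  apply: cl_exchange; first apply: mem_clS gcl.
    by apply/subsetP => x; rewrite !inE => /andP[->]; case: (x == f).
  by apply: contra nge'; apply: mem_clS; apply/subsetP => x;
     rewrite !inE => /and3P[-> _ ->].
move/(mem_cl_trans (setU1_cl ge _)); apply/implyP.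
by rewrite (negbTE nf) subsetDl.
Qed.

(** By independence of [X], the closures of [X :\ e] and [X :\ e'] meet in that of [X :\ e :\ e'], a
    set which the exchange leaves alone: the fundamental circuit of [g] avoids both elements. *)
Lemma cl_exchange_in X e f e' g :
    base X -> e != e' -> e' \in X -> g \in cl (X :\ e) -> g \in cl (X :\ e') ->
  g \in cl ((f |: X :\ e) :\ e').
Proof.
move=> [_ inX] ee' e'X ge ge'.
suff: g \in cl (X :\ e :\ e').
  by apply: mem_clS; apply/subsetP => x; rewrite !inE => /andP[->] /= ->;
     rewrite orbT.
apply: contraTT (inX _ e'X) => ng; rewrite negbK.
have e'cl : e' \in cl (g |: X :\ e :\ e').
  apply: cl_exchange => //; rewrite setD1K //.
  by rewrite in_setD1 eq_sym ee'.
apply: mem_cl_trans e'cl; apply: setU1_cl => //.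
by apply/subsetP => x; rewrite !inE => /and3P[-> _ ->].
Qed.

(** * Several exchanges in one base *)

Definition swap X (p : E * E) := p.2 |: X :\ p.1.

(** The pairwise condition is triangular: the fundamental circuit of a later insertion avoids every
    element removed earlier. Carrying out the first pair then changes none of the spanning relations
    required of the others. *)
Lemma base_swaps X L :
    base X -> {in L, forall p, p.2 \notin cl (X :\ p.1)} ->
    pairwise (fun p q => q.2 \in cl (X :\ p.1)) L ->
  base (foldl swap X L).
Proof.
elim: L X => [//|[e f] L IH] X bX hL /= /andP[/allP h1 h2].
have nf : f \notin cl (X :\ e) by apply: (hL (e, f)); rewrite mem_head.
have hL' q : q \in L -> q.2 \notin cl (X :\ q.1).
  by move=> qL; apply: hL; rewrite inE qL orbT.
apply: IH; first exact: base_exchange.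
  by move=> q qL; apply: cl_exchange_out => //; [apply: h1|apply: hL'].
have : {in L &, forall q q', q'.2 \in cl (X :\ q.1) ->
                             q'.2 \in cl (swap X (e, f) :\ q.1)}.
  move=> q q' qL q'L hq; apply: cl_exchange_in => //; last exact: (h1 q').
    by apply: contraTneq (h1 _ qL) => /= ->; apply: hL'.
  exact: base_out (hL' _ qL).
by move=> hh; apply: sub_in_pairwise h2 => //; exact: hh.
Qed.

(** Shows that the order of the pairs does not affect the result, so that the list may be sorted
    before [base_swaps] is applied. *)
Lemma swapsE X L :
    {in L, forall p, p.1 \in X} -> {in L, forall p, p.2 \notin X} ->
  foldl swap X L = (X :\: [set x in unzip1 L]) :|: [set x in unzip2 L].
Proof.
move=> h1 h2.
(* The starting set is the symmetric difference of [X] and [Z], where [Z] collects the elements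
   exchanged so far. *)
have gen Z : {in L, forall p, p.2 \notin X} ->
    foldl swap (X :\: Z :|: ~: X :&: Z) L =
    X :\: (Z :|: [set x in unzip1 L]) :|: ~: X :&: (Z :|: [set x in unzip2 L]).
  move: h1 {h2}; elim: L Z => [|[e f] L IH] Z h1 h2 /=.
    by apply/setP => x; rewrite !inE !orbF.
  have eX : e \in X by apply: (h1 (e, f)); rewrite mem_head.
  have fX : f \notin X by apply: (h2 (e, f)); rewrite mem_head.
  have -> : swap (X :\: Z :|: ~: X :&: Z) (e, f) =
            X :\: (Z :|: [set e; f]) :|: ~: X :&: (Z :|: [set e; f]).
    apply/setP => x; rewrite !inE /=.
    case: (eqVneq x f) => [->|xf]; first by rewrite fX /= !orbT.
    case: (eqVneq x e) => [->|xe] /=; first by rewrite eX /= orbT.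
    by rewrite orbF.
  rewrite IH; last 2 first.
  - by move=> p pL; apply: h1; rewrite inE pL orbT.
  - by move=> p pL; apply: h2; rewrite inE pL orbT.
  apply/setP => x; rewrite !inE.
  case: (eqVneq x f) => [->|xf]; first by rewrite (negbTE fX) /= !orbT ?andbF.
  case: (eqVneq x e) => [->|xe] /=; first by rewrite eX /= !orbT.
  by rewrite !orbF.
move: (gen set0 h2); rewrite setD0 setI0 setU0 !set0U => ->.
apply/setP => x; rewrite !inE; case xX: (x \in X) => //=; rewrite orbF.
case x2: (x \in unzip2 L); last by rewrite orbF.
by case/mapP: x2 xX => p /h2 /negbTE + -> => ->.
Qed.

(** [e] is chosen in the fundamental circuit of [f] in [X]: if [T :\ f] spanned the rest of that
    circuit, it would span [f]. *)
Lemma symmetric_exchange X T f :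
    base X -> base T -> f \in T -> f \notin X ->
  exists e, [/\ e \in X, e \notin T, f \notin cl (X :\ e) & e \notin cl (T :\ f)].
Proof.
move=> [spX inX] [spT inT] fT fX.
have fclX : f \in cl X by rewrite spX inE.
have [A minA sAX] := minset_exists (P := fun A => f \in cl A) fclX.
have /minsetP[fA minA'] := minA.
have [/subsetP sA|] := boolP (A \subset cl (T :\ f)).
  have := inT f fT; rewrite (mem_cl_trans _ fA) //; exact/subsetP.
case/subsetPn => e eA neT; exists e.
have eX := subsetP sAX _ eA.
have nfA : f \notin cl (A :\ e).
  apply/negP => /minA' /(_ (subsetDl _ _)) /setP /(_ e).
  by rewrite !inE eqxx eA.
split=> //.
  apply: contra neT => eT; apply: mem_cl; rewrite in_setD1 eT andbT.
  by apply: contraNneq fX => <-.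
apply: contra (inX e eX) => fclXe.
have : e \in cl (f |: A :\ e) by apply: cl_exchange; rewrite ?setD1K.
by apply: mem_cl_trans; apply: setU1_cl => //; apply: setSD.
Qed.

(** * Minimum-weight bases *)

Local Open Scope ring_scope.

Definition min_base (wt : E -> int) X : Prop :=
  base X /\ forall T, base T -> \sum_(e in X) wt e <= \sum_(e in T) wt e.

Lemma sum_swap (wt : E -> int) X e f : e \in X -> f \notin X ->
  \sum_(x in f |: X :\ e) wt x = \sum_(x in X) wt x - wt e + wt f.
Proof.
move=> eX fX; rewrite big_setU1 /=; last by rewrite in_setD1 (negbTE fX) andbF.
by rewrite (big_setD1 e eX) /= addrC; lia.
Qed.

Lemma min_base_exchange (wt : E -> int) X e f :
  min_base wt X -> f \notin cl (X :\ e) -> wt e <= wt f.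
Proof.
move=> [bX mX] nf; have eX := base_out bX nf.
have [->//|fe] := eqVneq f e.
have fX := base_in nf fe.
by have := mX _ (base_exchange bX nf); rewrite sum_swap //; lia.
Qed.

(** A symmetric exchange replaces an element of [T :\: X] by one of [X] without raising the weight
    of [T]. This ends with [T] inside [X], and nested bases are equal. *)
Lemma min_baseP (wt : E -> int) X :
    base X -> (forall e f, f \notin cl (X :\ e) -> wt e <= wt f) ->
  min_base wt X.
Proof.
move=> bX loc; split=> // T; have [k] := ubnP #|T :\: X|.
elim: k T => [//|k IH] T hk bT.
have [/eqP sTX|[f]] := set_0Vmem (T :\: X); last first.
  rewrite inE => /andP[fX fT].
  have [e [eX eT nf ne]] := symmetric_exchange bX bT fT fX.
  have := IH _ _ (base_exchange bT ne); rewrite sum_swap // => h.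
  have /h : (#|(e |: T :\ f) :\: X| < k)%N.
    apply: leq_trans (_ : #|T :\: X| <= k)%N => //.
    apply: proper_card; apply/properP; split.
      apply/subsetP => x; rewrite !inE; case: (eqVneq x e) => [->|]; rewrite ?eX //=.
      by move=> _ /and3P[-> _ ->].
    exists f; rewrite !inE ?fX ?fT // eqxx /=.
    by apply: contraNN fX => /orP[/eqP->|].
  by have := loc _ _ nf; lia.
rewrite setD_eq0 in sTX; suff -> : T = X by [].
apply/eqP; rewrite eqEsubset sTX; apply/subsetP => e eX.
apply: contraTT (bX.2 e eX) => eT; rewrite negbK.
have : e \in cl T by rewrite bT.1 inE.
apply: mem_clS; apply/subsetP => x xT; rewrite in_setD1 (subsetP sTX) // andbT.
by apply: contraNneq eT => <-.
Qed.

(* Kruskal without selecting minima: an element is kept exactly when it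
   is not spanned by the elements of smaller rank [rk], which refines [wt]. *)
Lemma greedy_base (wt : E -> int) (rk : E -> nat) X : injective rk ->
    (forall e f, wt e < wt f -> (rk e < rk f)%N) ->
    (forall f, (f \in X) = (f \notin cl [set g | (rk g < rk f)%N])) ->
  min_base wt X.
Proof.
move=> injrk rkwt XE.
(* Induction on the rank: a rejected element is spanned by elements of smaller rank, which in turn
   are spanned by kept ones. *)
have sp k f : (rk f < k)%N -> f \in cl [set g in X | (rk g <= rk f)%N].
  elim: k f => [//|k IH] f hf.
  have [fX|] := boolP (f \in X); first by apply: mem_cl; rewrite inE fX /=.
  rewrite XE negbK; apply: mem_cl_trans; apply/subsetP => g.
  rewrite inE => gf; have /IH : (rk g < k)%N by lia.
  by apply: mem_clS; apply/subsetP => x; rewrite !inE => /andP[->] /=; lia.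
have spX f : f \in cl X.
  by have := sp _ f (ltnSn _); apply: mem_clS; apply/subsetP => x; rewrite inE => /andP[].
have bX : base X.
  split; first by apply/setP => f; rewrite inE spX.
  move=> e eX; apply/negP => ecl.
  have [A minA sAX] := minset_exists (P := fun A => e \in cl A) ecl.
  have /minsetP[eA minA'] := minA.
  (* In the circuit formed by [e] and [A], the element of largest rank is spanned by the others, all
     of smaller rank, so it cannot have been kept. *)
  case: (@arg_maxnP _ e (fun x => x \in e |: A) rk); first by rewrite !inE eqxx.
  move=> g gA gmax.
  have gX : g \in X.
    move: gA; rewrite !inE => /predU1P[->//|gA].
    by have := subsetP sAX _ gA; rewrite !inE => /andP[].
  move: (gX); rewrite XE => /negP; apply.
  have gcl : g \in cl ((e |: A) :\ g).
    have [ge|ge] := eqVneq g e.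
      rewrite ge; apply: mem_clS eA; apply/subsetP => x xA.
      have := subsetP sAX _ xA; rewrite !inE => /andP[-> _]; by rewrite xA orbT.
    have gA' : g \in A by move: gA; rewrite !inE (negbTE ge).
    have := @cl_exchange (A :\ g) g e; rewrite setD1K // => /(_ eA) h.
    have /h : e \notin cl (A :\ g).
      apply/negP => /minA' /(_ (subsetDl _ _)) /setP /(_ g).
      by rewrite !inE eqxx gA'.
    apply: mem_clS; apply/subsetP => x; rewrite !inE => /predU1P[->|/andP[-> ->]].
      by rewrite eqxx eq_sym ge.
    by rewrite orbT.
  apply: mem_clS gcl; apply/subsetP => x; rewrite in_setD1 => /andP[xg xA].
  rewrite inE ltn_neqAle (gmax x xA : (rk x <= rk g)%N) andbT.
  by apply: contraNneq xg => /injrk ->.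
apply: min_baseP => // e f nf; rewrite leNgt; apply: contraNN nf => /rkwt ltfe.
have := sp _ f (ltnSn _); apply: mem_clS; apply/subsetP => x.
rewrite !inE => /andP[-> xf]; rewrite andbT.
by apply: contraTneq ltfe => <-; rewrite -leqNgt.
Qed.

End Pregeometry.

(** * The graphic matroid *)

Section GraphMatroid.
Variables (n m : nat) (ends : 'I_m -> 'I_n * 'I_n).
Implicit Types (S X : {set 'I_m}) (u v : 'I_n) (e f : 'I_m).

Lemma adj_sym S : symmetric (adj ends S).
Proof. by move=> u v; apply: eq_existsb => e; rewrite /joins orbC. Qed.

Lemma connect_adjC S : connect_sym (adj ends S).
Proof. by apply: sym_connect_sym; apply: adj_sym. Qed.

Lemma adj_ends S e : e \in S -> adj ends S (ends e).1 (ends e).2.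
Proof.
by move=> eS; apply/existsP; exists e; rewrite eS /joins -surjective_pairing eqxx.
Qed.

Lemma adjS S X : S \subset X -> subrel (adj ends S) (adj ends X).
Proof.
move=> sSX u v /existsP[e /andP[eS ee]]; apply/existsP; exists e.
by rewrite (subsetP sSX).
Qed.

Lemma connect_adjS S X u v :
  S \subset X -> connect (adj ends S) u v -> connect (adj ends X) u v.
Proof.
by move=> sSX; apply: connect_sub => x y /(adjS sSX) /connect1.
Qed.

(** Serves twice: it gives the exchange property of the graphic closure, and it describes the
    merging of two classes of labels when the program adds an edge. *)
Lemma connect_setU1 S e u v :
  connect (adj ends (e |: S)) u v =
  [|| connect (adj ends S) u v,
      connect (adj ends S) u (ends e).1 && connect (adj ends S) (ends e).2 v
    | connect (adj ends S) u (ends e).2 && connect (adj ends S) (ends e).1 v].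
Proof.
have sub : S \subset e |: S by apply: subsetUr.
have ee : connect (adj ends (e |: S)) (ends e).1 (ends e).2.
  by apply: connect1; apply: adj_ends; rewrite setU11.
apply/idP/idP; last first.
  case/or3P => [|/andP[h1 h2]|/andP[h1 h2]]; first exact: connect_adjS.
    apply: connect_trans (connect_adjS sub h1) _.
    by apply: connect_trans ee _; apply: connect_adjS h2.
  apply: connect_trans (connect_adjS sub h1) _.
  rewrite connect_adjC in ee.
  by apply: connect_trans ee _; apply: connect_adjS h2.
case/connectP => p; elim/last_ind: p v => [|p w IH] v /=.
  by move=> _ ->; rewrite connect0.
rewrite rcons_path last_rcons => /andP[hp hw] ->.
have {IH} := IH _ hp erefl; set x := last u p in hw *.
have : connect (adj ends S) x w || (ends e == (x, w)) || (ends e == (w, x)).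
  move: hw => /existsP[f /andP[]]; rewrite in_setU1 => /predU1P[->|fS].
    by rewrite /joins -orbA => ->; rewrite orbT.
  by move=> hf; rewrite connect1 //; apply/existsP; exists f; rewrite fS.
case/orP => [/orP[xw|/eqP->]|/eqP->] /=.
- case/or3P => [h|/andP[h1 h2]|/andP[h1 h2]]; apply/or3P.
  + by apply: Or31; apply: connect_trans h xw.
  + by apply: Or32; rewrite h1; apply: connect_trans h2 xw.
  + by apply: Or33; rewrite h1; apply: connect_trans h2 xw.
- case/or3P => [h|/andP[h1 h2]|/andP[h1 h2]]; apply/or3P.
  + by apply: Or32; rewrite h connect0.
  + by apply: Or32; rewrite h1 connect0.
  + by apply: Or31.
- case/or3P => [h|/andP[h1 h2]|/andP[h1 h2]]; apply/or3P.
  + by apply: Or33; rewrite h connect0.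
  + by apply: Or31.
  + by apply: Or33; rewrite h1 connect0.
Qed.

Definition graph_cl S : {set 'I_m} :=
  [set e | connect (adj ends S) (ends e).1 (ends e).2].

Lemma graph_clP S X u v :
  S \subset graph_cl X -> connect (adj ends S) u v -> connect (adj ends X) u v.
Proof.
move=> sSX; apply: connect_sub => x y /existsP[e /andP[/(subsetP sSX)]].
rewrite inE => he /orP[] /eqP ee; move: he; rewrite ee //=.
by rewrite connect_adjC.
Qed.

Lemma graph_pregeometry : pregeometry graph_cl.
Proof.
split=> [A|A B sAB|A e f].
- by apply/subsetP => e eA; rewrite inE; apply: connect1; apply: adj_ends.
- by apply/subsetP => e; rewrite !inE; apply: graph_clP.
rewrite !inE !connect_setU1 => /orP[-> //|] /orP[] /andP[h1 h2] _.
  apply/orP; right; apply/orP; left.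
  by rewrite connect_adjC h1 connect_adjC h2.
apply/orP; right; apply/orP; right.
by rewrite h2 h1.
Qed.

(** * Cycles and spanning trees in terms of the closure *)

Lemma walk_joins S u s e : walk ends S u s -> e \in unzip1 s ->
  exists x y, [/\ joins ends e x y, x \in u :: unzip2 s & y \in u :: unzip2 s].
Proof.
elim: s u => [//|[f v] s IH] u /= /and3P[fS fuv ws].
rewrite inE => /predU1P[->|es].
  by exists u, v; rewrite !inE !eqxx orbT.
have [x [y [h1 h2 h3]]] := IH _ ws es; exists x, y; split=> //.
  by rewrite inE h2 orbT.
by rewrite inE h3 orbT.
Qed.

(** Using the first edge a second time would bring the path back to [u]; hence distinct vertices
    force distinct edges, whichever parallel edges are picked. *)
Lemma path_walk S u p : path (adj ends S) u p -> uniq (u :: p) ->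
  exists s, [/\ walk ends S u s, unzip2 s = p & uniq (unzip1 s)].
Proof.
elim: p u => [|w p IH] u; first by exists [::].
move=> /= /andP[/existsP[e /andP[eS euw]] hp] /andP[ui up].
have [s [h1 h2 h3]] := IH _ hp up.
exists ((e, w) :: s); split=> //=; first by rewrite eS euw.
  by rewrite h2.
rewrite h3 andbT; apply/negP => /(walk_joins h1)[x [y [exy xs ys]]].
have us : u \in [:: x; y].
  by move: euw exy; rewrite /joins => /orP[] /eqP-> /orP[] /eqP[];
     do 2!move=> ?; subst; rewrite !inE eqxx ?orbT.
by move: ui; rewrite -h2; move: us; rewrite !inE => /orP[] /eqP->;
   rewrite -in_cons ?xs ?ys.
Qed.

Lemma walk_connect S u s :
  walk ends S u s -> connect (adj ends S) u (last u (unzip2 s)).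
Proof.
elim: s u => [|[e v] s IH] u //= /and3P[eS euv /IH].
by apply: connect_trans; apply: connect1; apply/existsP; exists e; rewrite eS.
Qed.

Lemma walkS S X u s : {subset unzip1 s <= X} -> walk ends S u s -> walk ends X u s.
Proof.
elim: s u => [//|[e v] s IH] u /= sX /and3P[_ -> /IH->]; first by rewrite sX ?mem_head.
by move=> x xs; apply: sX; rewrite inE xs orbT.
Qed.

Lemma walk_sub S u s : walk ends S u s -> {subset unzip1 s <= S}.
Proof.
elim: s u => [//|[f v] t IH] w /= /and3P[fX _ /IH h] x.
by rewrite inE => /predU1P[->|/h].
Qed.

(** A simple path joining the ends of [e] in [X :\ e] is closed by [e] to a cycle; conversely the
    first edge of a cycle is spanned by the remaining ones. *)
Lemma acyclicP X :
  acyclic ends X <-> forall e, e \in X -> e \notin graph_cl (X :\ e).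
Proof.
split=> [ac e eX|ind u s]; apply/negP.
  rewrite inE => h; move: (h) => /connectP[p hp _].
  case/connectP: h => {hp}p hp; case/shortenP: hp => {}p hp up _ lp.
  have [s [h1 h2 h3]] := path_walk hp up.
  suff : is_cycle ends X (ends e).2 ((e, (ends e).1) :: s) by apply/negP; apply: ac.
  rewrite /is_cycle /= h2 eX lp eqxx -/(uniq (_ :: p)) up andbT.
  rewrite -lp /joins -surjective_pairing eqxx orbT /=.
  have eS := walk_sub h1.
  rewrite h3 andbT; apply/andP; split.
    by apply: walkS h1 => x /eS; rewrite in_setD1 => /andP[].
  by apply/negP => /eS; rewrite !inE eqxx.
case: s => [//|[e v] s] /and5P[_ /= /and3P[eX euv ws] /eqP ls /andP[es us] _].
have := ind e eX; rewrite inE => /negP; apply.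
have ws' : walk ends (X :\ e) v s.
  apply: walkS (ws) => x xs; rewrite in_setD1 (walk_sub ws) // andbT.
  by apply: contraNneq es => <-.
have := walk_connect ws'; rewrite ls.
by case/orP: euv => /eqP-> /=; rewrite // connect_adjC.
Qed.

Lemma spanning_treeP X : connected_by ends [set: 'I_m] ->
  spanning_tree ends X <-> base graph_cl X.
Proof.
move=> conG; split=> -[h1 /acyclicP h2]; split=> //.
  by apply/setP => e; rewrite !inE h1.
move=> u v; apply: graph_clP (conG u v).
by rewrite h1.
Qed.

(** The length of the input controls the number of edges only; this carries the bound over to the
    vertices, over which the labelling loops run. A vertex set with one edge less than vertices is
    grown along edges that leave it. *)
Lemma connected_card : connected_by ends [set: 'I_m] -> n <= m.+1.
Proof.
move=> conG; case: (posnP n) => [-> //|n0].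
pose v0 := Ordinal n0.
suff ex k : k < n -> exists (A : {set 'I_n}) (F : {set 'I_m}),
    [/\ v0 \in A, #|A| = k.+1, #|F| = k
      & forall e, e \in F -> ((ends e).1 \in A) && ((ends e).2 \in A)].
  have [|A [F [_ _ cF _]]] := ex n.-1; first by rewrite prednK.
  by have := max_card (mem F); rewrite cF card_ord; lia.
elim: k => [_|k IH kn].
  by exists [set v0], set0; rewrite set11 cards1 cards0; split=> // e; rewrite inE.
have [|A [F [v0A cA cF hF]]] := IH; first by lia.
have [e he] : exists e, ((ends e).1 \in A) != ((ends e).2 \in A).
  apply/existsP; apply: contraLR kn => /existsPn he.
  have cl : closed (adj ends [set: 'I_m]) (mem A).
    move=> x y /existsP[e /andP[_ /orP[] /eqP ee]];
      have := he e; rewrite ee negbK => /eqP //=.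
  suff AT : A = setT by move: cA; rewrite AT cardsT card_ord; lia.
  by apply/setP => x; rewrite inE -(closed_connect cl (conG v0 x)).
have eF : e \notin F by apply: contra he => /hF /andP[-> ->].
pose x := if (ends e).1 \in A then (ends e).2 else (ends e).1.
have xA : x \notin A by rewrite /x; case: ifP he => [_|-> //]; case: (_ \in A).
exists (x |: A), (e |: F); rewrite !cardsU1 xA eF cA cF inE v0A orbT; split=> // f.
rewrite in_setU1 => /predU1P[->|/hF /andP[h1 h2]]; rewrite !inE.
  by rewrite /x; case a1: ((ends e).1 \in A) he; case a2: ((ends e).2 \in A) => //= _;
     rewrite eqxx ?orbT.
by rewrite h1 h2 !orbT.
Qed.

End GraphMatroid.

(** * Augmentation along longest exchange paths *)

Section KeyedSwaps.
Variables (E : finType) (cl : {set E} -> {set E}).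
Hypothesis clP : pregeometry cl.
Implicit Types (X Y : {set E}) (L : seq (E * E)).
Local Open Scope ring_scope.

(* Performing the exchanges by increasing key keeps the fundamental circuits of
   the remaining ones untouched. *)
Lemma base_keyed_swaps (key : E * E -> int) X L :
    base cl X -> uniq L ->
    {in L, forall p, p.2 \notin cl (X :\ p.1)} ->
    {in L, forall p, p.2 \notin X} ->
    {in L &, forall p q, q.2 \notin cl (X :\ p.1) ->
                         key q <= key p /\ (key q = key p -> p = q)} ->
  base cl (foldl (@swap E) X L).
Proof.
move=> bX uL hL nL kL; pose L' := sort (relpre key <=%R) L.
have pL : perm_eq L' L by rewrite perm_sort.
have mL : L' =i L by apply: perm_mem.
have oL p : p \in L -> p.1 \in X by move=> /hL; apply: base_out.
rewrite swapsE //.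
have -> : [set x in unzip1 L] = [set x in unzip1 L'].
  by apply/setP => x; rewrite !inE; apply/perm_mem/perm_map; rewrite perm_sym.
have -> : [set x in unzip2 L] = [set x in unzip2 L'].
  by apply/setP => x; rewrite !inE; apply/perm_mem/perm_map; rewrite perm_sym.
rewrite -swapsE; last 2 first.
- by move=> p; rewrite mL; apply: oL.
- by move=> p; rewrite mL; apply: nL.
apply: base_swaps => //; first by move=> p; rewrite mL; apply: hL.
have : pairwise [rel p q | (key p <= key q) && (p != q)] L'.
  rewrite pairwise_relI -[pairwise (fun p q => p != q) _]uniq_pairwise (perm_uniq pL) uL andbT.
  rewrite -sorted_pairwise; last by move=> y x z /=; apply: le_trans.
  by apply: sort_sorted => x y /=; apply: le_total.
have hh : {in L' &, forall p q,
    [rel p q | (key p <= key q) && (p != q)] p q -> q.2 \in cl (X :\ p.1)}.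
  move=> p q; rewrite !mL => pL' qL' /andP[/= pq npq].
  apply: contraNT npq => /(kL p q pL' qL')[qp eqpq].
  by apply/eqP; apply: eqpq; apply/eqP; rewrite eq_le pq qp.
by move=> hp; apply: sub_in_pairwise hp => //; exact: hh.
Qed.

Lemma sum_swaps (wt : E -> int) X L :
    {in L, forall p, p.1 \in X} -> {in L, forall p, p.2 \notin X} ->
    uniq (unzip1 L) -> uniq (unzip2 L) -> {in L, forall p, wt p.1 = wt p.2} ->
  \sum_(x in foldl (@swap E) X L) wt x = \sum_(x in X) wt x.
Proof.
elim: L X => [//|[e f] L IH] X h1 h2 /= /andP[e1 u1] /andP[f2 u2] hw.
have eX : e \in X by apply: (h1 (e, f)); rewrite mem_head.
have fX : f \notin X by apply: (h2 (e, f)); rewrite mem_head.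
have ewf : wt e = wt f by apply: (hw (e, f)); rewrite mem_head.
rewrite IH //.
- by rewrite sum_swap // ewf subrK.
- move=> p pL; rewrite !inE /= h1 ?inE ?pL ?orbT // andbT; apply/orP; right.
  by apply: contraNneq e1 => <-; apply: map_f.
- move=> p pL; rewrite !inE /= negb_or (negbTE (h2 p _)) ?inE ?pL ?orbT //.
  by rewrite andbF andbT; apply: contraNneq f2 => <-; apply: map_f.
- by move=> p pL; apply: hw; rewrite inE pL orbT.
Qed.

End KeyedSwaps.

(** * Optimality certificates for pairs of bases *)

Section Augmentation.
Variables (E : finType) (cl : {set E} -> {set E}).
Hypothesis clP : pregeometry cl.
Variables C D : E -> nat.
Implicit Types (X Y : {set E}) (dl d h : E -> nat) (u v : E).

(** A weight splitting: [lam] acts as a Lagrange multiplier for the bound on [#|Y :\: X|], and the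
    last two conditions are complementary slackness. *)
Definition certificate X Y dl (lam : nat) : Prop :=
  [/\ min_base cl (fun e => (C e)%:Z - (dl e)%:Z)%R X,
      min_base cl (fun e => (D e)%:Z + (dl e)%:Z)%R Y,
      forall e, dl e <= lam,
      forall e, e \in X :\: Y -> dl e = 0
    & forall e, e \in Y :\: X -> dl e = lam].

(* Moving [dl] from one cost function to the other changes the total cost of a
   pair by at most [lam * #|Y :\: X|], with equality for the certified pair. *)
Lemma certificate_optimal X Y dl lam k X' Y' :
    certificate X Y dl lam -> #|Y :\: X| = k \/ lam = 0 ->
    base cl X' -> base cl Y' -> #|Y' :\: X'| <= k ->
  \sum_(e in X) C e + \sum_(e in Y) D e <=
  \sum_(e in X') C e + \sum_(e in Y') D e.
Proof.
move=> [[_ mX] [_ mY] bd d0 dlam] hk bX' bY' ck.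
have {mX} := mX _ bX'; have {mY} := mY _ bY'.
rewrite !big_split /= !sumrN.
have cast (F : E -> nat) (A : {set E}) :
  (\sum_(e in A) (F e)%:Z)%R = Posz (\sum_(e in A) F e).
  by rewrite (big_morph Posz PoszD (erefl _)).
rewrite !cast.
have split (A B : {set E}) :
    \sum_(e in A) dl e = \sum_(e in A :&: B) dl e + \sum_(e in A :\: B) dl e.
  by rewrite (big_setID B).
rewrite (split X Y) (split Y X) (split X' Y') (split Y' X').
rewrite (setIC Y X) (setIC Y' X').
have -> : \sum_(e in X :\: Y) dl e = 0 by rewrite big1.
have -> : \sum_(e in Y :\: X) dl e = #|Y :\: X| * lam.
  by rewrite -sum_nat_const; apply: eq_bigr.
have : \sum_(e in Y' :\: X') dl e <= #|Y' :\: X'| * lam.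
  by rewrite -sum_nat_const; apply: leq_sum.
have : #|Y' :\: X'| * lam <= #|Y :\: X| * lam.
  by case: hk => [->|->]; rewrite ?muln0 // leq_mul2r ck orbT.
lia.
Qed.

(** With this choice [D + dl] is constant, so every base is minimum for it, and [C - dl] is [C + D]
    up to a constant. The maximum of [D] keeps [dl] a natural number. *)
Lemma certificate_init X :
    min_base cl (fun e => Posz (C e + D e)) X ->
  certificate X X (fun e => \max_f D f - D e) (\max_f D f).
Proof.
move=> mX; have bX := mX.1.
have leD e : D e <= \max_f D f by apply: leq_bigmax.
have loc e f (nf : f \notin cl (X :\ e)) : C e + D e <= C f + D f.
  by have := min_base_exchange clP mX nf; lia.
split=> [|||e|e]; last 2 first.
- by rewrite setDv inE.
- by rewrite setDv inE.
- by apply: min_baseP => // e f /loc; have := leD e; have := leD f; lia.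
- by apply: min_baseP => // e f /loc; have := leD e; have := leD f; lia.
- by move=> e; rewrite leq_subr.
Qed.

(** * Longest paths in the exchange graph *)

Section Step.
Variables X Y : {set E}.
Local Notation N := #|E|.+2.

(* Arcs of the exchange graph, with gain [a - b]: insert [u] and remove [v] in
   [X]; insert [v] and remove [u] in [Y]; and free moves into [Y :\: X], which
   force potentials to be maximal there. *)
Definition exch_arc u v (a b : nat) : Prop :=
  [\/ [/\ u \notin cl (X :\ v), a = C v & b = C u],
      [/\ v \notin cl (Y :\ u), a = D u & b = D v]
    | [/\ v \in Y :\: X, a = 0 & b = 0]].

Definition tight d u v : Prop :=
  exists a b, exch_arc u v a b /\ d v + N * b + 1 = d u + N * a.

Definition feasible d : Prop :=
  forall u v a b, exch_arc u v a b -> d u + N * a <= d v + N * b + 1.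

(* Longest paths in the exchange graph with arc lengths [N * (a - b) - 1]: the
   [-1] makes them use as few arcs as possible. *)
Definition longest dl d : Prop :=
  [/\ feasible d, forall v, d v <= N * dl v
    & forall v, 0 < d v -> exists u, tight d u v].

Variables (dl : E -> nat) (lam : nat).
Hypothesis ct : certificate X Y dl lam.

Let bX : base cl X. Proof. by case: ct => [[]]. Qed.
Let bY : base cl Y. Proof. by case: ct => _ []. Qed.

(** Local optimality of both bases makes [dl] a potential of the exchange graph, which is the upper
    bound that keeps longest paths finite. *)
Lemma certificate_arc u v a b : exch_arc u v a b -> dl u + a <= dl v + b.
Proof.
case: ct => mX mY bd d0 dlam [] [h -> ->].
- by have := min_base_exchange clP mX h; lia.
- by have := min_base_exchange clP mY h; lia.
- by rewrite (dlam _ h) !addn0.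
Qed.

(** No path is formed: starting from [N * dl], a positive value that no tight arc enters is lowered
    by one. This preserves feasibility and decreases the sum of the values. *)
Lemma longest_exists : exists d, longest dl d.
Proof.
suff H K d : \sum_v d v < K -> feasible d -> (forall v, d v <= N * dl v) ->
    exists d', longest dl d'.
  apply: (H _ (fun v => N * dl v) (ltnSn _)) => //.
  by move=> u v a b /certificate_arc; rewrite -!mulnDr => h;
     apply: leq_trans (leq_addr _ _); rewrite leq_mul2l h orbT.
elim: K d => [//|K IH] d hK fd bd.
have [tg|] := boolp.pselect (forall v, 0 < d v -> exists u, tight d u v).
  by exists d; split.
move=> /boolp.existsNP[v /boolp.not_implyP[dv ntg]].
pose d' x := if x == v then (d x).-1 else d x.
have d'le x : d' x <= d x by rewrite /d'; case: ifP => // _; apply: leq_pred.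
apply: (IH d').
- have : \sum_x d' x < \sum_x d x; last by lia.
  rewrite (bigD1 v) //= [X in _ < X](bigD1 v) //= {1}/d' eqxx.
  have : \sum_(i | i != v) d' i <= \sum_(i | i != v) d i by apply: leq_sum.
  by lia.
- move=> u x a b h; have := fd _ _ _ _ h; have := d'le u.
  case: (eqVneq x v) => [xv|xv]; last by rewrite [d' x]/d' (negbTE xv); lia.
  have d'x : d' x = (d x).-1 by rewrite /d' xv eqxx.
  have [uv|uv] := eqVneq u v; first by rewrite uv -xv d'x; lia.
  have /eqP : d x + N * b + 1 <> d u + N * a.
    by move=> tt; apply: ntg; exists u, a, b; rewrite -xv.
  by rewrite -xv in dv; rewrite d'x; lia.
- by move=> x; apply: leq_trans (bd x).
Qed.

Variable d : E -> nat.
Hypothesis ld : longest dl d.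

(* Since [N > #|E|], a distance [d v = N * W v - h v] determines both the gain
   [W v] and the number of arcs [h v] of a longest path. *)
Lemma longest_level : exists h W : E -> nat,
  forall v, h v < #|E| /\ d v + h v = N * W v.
Proof.
case: ld => fd bd td.
suff H v : exists2 s, uniq (v :: s) & exists W, d v + size s = N * W.
  have {}H v : exists hW : nat * nat, hW.1 < #|E| /\ d v + hW.1 = N * hW.2.
    have [s us [W hW]] := H v; exists (size s, W); split=> //=.
    by have := card_uniqP us => /= <-; apply: max_card.
  have [hW hWP] := boolp.choice H.
  by exists (fun v => (hW v).1), (fun v => (hW v).2).
(* This slack drops strictly along tight arcs followed backwards, because each arc costs one unit.
   Hence the path repeats no element and has fewer than [#|E|] arcs. *)
pose mu x := N * dl x - d x.
suff K k : mu v < k -> exists s, [/\ uniq (v :: s), {in s, forall x, mu x < mu v}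
    & exists W, d v + size s = N * W].
  by have [s [us _ hW]] := K _ (ltnSn _); exists s.
elim: k v => [//|k IH] v hk.
have [d0|dv] := posnP (d v).
  by exists [::]; split=> //; exists 0; rewrite d0 muln0.
have [u [a [b [auv tuv]]]] := td v dv.
have := certificate_arc auv => lab.
have lab' : N * dl u + N * a <= N * dl v + N * b by rewrite -!mulnDr leq_mul2l lab orbT.
have muv : mu u < mu v by have := bd u; have := bd v; rewrite /mu; lia.
have [|s [us ms [W hW]]] := IH u; first by lia.
have mus : {in u :: s, forall x, mu x < mu v}.
  by move=> x; rewrite inE => /predU1P[->//|/ms]; lia.
exists (u :: s); split=> //.
  by rewrite cons_uniq us andbT; apply/negP => /mus; rewrite ltnn.
have bW : b <= W + a.
  by rewrite -(@leq_pmul2l N) // mulnDr; lia.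
have bW' : N * b <= N * (W + a) by rewrite leq_mul2l bW orbT.
exists (W + a - b); rewrite mulnBr; move: bW' tuv hW; rewrite !mulnDr /=.
by move: (N * W) (N * a) (N * b); lia.
Qed.

Section Level.
Variables h W : E -> nat.
Hypothesis hWP : forall v, h v < #|E| /\ d v + h v = N * W v.

(** A tight arc moves by exactly one level of [h]. This is the form in which the absence of
    shortcuts is used. *)
Lemma tight_step u v a b : d v + N * b + 1 = d u + N * a ->
  h v = (h u).+1 /\ W v + b = W u + a.
Proof.
move=> tt; have [hu eu] := hWP u; have [hv ev] := hWP v.
have eq1 : N * (W v + b) + (h u).+1 = N * (W u + a) + h v by rewrite !mulnDr; lia.
have [lt|gt|eq2] := ltngtP (W v + b) (W u + a); last by rewrite eq2 in eq1; lia.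
- have : N * (W v + b).+1 <= N * (W u + a) by rewrite leq_mul2l lt orbT.
  by rewrite mulnS; lia.
- have : N * (W u + a).+1 <= N * (W v + b) by rewrite leq_mul2l gt orbT.
  by rewrite mulnS; lia.
Qed.

Lemma level_feasible u v a b : exch_arc u v a b -> W u + a <= W v + b.
Proof.
case: ld => fd _ _ /fd le1; have [hu eu] := hWP u; have [hv ev] := hWP v.
rewrite leqNgt; apply/negP => lt.
have : N * (W v + b).+1 <= N * (W u + a) by rewrite leq_mul2l lt orbT.
by rewrite mulnS !mulnDr; lia.
Qed.

Lemma level_le v : W v <= dl v.
Proof.
case: ld => _ bd _; have := bd v; have [hv ev] := hWP v => le1.
rewrite leqNgt; apply/negP => lt.
have : N * (dl v).+1 <= N * W v by rewrite leq_mul2l lt orbT.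
by rewrite mulnS; lia.
Qed.

Lemma level_mono u v : d u <= d v -> W u <= W v.
Proof.
have [hu eu] := hWP u; have [hv ev] := hWP v => le1.
rewrite leqNgt; apply/negP => lt.
have : N * (W v).+1 <= N * W u by rewrite leq_mul2l lt orbT.
by rewrite mulnS; lia.
Qed.

Lemma level_eq0 v : (h v == 0) = (d v == 0).
Proof.
have [hv ev] := hWP v; apply/eqP/eqP => [h0|d0]; last first.
  case: (posnP (W v)) => [w0|]; first by rewrite w0 muln0 in ev; lia.
  by case: (W v) ev => [//|w]; rewrite mulnS; lia.
case: ld => _ _ td; case: (posnP (d v)) => // /td[u [a [b [auv tuv]]]].
by have [] := tight_step tuv; rewrite h0.
Qed.

(** The gains are potentials for the unchanged pair: the free moves force the largest gain on
    [Y :\: X], and the bound by [dl] keeps gains zero on [X :\: Y]. *)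
Lemma certificate_level es : (forall v, d v <= d es) -> certificate X Y W (W es).
Proof.
case: ct => mX mY bd d0 dlam mes; split=> [|||v|v].
- apply: min_baseP => // e f nf.
  have /level_feasible : exch_arc f e (C e) (C f) by apply: Or31.
  by lia.
- apply: min_baseP => // e f nf.
  have /level_feasible : exch_arc e f (D e) (D f) by apply: Or32.
  by lia.
- by move=> v; apply: level_mono.
- by move=> /d0 dv; have := level_le v; rewrite dv leqn0 => /eqP.
- move=> hv; apply/eqP; rewrite eqn_leq level_mono //=.
  by have := @level_feasible es v 0 0; rewrite !addn0; apply; apply: Or33.
Qed.

End Level.

Lemma longest_stop es :
  (forall v, d v <= d es) -> d es = 0 -> exists dl', certificate X Y dl' 0.
Proof.
move=> mes d0; have [h [W hWP]] := longest_level; exists W.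
suff W0 : W es = 0 by rewrite -W0; apply: certificate_level hWP _ mes.
have [_ eW] := hWP es; have /eqP h0 : h es == 0 by rewrite (level_eq0 hWP) d0.
by move: eW; rewrite h0 d0 addn0 => /esym/eqP; rewrite muln_eq0 => /eqP.
Qed.

Lemma longest_le0 v : lam = 0 -> d v = 0.
Proof.
case: ct => _ _ bd _ _ l0; have := bd v; rewrite l0 leqn0 => /eqP dv.
by case: ld => _ le1 _; have := le1 v; rewrite dv muln0 leqn0 => /eqP.
Qed.

(** * Exchanging along a longest path *)

Section Path.
Variables (pr : E -> E) (es : E).
Local Notation p i := (iter i pr es).

(** The path is read backwards from its last element [es]. The arc from [p i.+1] to [p i] is an
    exchange in [X] if [p i] belongs to [X], and an exchange in [Y] otherwise. *)
Definition path_swapsX r := [seq (p i, p i.+1) | i <- iota 0 r & p i \in X].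
Definition path_swapsY r := [seq (p i.+1, p i) | i <- iota 0 r & p i \notin X].

Hypothesis prP : forall v, 0 < d v -> tight d (pr v) v.
Hypothesis mes : forall v, d v <= d es.
Hypothesis des : 0 < d es.
Variables h W : E -> nat.
Hypothesis hWP : forall v, h v < #|E| /\ d v + h v = N * W v.
Let r := h es.

Lemma path_level i : i <= r -> h (p i) + i = r.
Proof.
elim: i => [|i IH] ir; first by rewrite addn0.
have hi := IH (ltnW ir).
have /prP[a [b [ar tt]]] : 0 < d (p i).
  by rewrite lt0n -(level_eq0 hWP); apply/eqP; lia.
by have [] := tight_step hWP tt; rewrite iterS; lia.
Qed.

Lemma path_tight i : i < r -> tight d (p i.+1) (p i).
Proof.
move=> ir; apply: prP; rewrite lt0n -(level_eq0 hWP).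
by have := path_level (ltnW ir); apply: contraPneq => ->; lia.
Qed.

Lemma path_inj i j : i <= r -> j <= r -> p i = p j -> i = j.
Proof. by move=> /path_level hi /path_level hj eij; rewrite eij in hi; lia. Qed.

Lemma path_neq i : i < r -> p i.+1 != p i.
Proof. by move=> ir; apply/eqP => /(path_inj ir (ltnW ir)); lia. Qed.

(** Elements of [Y :\: X] have the largest gain, so by maximality of [d es] they are at least as
    many arcs deep as [es]; only [es] itself remains. No exchange arc enters an element of [Y :\: X]
    except from itself, and a tight free move into [es] would start at a larger distance. *)
Lemma path_notYX i : i <= r -> p i \notin Y :\: X.
Proof.
move=> ir; apply/negP => hi.
have Wi : W (p i) = W es by have [_ _ _ _ ->] := certificate_level hWP mes.
have [_ e1] := hWP es; have [_ e2] := hWP (p i); have := path_level ir.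
have := mes (p i); rewrite Wi in e2 => le1 hl.
have i0 : i = 0 by rewrite /r in hl; lia.
rewrite i0 /= in hi.
have [a [b [ar tt]]] := prP des; move: hi; rewrite inE => /andP[nX eY].
have ne : pr es != es.
  by apply: (@path_neq 0); rewrite /r lt0n (level_eq0 hWP) -lt0n.
case: ar => -[ar ea eb].
- by rewrite (base_out bX ar) in nX.
- by rewrite eq_sym in ne; rewrite (negbTE (base_in clP ar ne)) in eY.
- by have := mes (pr es); rewrite ea eb in tt; lia.
Qed.

(** An element of [X :\: Y] has distance zero, so it could only be the start of the path; but the
    arc leaving it would insert it into [X] or remove it from [Y]. *)
Lemma path_XY i : i <= r -> (p i \in X) = (p i \in Y).
Proof.
move=> ir; have := path_notYX ir; rewrite inE.
case iX: (p i \in X) => /=; last by move/negbTE => ->.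
move=> _; apply/esym; apply: contraT => niY.
have iXY : p i \in X :\: Y by rewrite inE iX niY.
have di : d (p i) = 0.
  case: ct => _ _ _ /(_ _ iXY) d0 _; case: ld => _ /(_ (p i)).
  by rewrite d0 muln0 leqn0 => /eqP.
have : h (p i) == 0 by rewrite (level_eq0 hWP) di.
have := path_level ir => hl /eqP h0.
case: i => [|i] in ir iX niY iXY di hl h0 *; first by move: des; rewrite di.
have [a [b [ar tt]]] := path_tight ir.
case: ar => -[ar ea eb].
- by rewrite (negbTE (base_in clP ar (path_neq ir))) in iX.
- by rewrite (base_out bY ar) in niY.
- by have := path_notYX (ltnW ir); rewrite ar.
Qed.

Lemma path_stepX i : i < r -> p i \in X ->
  [/\ p i.+1 \notin cl (X :\ p i), p i.+1 \notin X
    & d (p i) + N * C (p i.+1) + 1 = d (p i.+1) + N * C (p i)].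
Proof.
move=> ir iX; have [a [b [ar tt]]] := path_tight ir; have ne := path_neq ir.
case: ar => -[ar ea eb].
- by split; [|apply: (base_in clP ar)|rewrite -ea -eb].
- rewrite eq_sym in ne; have := base_in clP ar ne.
  by rewrite -(path_XY (ltnW ir)) iX.
- by have := path_notYX (ltnW ir); rewrite ar.
Qed.

Lemma path_stepY i : i < r -> p i \notin X ->
  [/\ p i \notin cl (Y :\ p i.+1), p i \notin Y, p i.+1 \in Y
    & d (p i) + N * D (p i) + 1 = d (p i.+1) + N * D (p i.+1)].
Proof.
move=> ir iX; have [a [b [ar tt]]] := path_tight ir; have ne := path_neq ir.
case: ar => -[ar ea eb].
- by rewrite (base_out bX ar) in iX.
- rewrite eq_sym in ne.
  by split; [|apply: (base_in clP ar)|apply: base_out ar|rewrite -ea -eb].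
- by have := path_notYX (ltnW ir); rewrite ar.
Qed.

Lemma path_swapsXP q : q \in path_swapsX r ->
  exists i, [/\ i < r, p i \in X & q = (p i, p i.+1)].
Proof.
by case/mapP => i; rewrite mem_filter mem_iota => /andP[iX ir] ->; exists i.
Qed.

Lemma path_swapsYP q : q \in path_swapsY r ->
  exists i, [/\ i < r, p i \notin X & q = (p i.+1, p i)].
Proof.
by case/mapP => i; rewrite mem_filter mem_iota => /andP[iX ir] ->; exists i.
Qed.

Lemma path_map_uniq (a : pred nat) (f : nat -> nat) : injective f ->
  (forall i, i < r -> f i <= r) -> uniq [seq p (f i) | i <- iota 0 r & a i].
Proof.
move=> fI fr; rewrite map_inj_in_uniq ?filter_uniq ?iota_uniq // => i j.
rewrite !mem_filter !mem_iota => /andP[_ ir] /andP[_ jr] /path_inj eij.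
by apply: fI; apply: eij; apply: fr.
Qed.

Let X' := foldl (@swap E) X (path_swapsX r).
Let Y' := foldl (@swap E) Y (path_swapsY r).

Let u1X : uniq (unzip1 (path_swapsX r)).
Proof. by rewrite /unzip1 -map_comp; apply: (@path_map_uniq _ id) => // i /ltnW. Qed.
Let u2X : uniq (unzip2 (path_swapsX r)).
Proof. by rewrite /unzip2 -map_comp; apply: (@path_map_uniq _ succn) => // i j []. Qed.
Let u1Y : uniq (unzip1 (path_swapsY r)).
Proof. by rewrite /unzip1 -map_comp; apply: (@path_map_uniq _ succn) => // i j []. Qed.
Let u2Y : uniq (unzip2 (path_swapsY r)).
Proof. by rewrite /unzip2 -map_comp; apply: (@path_map_uniq _ id) => // i /ltnW. Qed.

Let outX : {in path_swapsX r, forall q, q.1 \in X}.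
Proof. by move=> q /path_swapsXP[i [ir iX ->]]. Qed.
Let inX : {in path_swapsX r, forall q, q.2 \notin X}.
Proof. by move=> q /path_swapsXP[i [ir iX ->]]; case: (path_stepX ir iX). Qed.
Let outY : {in path_swapsY r, forall q, q.1 \in Y}.
Proof. by move=> q /path_swapsYP[i [ir iX ->]]; case: (path_stepY ir iX). Qed.
Let inY : {in path_swapsY r, forall q, q.2 \notin Y}.
Proof. by move=> q /path_swapsYP[i [ir iX ->]]; case: (path_stepY ir iX). Qed.

(** If the insertion of pair [j] fits the removal of pair [i], there is an arc from [p j.+1] to
    [p i]. Its feasibility compares the two keys; equality makes it tight, and then the levels give
    [i = j]. *)
Lemma path_baseX : base cl X'.
Proof.
apply: (@base_keyed_swaps _ _ clP (fun q => (d q.1)%:Z - (N * C q.1)%:Z)%R) => //.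
- exact: map_uniq u1X.
- by move=> q /path_swapsXP[i [ir iX ->]]; case: (path_stepX ir iX).
move=> q q' /path_swapsXP[i [ir iX ->]] /path_swapsXP[j [jr jX ->]] /= nij.
have [_ _ tj] := path_stepX jr jX.
have ar : exch_arc (p j.+1) (p i) (C (p i)) (C (p j.+1)) by apply: Or31.
have fij : d (p j.+1) + N * C (p i) <= d (p i) + N * C (p j.+1) + 1.
  by case: ld => fd _ _; apply: fd ar.
split; first by move: tj fij; move: (N * _) (N * _) (N * _); lia.
move=> eqk; have tij : d (p i) + N * C (p j.+1) + 1 = d (p j.+1) + N * C (p i).
  by move: tj fij eqk; move: (N * _) (N * _) (N * _); lia.
have [eh _] := tight_step hWP tij.
have hi := path_level (ltnW ir); have hj := path_level jr.
by have -> : i = j by lia.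
Qed.

(** As for [X], except that the removed element is now the tail of its arc instead of the head,
    which reverses the sign of the distance in the key. *)
Lemma path_baseY : base cl Y'.
Proof.
apply: (@base_keyed_swaps _ _ clP (fun q => - (d q.1 + N * D q.1)%:Z)%R) => //.
- exact: map_uniq u1Y.
- by move=> q /path_swapsYP[i [ir iX ->]]; case: (path_stepY ir iX).
move=> q q' /path_swapsYP[i [ir iX ->]] /path_swapsYP[j [jr jX ->]] /= nij.
have [_ _ _ tj] := path_stepY jr jX.
have ar : exch_arc (p i.+1) (p j) (D (p i.+1)) (D (p j)) by apply: Or32.
have fij : d (p i.+1) + N * D (p i.+1) <= d (p j) + N * D (p j) + 1.
  by case: ld => fd _ _; apply: fd ar.
split; first by move: tj fij; rewrite !iterS; move: (N * _) (N * _) (N * _); lia.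
move=> eqk.
have tij : d (p j) + N * D (p j) + 1 = d (p i.+1) + N * D (p i.+1).
  by move: tj fij eqk; rewrite !iterS; move: (N * _) (N * _) (N * _); lia.
have [eh _] := tight_step hWP tij.
have hi := path_level ir; have hj := path_level (ltnW jr).
by have -> : i = j by lia.
Qed.

Lemma mem_path_unzip1X i : i <= r ->
  (p i \in unzip1 (path_swapsX r)) = (p i \in X) && (i < r).
Proof.
move=> ir; rewrite /unzip1 -map_comp; apply/mapP/andP => [[j]|[iX ir']].
  rewrite mem_filter mem_iota => /andP[jX /= jr] /(path_inj ir) ->; last exact: ltnW.
  by rewrite jX.
by exists i => //; rewrite mem_filter iX mem_iota.
Qed.

Lemma mem_path_unzip2X i : i <= r ->
  (p i \in unzip2 (path_swapsX r)) = (0 < i) && (p i.-1 \in X).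
Proof.
move=> ir; rewrite /unzip2 -map_comp; apply/mapP/andP => [[j]|[i0 iX]].
  by rewrite mem_filter mem_iota => /andP[jX /= jr] /(@path_inj i j.+1 ir jr) ->.
exists i.-1; first by rewrite mem_filter iX mem_iota; lia.
by rewrite /= -iterS prednK.
Qed.

Lemma mem_path_unzip1Y i : i <= r ->
  (p i \in unzip1 (path_swapsY r)) = (0 < i) && (p i.-1 \notin X).
Proof.
move=> ir; rewrite /unzip1 -map_comp; apply/mapP/andP => [[j]|[i0 iX]].
  by rewrite mem_filter mem_iota => /andP[jX /= jr] /(@path_inj i j.+1 ir jr) ->.
exists i.-1; first by rewrite mem_filter iX mem_iota; lia.
by rewrite /= -iterS prednK.
Qed.

Lemma mem_path_unzip2Y i : i <= r ->
  (p i \in unzip2 (path_swapsY r)) = (p i \notin X) && (i < r).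
Proof.
move=> ir; rewrite /unzip2 -map_comp; apply/mapP/andP => [[j]|[iX ir']].
  rewrite mem_filter mem_iota => /andP[jX /= jr] /(path_inj ir) ->; last exact: ltnW.
  by rewrite jX.
by exists i => //; rewrite mem_filter iX mem_iota.
Qed.

Lemma path_alternates i : 0 < i -> i <= r -> (p i.-1 \in X) = (p i \notin X).
Proof.
case: i => [//|i] _ ir; rewrite [i.+1.-1]/=.
case iX: (p i \in X); first by case: (path_stepX ir iX) => _ ->.
have [_ _ iY _] := path_stepY ir (negbT iX).
by rewrite (path_XY ir) iY.
Qed.

(** Each interior element takes part in one exchange in [X] and one in [Y], so it enters or leaves
    both; the ends take part in one exchange only. *)
Lemma mem_pathX' i : i <= r -> (p i \in X') = if p i \in X then i == r else 0 < i.
Proof.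
move=> ir; rewrite /X' swapsE // in_setU in_setD ![_ \in [set _ in _]]inE.
rewrite mem_path_unzip1X // mem_path_unzip2X //.
have ei : (i == r) = ~~ (i < r) by rewrite eqn_leq ir -leqNgt.
case: (posnP i) => [i0|i0] /=; first by case: ifP => iX; rewrite /= ?andbT ?andbF ?orbF ?ei.
by rewrite path_alternates // ei; case: ifP => iX /=; rewrite ?andbT ?andbF ?orbF.
Qed.

Lemma mem_pathY' i : i <= r -> (p i \in Y') = if p i \in X then i == 0 else i < r.
Proof.
move=> ir; rewrite /Y' swapsE // in_setU in_setD ![_ \in [set _ in _]]inE.
rewrite mem_path_unzip1Y // mem_path_unzip2Y // -path_XY //.
case: (posnP i) => [i0|i0] /=.
  by case: ifP => iX; rewrite /= ?andbT ?andbF ?orbF ?i0.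
rewrite path_alternates //.
by case: ifP => iX /=; rewrite ?andbT ?andbF ?orbF.
Qed.

Lemma mem_path' x : (forall i, i <= r -> x != p i) ->
  (x \in X') = (x \in X) /\ (x \in Y') = (x \in Y).
Proof.
move=> nx; rewrite /X' /Y' !swapsE // !in_setU !in_setD ![_ \in [set _ in _]]inE.
have n1 (a : pred nat) (f : nat -> nat) : (forall i, i < r -> f i <= r) ->
    (x \in [seq p (f i) | i <- iota 0 r & a i]) = false.
  move=> fr; apply/mapP => -[i]; rewrite mem_filter mem_iota => /andP[_ /= ir].
  by move/eqP; apply/negP; apply: nx; apply: fr.
rewrite /unzip1 /unzip2 -!map_comp.
rewrite (n1 _ id) ?(n1 _ succn) /= ?orbF //; last by move=> i /ltnW.
by rewrite (n1 _ id) ?(n1 _ succn) /= ?orbF //; last by move=> i /ltnW.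
Qed.

Let r0 : 0 < r.
Proof. by rewrite /r lt0n (level_eq0 hWP) -lt0n. Qed.

Lemma path_onP x :
  (exists2 i, i <= r & x = p i) \/ (forall i, i <= r -> x != p i).
Proof.
have [/mapP[i]|nx] := boolP (x \in [seq p i | i <- iota 0 r.+1]).
  by rewrite mem_iota => /andP[_ ir] ->; left; exists i.
right=> i ir; apply: contraNneq nx => ->; apply/mapP; exists i => //.
by rewrite mem_iota.
Qed.

Lemma path_diffYX : Y' :\: X' = es |: (Y :\: X).
Proof.
apply/setP => x; rewrite in_setU1 !in_setD.
have [[i ir ->]|nx] := path_onP x; last first.
  by have [-> ->] := mem_path' nx; rewrite (negbTE (nx 0 _)).
have -> : (p i == es) = (i == 0).
  by apply/eqP/eqP => [/(path_inj ir (leq0n r))|->].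
rewrite mem_pathX' // mem_pathY' // -path_XY // andNb orbF.
by case: ifP => _; lia.
Qed.

Lemma path_diffXY : X' :\: Y' = p r |: (X :\: Y).
Proof.
apply/setP => x; rewrite in_setU1 !in_setD.
have [[i ir ->]|nx] := path_onP x; last first.
  by have [-> ->] := mem_path' nx; rewrite (negbTE (nx r _)).
have -> : (p i == p r) = (i == r).
  by apply/eqP/eqP => [/(path_inj ir (leqnn r))|->].
rewrite mem_pathX' // mem_pathY' // -path_XY // andNb orbF.
by case: ifP => _; lia.
Qed.

(** Tight arcs join elements of equal modified cost, so the exchanges keep both weights and with
    them minimality. The new element [es] of [Y' :\: X'] has gain [W es], and the new element of
    [X' :\: Y'] has gain 0. *)
Lemma path_augments :
  certificate X' Y' W (W es) /\ #|Y' :\: X'| = #|Y :\: X|.+1.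
Proof.
have [[_ mX] [_ mY] bd d0 dlam] := certificate_level hWP mes.
split; last first.
  by rewrite path_diffYX cardsU1 (path_notYX (leq0n r)).
split=> //.
- split; first exact: path_baseX.
  move=> T /mX; rewrite sum_swaps // => q /path_swapsXP[i [ir iX ->]] /=.
  have [nX _ tt] := path_stepX ir iX.
  have ar : exch_arc (p i.+1) (p i) (C (p i)) (C (p i.+1)) by apply: Or31.
  have [_] := tight_step hWP tt; rewrite -iterS; lia.
- split; first exact: path_baseY.
  move=> T /mY; rewrite sum_swaps // => q /path_swapsYP[i [ir iX ->]] /=.
  have [nX _ _ tt] := path_stepY ir iX.
  have ar : exch_arc (p i.+1) (p i) (D (p i.+1)) (D (p i)) by apply: Or32.
  have [_] := tight_step hWP tt; rewrite -iterS; lia.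
- move=> e; rewrite path_diffXY in_setU1 => /predU1P[->|/d0 //].
  have hr : h (p r) = 0 by have := path_level (leqnn r); lia.
  have dr : d (p r) = 0 by apply/eqP; rewrite -(level_eq0 hWP) hr.
  have [_] := hWP (p r); rewrite dr hr addn0 => /esym/eqP.
  by rewrite muln_eq0 => /eqP.
- by move=> e; rewrite path_diffYX in_setU1 => /predU1P[->|/dlam].
Qed.

End Path.

Lemma longest_augment (pr : E -> E) es :
    (forall v, 0 < d v -> tight d (pr v) v) -> (forall v, d v <= d es) ->
    0 < d es ->
  exists r, [/\ r < #|E|, forall i, i < r -> 0 < d (iter i pr es),
                d (iter r pr es) = 0
    & let X' := foldl (@swap E) X (path_swapsX pr es r) in
      let Y' := foldl (@swap E) Y (path_swapsY pr es r) in
      exists dl' lam', certificate X' Y' dl' lam' /\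
                       #|Y' :\: X'| = #|Y :\: X|.+1].
Proof.
move=> prP mes des; have [h [W hWP]] := longest_level.
exists (h es); have [hes _] := hWP es; split=> //.
- move=> i ir; rewrite lt0n -(level_eq0 hWP).
  by have := path_level prP des hWP (ltnW ir); apply: contraPneq => ->; lia.
- apply/eqP; rewrite -(level_eq0 hWP).
  by have := path_level prP des hWP (leqnn (h es)); lia.
- by exists W, (W es); apply: path_augments.
Qed.

(* [h v] is the number of Bellman-Ford sweeps after which [v] has its final
   value. *)
Lemma longest_sweeps : exists h : E -> nat,
  [/\ forall v, h v < #|E|, forall v, h v = 0 -> d v = 0
    & forall v, 0 < h v -> exists u a b,
        [/\ exch_arc u v a b, d v + N * b + 1 = d u + N * a & h v = (h u).+1]].
Proof.
have [h [W hWP]] := longest_level; exists h; split=> v; first by case: (hWP v).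
  by move/eqP; rewrite (level_eq0 hWP) => /eqP.
rewrite lt0n (level_eq0 hWP) -lt0n; case: ld => _ _ td /td[u [a [b [ar tt]]]].
by exists u, a, b; split=> //; case: (tight_step hWP tt).
Qed.

End Step.
End Augmentation.

(** * A structured language for random access machines *)

Section Language.
Local Open Scope nat_scope.

Definition memory : Type := nat -> nat -> nat.

Definition setm (s : memory) (a i x : nat) : memory :=
  fun a' i' => if (a' == a) && (i' == i) then x else s a' i'.

Inductive expr : Type :=
  | EConst of nat
  | EGet of nat & expr
  | EAdd of expr & expr
  | ESub of expr & expr
  | EHalf of expr
  | ERead of expr.

(** [BitLen] is primitive because its halving loop has to run before the input size, the bound of
    the main loops, is known. *)
Inductive stmt : Type :=
  | Skip
  | Assign of nat & expr & expr
  | BitLen of nat & expr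
  | Seq of stmt & stmt
  | If of expr & stmt & stmt
  | For of nat & stmt
  | Print of expr.

Fixpoint eval (w : seq nat) (s : memory) (e : expr) : nat :=
  match e with
  | EConst n => n
  | EGet a e => s a (eval w s e)
  | EAdd e1 e2 => eval w s e1 + eval w s e2
  | ESub e1 e2 => eval w s e1 - eval w s e2
  | EHalf e => (eval w s e)./2
  | ERead e => nth 0 w (eval w s e)
  end.

(* All loops share one bound, the value of the variable [b]: this alone makes
   every statement run in time polynomial in that value. *)
Fixpoint exec (w : seq nat) (b : nat) (c : stmt) (s : memory) : memory :=
  match c with
  | Skip | Print _ => s
  | Assign a e1 e2 => setm s a (eval w s e1) (eval w s e2)
  | BitLen a e => setm s a 0 (bit_length (nth 0 w (eval w s e)))
  | Seq c1 c2 => exec w b c2 (exec w b c1 s)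
  | If e c1 c2 => if 0 < eval w s e then exec w b c1 s else exec w b c2 s
  | For i c =>
      setm (iteri (s b 0) (fun j s => exec w b c (setm s i 0 j)) s) i 0 (s b 0)
  end.

Fixpoint prints (w : seq nat) (b : nat) (c : stmt) (s : memory) : seq nat :=
  match c with
  | Skip | Assign _ _ _ | BitLen _ _ => [::]
  | Print e => [:: eval w s e]
  | Seq c1 c2 => prints w b c1 s ++ prints w b c2 (exec w b c1 s)
  | If e c1 c2 => if 0 < eval w s e then prints w b c1 s else prints w b c2 s
  | For i c => flatten
      [seq prints w b c
         (setm (iteri j (fun j s => exec w b c (setm s i 0 j)) s) i 0 j)
      | j <- iota 0 (s b 0)]
  end.

Fixpoint writes (c : stmt) : seq nat :=
  match c with
  | Skip | Print _ => [::]
  | Assign a _ _ | BitLen a _ => [:: a]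
  | Seq c1 c2 | If _ c1 c2 => writes c1 ++ writes c2
  | For i c => i :: writes c
  end.

Lemma setmE s a i x : setm s a i x a i = x.
Proof. by rewrite /setm !eqxx. Qed.

Lemma setm_neq s a i x a' : a' != a -> setm s a i x a' = s a'.
Proof. by move=> ne; rewrite /setm (negbTE ne). Qed.

Lemma exec_frame w b c s a : a \notin writes c -> exec w b c s a = s a.
Proof.
elim: c s => //= [a' e1 e2|a' e|c1 IH1 c2 IH2|e c1 IH1 c2 IH2|i c IH] s.
- by rewrite inE => /setm_neq ->.
- by rewrite inE => /setm_neq ->.
- by rewrite mem_cat negb_or => /andP[n1 n2]; rewrite IH2 // IH1.
- by rewrite mem_cat negb_or => /andP[n1 n2]; case: ifP => _; rewrite ?IH1 ?IH2.
- rewrite inE negb_or => /andP[ni nc]; rewrite setm_neq //.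
  by elim: (s b 0) => //= j IHj; rewrite IH // setm_neq.
Qed.

(* Variable [a] at index [i] lives in register [64 * i + a]; variables are
   below 32, and registers 32, ..., 63 are the evaluation stack. *)
Definition addr (d a : nat) : program :=
  nseq 6 (iadd (32 + d) (32 + d) (32 + d)) ++
  [:: iconst (33 + d) a; iadd (32 + d) (32 + d) (33 + d)].

Fixpoint cexpr (d : nat) (e : expr) : program :=
  match e with
  | EConst n => [:: iconst (32 + d) n]
  | EGet a e => cexpr d e ++ addr d a ++ [:: iload (32 + d) (32 + d)]
  | EAdd e1 e2 =>
      cexpr d e1 ++ cexpr d.+1 e2 ++ [:: iadd (32 + d) (32 + d) (33 + d)]
  | ESub e1 e2 =>
      cexpr d e1 ++ cexpr d.+1 e2 ++ [:: isub (32 + d) (32 + d) (33 + d)]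
  | EHalf e => cexpr d e ++ [:: ihalf (32 + d) (32 + d)]
  | ERead e => cexpr d e ++ [:: iread (32 + d) (32 + d)]
  end.

Fixpoint wf_expr (d : nat) (e : expr) : bool :=
  match e with
  | EConst n => d < 31
  | EGet a e => [&& a < 32, d < 31 & wf_expr d e]
  | EAdd e1 e2 | ESub e1 e2 => [&& d < 31, wf_expr d e1 & wf_expr d.+1 e2]
  | EHalf e | ERead e => (d < 31) && wf_expr d e
  end.

(** An unconditional jump is a conditional one on register 32 just set to 1. In [BitLen] the last
    addition is a mere copy, since register 32 is zero when the halving loop ends. Entry 0 of a
    variable is the register of the same number, so loop counters are accessed without address
    computation. *)
Fixpoint cstmt (b off : nat) (c : stmt) : program :=
  match c with
  | Skip => [::]
  | Assign a e1 e2 => cexpr 0 e1 ++ addr 0 a ++ cexpr 1 e2 ++ [:: istore 32 33]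
  | BitLen a e =>
      let ce := cexpr 0 (ERead e) in
      ce ++ [:: iconst 33 0; iconst 34 1; ihalf 32 32; iadd 33 33 34;
                ijpos 32 (off + size ce + 2); iadd a 33 32]
  | Seq c1 c2 =>
      let p1 := cstmt b off c1 in p1 ++ cstmt b (off + size p1) c2
  | If e c1 c2 =>
      let ce := cexpr 0 e in
      let p2 := cstmt b (off + (size ce).+1) c2 in
      let l1 := off + (size ce + size p2 + 3) in
      let p1 := cstmt b l1 c1 in
      ce ++ ijpos 32 l1 :: p2 ++
      [:: iconst 32 1; ijpos 32 (l1 + size p1)] ++ p1
  | For i c =>
      let p := cstmt b (off + 5) c in
      [:: iconst i 0; isub 32 b i; ijpos 32 (off + 5); iconst 32 1;
          ijpos 32 (off + 5 + size p + 3)] ++ p ++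
      [:: iconst 32 1; iadd i i 32; ijpos 32 (off + 1)]
  | Print e => cexpr 0 e ++ [:: iprint 32]
  end.

(** The bound variable is never written and a loop body leaves its counter alone, so the number of
    rounds is fixed on entry. *)
Fixpoint wf (b : nat) (c : stmt) : bool :=
  match c with
  | Skip => true
  | Assign a e1 e2 => [&& a != b, a < 32, wf_expr 0 e1 & wf_expr 1 e2]
  | BitLen a e => [&& a != b, a < 32 & wf_expr 0 e]
  | Seq c1 c2 => wf b c1 && wf b c2
  | If e c1 c2 => [&& wf_expr 0 e, wf b c1 & wf b c2]
  | For i c => [&& i != b, i < 32, i \notin writes c & wf b c]
  | Print e => wf_expr 0 e
  end.

Lemma wf_writes b c : wf b c -> b \notin writes c.
Proof.
elim: c => //= [a e1 e2|a e|c1 IH1 c2 IH2|e c1 IH1 c2 IH2|i c IH].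
- by case/and4P => ne _ _ _; rewrite inE eq_sym.
- by case/and3P => ne _ _; rewrite inE eq_sym.
- by case/andP => /IH1 n1 /IH2 n2; rewrite mem_cat negb_or n1.
- by case/and3P => _ /IH1 n1 /IH2 n2; rewrite mem_cat negb_or n1.
- by case/and4P => ne _ _ /IH nc; rewrite inE negb_or eq_sym ne.
Qed.

Fixpoint loop_depth (c : stmt) : nat :=
  match c with
  | Skip | Assign _ _ _ | Print _ => 0
  | BitLen _ _ => 1
  | Seq c1 c2 | If _ c1 c2 => maxn (loop_depth c1) (loop_depth c2)
  | For _ c => (loop_depth c).+1
  end.

(** The coefficient of the time bound; the exponent is [loop_depth]. A round of a loop has five
    control instructions, entry and exit take five more, and the halving loop of [BitLen] spends
    three per bit. *)
Fixpoint cost (c : stmt) : nat :=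
  match c with
  | Skip => 0
  | Assign a e1 e2 => size (cstmt 0 0 c)
  | Print e => size (cstmt 0 0 c)
  | BitLen a e => size (cstmt 0 0 c) + 3
  | Seq c1 c2 => cost c1 + cost c2
  | If e c1 c2 => size (cexpr 0 e) + 3 + cost c1 + cost c2
  | For _ c => cost c + 10
  end.

(** * Simulation of statements by the machine *)

Section Machine.
Variables (p : program) (w : seq nat).

Definition reach (s : config) (t : nat) (s' : config) : Prop :=
  iter t (step p w) s = s'.

Lemma reach_trans s1 t1 s2 t2 s3 :
  reach s1 t1 s2 -> reach s2 t2 s3 -> reach s1 (t1 + t2) s3.
Proof. by rewrite /reach => <- <-; rewrite addnC iterD. Qed.

Definition code_at (off : nat) (c : program) : Prop :=
  exists p1 p2, p = p1 ++ c ++ p2 /\ size p1 = off.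

Lemma code_at_cat off c1 c2 : code_at off (c1 ++ c2) ->
  code_at off c1 /\ code_at (off + size c1) c2.
Proof.
move=> [p1 [p2 [ep <-]]]; split; first by exists p1, (c2 ++ p2); rewrite ep !catA.
by exists (p1 ++ c1), p2; rewrite ep !catA size_cat.
Qed.

Lemma code_at_cons off ins c :
  code_at off (ins :: c) -> onth p off = Some ins /\ code_at off.+1 c.
Proof.
move=> [p1 [p2 [ep <-]]]; split; last first.
  by exists (rcons p1 ins), p2; rewrite size_rcons cat_rcons.
by rewrite ep; elim: p1 {ep} => [|x p1 IH] //=.
Qed.

Lemma reachS off ins r o t s' : onth p off = Some ins ->
  reach (exec_instr w ins (Config off r o)) t s' ->
  reach (Config off r o) t.+1 s'.
Proof. by move=> h <-; rewrite /reach iterSr; congr iter; rewrite /step /= h. Qed.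

Definition agree (s : memory) (r : nat -> nat) : Prop :=
  forall a i, a < 32 -> r (64 * i + a) = s a i.

Lemma agree_upd s r j x : 32 <= j < 64 -> agree s r -> agree s (upd r j x).
Proof.
move=> hj ag a i ha; rewrite /upd; case: eqP => [e|_]; last exact: ag.
by lia.
Qed.

Lemma agree_set s r a i x :
  a < 32 -> agree s r -> agree (setm s a i x) (upd r (64 * i + a) x).
Proof.
move=> ha ag a' i' ha'; rewrite /upd /setm.
have -> : (64 * i' + a' == 64 * i + a) = (a' == a) && (i' == i) by lia.
by case: ifP => // _; apply: ag.
Qed.

Lemma updE r i x : upd r i x i = x. Proof. by rewrite /upd eqxx. Qed.

Lemma upd_neq r i x j : j != i -> upd r i x j = r j.
Proof. by rewrite /upd => /negbTE ->. Qed.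

Lemma reach_addr off d a r o : code_at off (addr d a) ->
  exists r', [/\ reach (Config off r o) (size (addr d a))
                   (Config (off + size (addr d a)) r' o),
    r' (32 + d) = 64 * r (32 + d) + a
    & forall j, j != 32 + d -> j != 33 + d -> r' j = r j].
Proof.
move=> h; rewrite /addr /= in h *; have [s0 h1] := code_at_cons h.
have [s1 h2] := code_at_cons h1; have [s2 h3] := code_at_cons h2.
have [s3 h4] := code_at_cons h3; have [s4 h5] := code_at_cons h4.
have [s5 h6] := code_at_cons h5; have [s6 h7] := code_at_cons h6.
have [s7 h8] := code_at_cons h7.
eexists; split.
- rewrite -[8]/(0.+4.+4) 4!addnS 4!addnS addn0.
  apply: (reachS s0); apply: (reachS s1); apply: (reachS s2); apply: (reachS s3).
  apply: (reachS s4); apply: (reachS s5); apply: (reachS s6); apply: (reachS s7).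
  by rewrite /reach /=; reflexivity.
- rewrite !updE /upd !eqxx.
  have -> : (32 + d == 33 + d) = false by lia.
  by rewrite /=; lia.
- by move=> j n1 n2; rewrite !upd_neq.
Qed.

Local Opaque addr.

Lemma reach_expr e d off s r o :
    wf_expr d e -> code_at off (cexpr d e) -> agree s r ->
  exists r', [/\ reach (Config off r o) (size (cexpr d e))
                   (Config (off + size (cexpr d e)) r' o),
    agree s r', r' (32 + d) = eval w s e
    & forall j, j < d -> r' (32 + j) = r (32 + j)].
Proof.
elim: e d off r => [n|a e IH|e1 IH1 e2 IH2|e1 IH1 e2 IH2|e IH|e IH] d off r.
- move=> /= hd h ag; have [s0 _] := code_at_cons h.
  exists (upd r (32 + d) n); split.
  + by rewrite addn1; apply: (reachS s0).
  + by apply: agree_upd => //; lia.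
  + by rewrite updE.
  + by move=> j jd; rewrite upd_neq //; lia.
- move=> /= /and3P[ha hd wfe] hc ag.
  have [h1 hc1] := code_at_cat hc; have [h2 h3] := code_at_cat hc1.
  have [r1 [R1 ag1 e1 f1]] := IH _ _ _ wfe h1 ag.
  have [r2 [R2 e2 f2]] := reach_addr r1 o h2.
  have [s3 _] := code_at_cons h3.
  have ag2 : agree s r2.
    by move=> a' i ha'; rewrite f2; [apply: ag1| |]; lia.
  exists (upd r2 (32 + d) (s a (eval w s e))); split.
  + rewrite 2!size_cat !addnA; apply: reach_trans (reach_trans R1 R2) _.
    by rewrite addn1; apply: (reachS s3); rewrite /= e2 e1 ag2.
  + by apply: agree_upd => //; lia.
  + by rewrite updE.
  + by move=> j jd; rewrite upd_neq ?f2 ?f1 //; lia.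
- move=> /= /and3P[hd wf1 wf2] hc ag.
  have [h1 hc1] := code_at_cat hc; have [h2 h3] := code_at_cat hc1.
  have [r1 [R1 ag1 e1' f1]] := IH1 _ _ _ wf1 h1 ag.
  have [r2 [R2 ag2 e2' f2]] := IH2 _ _ _ wf2 h2 ag1.
  have [s3 _] := code_at_cons h3.
  exists (upd r2 (32 + d) (eval w s e1 + eval w s e2)); split.
  + rewrite !size_cat !addnA; apply: reach_trans (reach_trans R1 R2) _.
    rewrite addn1; apply: (reachS s3); rewrite /= f2 // e1'.
    by have -> : 33 + d = 32 + d.+1 by []; rewrite e2'.
  + by apply: agree_upd => //; lia.
  + by rewrite updE.
  + by move=> j jd; rewrite upd_neq ?f2 ?f1 //; lia.
- move=> /= /and3P[hd wf1 wf2] hc ag.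
  have [h1 hc1] := code_at_cat hc; have [h2 h3] := code_at_cat hc1.
  have [r1 [R1 ag1 e1' f1]] := IH1 _ _ _ wf1 h1 ag.
  have [r2 [R2 ag2 e2' f2]] := IH2 _ _ _ wf2 h2 ag1.
  have [s3 _] := code_at_cons h3.
  exists (upd r2 (32 + d) (eval w s e1 - eval w s e2)); split.
  + rewrite !size_cat !addnA; apply: reach_trans (reach_trans R1 R2) _.
    rewrite addn1; apply: (reachS s3); rewrite /= f2 // e1'.
    by have -> : 33 + d = 32 + d.+1 by []; rewrite e2'.
  + by apply: agree_upd => //; lia.
  + by rewrite updE.
  + by move=> j jd; rewrite upd_neq ?f2 ?f1 //; lia.
- move=> /= /andP[hd wfe] hc ag.
  have [h1 h3] := code_at_cat hc.
  have [r1 [R1 ag1 e1 f1]] := IH _ _ _ wfe h1 ag.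
  have [s3 _] := code_at_cons h3.
  exists (upd r1 (32 + d) (eval w s e)./2); split.
  + rewrite !size_cat !addnA; apply: reach_trans R1 _.
    by rewrite addn1; apply: (reachS s3); rewrite /= e1.
  + by apply: agree_upd => //; lia.
  + by rewrite updE.
  + by move=> j jd; rewrite upd_neq ?f1 //; lia.
- move=> /= /andP[hd wfe] hc ag.
  have [h1 h3] := code_at_cat hc.
  have [r1 [R1 ag1 e1 f1]] := IH _ _ _ wfe h1 ag.
  have [s3 _] := code_at_cons h3.
  exists (upd r1 (32 + d) (nth 0 w (eval w s e))); split.
  + rewrite !size_cat !addnA; apply: reach_trans R1 _.
    by rewrite addn1; apply: (reachS s3); rewrite /= e1.
  + by apply: agree_upd => //; lia.
  + by rewrite updE.
  + by move=> j jd; rewrite upd_neq ?f1 //; lia.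
Qed.

Lemma bit_length_half x : 1 < x -> bit_length x = (bit_length x./2).+1.
Proof. by move=> x1; rewrite /bit_length trunc_log2S. Qed.

(** The body runs before the test, so zero takes one round, in agreement with [bit_length 0 = 1]. *)
Lemma reach_bits l c r o :
    code_at l [:: ihalf 32 32, iadd 33 33 34, ijpos 32 l & c] -> r 34 = 1 ->
  exists r', [/\ reach (Config l r o) (3 * bit_length (r 32)) (Config (l + 3) r' o),
    r' 33 = r 33 + bit_length (r 32), r' 32 = 0
    & forall j, j != 32 -> j != 33 -> r' j = r j].
Proof.
move=> h; have [s0 h1] := code_at_cons h.
have [s1 h2] := code_at_cons h1; have [s2 h3] := code_at_cons h2.
have [k] := ubnP (r 32); elim: k r => [//|k IH] r hk r34.
pose r1 := upd (upd r 32 (r 32)./2) 33 (r 33 + 1).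
have R1 : reach (Config l r o) 3
    (Config (if 0 < (r 32)./2 then l else l.+3) r1 o).
  apply: (reachS s0); apply: (reachS s1); apply: (reachS s2).
  by rewrite /reach /= /r1 /upd /= r34.
have [x1|x1] := leqP (r 32) 1.
  exists r1; split.
  - have -> : bit_length (r 32) = 1 by case: (r 32) x1 => [|[|]].
    move: R1; rewrite (_ : (r 32)./2 = 0) /=; last by case: (r 32) x1 => [|[|]].
    by rewrite addn3.
  - by rewrite /r1 updE; case: (r 32) x1 => [|[|]].
  - by rewrite /r1 /upd /=; case: (r 32) x1 => [|[|]].
  - by move=> j n1 n2; rewrite /r1 !upd_neq.
have hx : 0 < (r 32)./2 by lia.
rewrite hx in R1.
have [||r' [R2 e1 e2 f2]] := IH r1.
- by rewrite /r1 /upd /=; lia.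
- by rewrite /r1 /upd /=.
exists r'; split=> //.
- rewrite bit_length_half // mulnS; apply: reach_trans R1 _.
  by move: R2; rewrite /r1 /upd.
- by rewrite e1 (bit_length_half x1) /r1 /upd /=; lia.
- by move=> j n1 n2; rewrite f2 // /r1 !upd_neq.
Qed.

Definition stmt_ok b S c : Prop := forall off s r o,
    wf b c -> code_at off (cstmt b off c) -> agree s r ->
    s b 0 <= S -> input_size w <= S ->
  exists t r', [/\ t <= cost c * S.+1 ^ loop_depth c,
    reach (Config off r o) t
      (Config (off + size (cstmt b off c)) r' (o ++ prints w b c s))
    & agree (exec w b c s) r'].

Lemma stmt_ok_skip b S  : stmt_ok b S Skip.
Proof.
move=> off s r o.
move=> _ _ ag _ _; exists 0, r; split=> //.
by rewrite /reach /= addn0 cats0.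
Qed.

Lemma stmt_ok_assign b S a e1 e2 : stmt_ok b S (Assign a e1 e2).
Proof.
move=> off s r o.
move=> /= /and4P[_ a32 wf1 wf2] hc ag _ _.
have [h1 hc1] := code_at_cat hc; have [h2 hc2] := code_at_cat hc1.
have [h3 h4] := code_at_cat hc2.
have [r1 [R1 ag1 q1 f1]] := reach_expr o wf1 h1 ag.
have [r2 [R2 q2 f2]] := reach_addr r1 o h2.
have ag2 : agree s r2 by move=> a' j ha'; rewrite f2; [apply: ag1| |]; lia.
have [r3 [R3 ag3 q3 f3]] := reach_expr o wf2 h3 ag2.
have [s4 _] := code_at_cons h4.
exists (size (cstmt b off (Assign a e1 e2))), (upd r3 (64 * eval w s e1 + a) (eval w s e2)).
split; first by rewrite muln1.
+ rewrite cats0 /= 2!size_cat [size (cexpr 1 e2 ++ _)]size_cat !addnA.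
  apply: reach_trans (reach_trans (reach_trans R1 R2) R3) _.
  rewrite addn1; apply: (reachS s4) => /=.
  by have := f3 0 isT; have := q3; rewrite /= => -> ->; rewrite q2 q1.
+ exact: agree_set.
Qed.

Lemma stmt_ok_bitlen b S a e : stmt_ok b S (BitLen a e).
Proof.
move=> off s r o.
move=> /= /and3P[ab a32 wfe] hc ag _ wS.
have [h1 h2] := code_at_cat hc.
have wfe' : wf_expr 0 (ERead e) by [].
have [r1 [R1 ag1 q1 f1]] := reach_expr o wfe' h1 ag.
have [s1 h3] := code_at_cons h2; have [s2 h4] := code_at_cons h3.
set ce := cexpr 0 e ++ [:: iread (32 + 0) (32 + 0)] in h1 h2 h3 h4 s1 s2 *.
have le : (off + size ce).+2 = off + size ce + 2 by lia.
rewrite le in h4.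
pose r2 := upd (upd r1 33 0) 34 1.
have [//|r3 [R3 q3 z3 f3]] := reach_bits (r := r2) o h4.
have [_ h5] := code_at_cons h4; have [_ h6] := code_at_cons h5.
have [_ h7] := code_at_cons h6; have [s7 _] := code_at_cons h7.
have r232 : r2 32 = nth 0 w (eval w s e) by move: q1; rewrite /r2 /upd /= => ->.
have R2 : reach (Config (off + size ce) r1 o) 2 (Config (off + size ce + 2) r2 o).
  by rewrite -le; apply: (reachS s1); apply: (reachS s2).
exists (size ce + 2 + 3 * bit_length (r2 32) + 1), (upd r3 a (r3 33 + r3 32)); split.
+ have lb : bit_length (r2 32) <= S.+1.
    have [ei|ei] := ltnP (eval w s e) (size w); last by rewrite r232 nth_default.
    apply: leq_trans (_ : S <= _) => //; apply: leq_trans wS.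
    rewrite r232 /input_size.
    by rewrite (big_nth 0) big_mkord (bigD1 (Ordinal ei)) //= leq_addr.
  by rewrite expn1 size_cat /=; move: lb; move: (size ce) (bit_length _); nia.
+ rewrite cats0 size_cat -/ce /= addnA.
  have -> : off + size ce + 6 = (off + size ce + 2 + 3).+1 by lia.
  apply: reach_trans (reach_trans (reach_trans R1 R2) R3) _.
  have e3 : (off + size ce + 2).+3 = off + size ce + 2 + 3 by lia.
  by rewrite e3 in s7; apply: (reachS s7).
+ rewrite z3 addn0 q3 r232 [r2 33](_ : _ = 0) // add0n.
  apply: (@agree_set s r3 a 0 _ a32) => a' j ha'; rewrite f3; [|lia|lia].
  by rewrite /r2 !upd_neq ?ag1 //; lia.
Qed.

Lemma stmt_ok_seq b S c1 c2 : stmt_ok b S c1 -> stmt_ok b S c2 -> stmt_ok b S (Seq c1 c2).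
Proof.
move=> IH1 IH2 off s r o.
move=> /= /andP[wf1 wf2] hc ag bS wS.
have [h1 h2] := code_at_cat hc.
have [t1 [r1 [l1 R1 ag1]]] := IH1 _ _ _ o wf1 h1 ag bS wS.
have bS' : exec w b c1 s b 0 <= S by rewrite exec_frame ?wf_writes.
have [t2 [r2 [l2 R2 ag2]]] := IH2 _ _ _ (o ++ prints w b c1 s) wf2 h2 ag1 bS' wS.
exists (t1 + t2), r2; split=> //; last first.
  by rewrite catA size_cat addnA; apply: reach_trans R1 R2.
rewrite mulnDl; apply: leq_add; [apply: leq_trans l1 _|apply: leq_trans l2 _];
  by apply: leq_mul => //; apply: leq_pexp2l; rewrite ?leq_maxl ?leq_maxr.
Qed.

Lemma stmt_ok_if b S e c1 c2 : stmt_ok b S c1 -> stmt_ok b S c2 -> stmt_ok b S (If e c1 c2).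
Proof.
move=> IH1 IH2 off s r o.
move=> /= /and3P[wfe wf1 wf2] hc ag bS wS.
have [h1 h2] := code_at_cat hc.
have [r1 [R1 ag1 q1 f1]] := reach_expr o wfe h1 ag.
have [s2 h3] := code_at_cons h2.
set p2 := cstmt b (off + (size (cexpr 0 e)).+1) c2 in h2 h3 s2 *.
set l1 := off + (size (cexpr 0 e) + size p2 + 3) in h2 h3 s2 *.
set p1 := cstmt b l1 c1 in h2 h3 s2 *.
have [h4 h5] := code_at_cat h3.
have [s5 h6] := code_at_cons h5; have [s6 h7] := code_at_cons h6.
have sz : off + size (cexpr 0 e ++ ijpos 32 l1 :: p2 ++
    [:: iconst 32 1; ijpos 32 (l1 + size p1)] ++ p1) = l1 + size p1.
  by rewrite size_cat /= size_cat /= /l1; lia.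
have pos k : 0 < S.+1 ^ k by rewrite expn_gt0.
have pd1 := pos (maxn (loop_depth c1) (loop_depth c2)).
rewrite /= in sz; rewrite sz.
case: ifP => ev.
+ have h7' : code_at l1 p1 by rewrite /l1; move: h7; congr (code_at _ _); lia.
  have [t2 [r2 [b2 R2 ag2]]] := IH1 _ _ _ o wf1 h7' ag1 bS wS.
  exists (size (cexpr 0 e) + (t2.+1)), r2; split=> //; last first.
    apply: reach_trans R1 _; apply: (reachS s2).
    by rewrite /= -[32]/(32 + 0) q1 ev.
  have : t2 <= cost c1 * S.+1 ^ maxn (loop_depth c1) (loop_depth c2).
    by apply: leq_trans b2 _; apply: leq_mul => //; apply: leq_pexp2l; rewrite ?leq_maxl.
  by nia.
+ have h4' : code_at (off + (size (cexpr 0 e)).+1) p2 by rewrite addnS.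
  have [t2 [r2 [b2 R2 ag2]]] := IH2 _ _ _ o wf2 h4' ag1 bS wS.
  exists (size (cexpr 0 e) + (t2 + 2).+1), (upd r2 32 1); split; last first.
  * by apply: agree_upd.
  * apply: reach_trans R1 _; apply: (reachS s2).
    rewrite /= (q1 : r1 32 = eval w s e) ev -addnS.
    rewrite -addnS in s5 s6; apply: reach_trans R2 _.
    by apply: (reachS s5); apply: (reachS s6).
  have : t2 <= cost c2 * S.+1 ^ maxn (loop_depth c1) (loop_depth c2).
    by apply: leq_trans b2 _; apply: leq_mul => //; apply: leq_pexp2l; rewrite ?leq_maxr.
  by nia.
Qed.

Lemma stmt_ok_for b S i c : b < 32 -> stmt_ok b S c -> stmt_ok b S (For i c).
Proof.
move=> b32 IH off s r o.
move=> /= /and4P[ib i32 iw wfc] h ag bS wS.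
have [s0 h0] := code_at_cons h; have [s1 h1] := code_at_cons h0.
have [s2 h2] := code_at_cons h1; have [s3 h3] := code_at_cons h2.
have [s4 h4] := code_at_cons h3; have [h5 h6] := code_at_cat h4.
have {}h5 : code_at (off + 5) (cstmt b (off + 5) c).
  by move: h5; congr (code_at _ _); lia.
set P := cstmt b (off + 5) c in h h0 h1 h2 h3 h4 h6 s4 h5 *.
have [s6 h7] := code_at_cons h6; have [s7 h8] := code_at_cons h7.
have [s8 _] := code_at_cons h8.
pose F := fun j s => exec w b c (setm s i 0 j).
pose st j := iteri j F s.
pose pt j := flatten [seq prints w b c (setm (st j') i 0 j') | j' <- iota 0 j].
have stb j : st j b 0 = s b 0.
  elim: j => //= j IHj; rewrite /F exec_frame ?wf_writes //.
  by rewrite setm_neq // eq_sym.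
have loop j : j <= s b 0 -> exists t r1,
    [/\ t <= 1 + j * (cost c * S.+1 ^ loop_depth c + 5),
       reach (Config off r o) t (Config (off + 1) r1 (o ++ pt j))
     & agree (setm (st j) i 0 j) r1].
  elim: j => [_|j IHj jb].
    exists 1, (upd r i 0); split=> //; last by have := agree_set 0 0 i32 ag.
    by rewrite cats0 addn1; apply: (reachS s0).
  have [t [r1 [lt R1 ag1]]] := IHj (ltnW jb).
  have r1b : r1 b = s b 0.
    have := ag1 b 0 b32; rewrite setm_neq 1?eq_sym // stb => <-.
    by congr (r1 _); lia.
  have r1i : r1 i = j.
    by have := ag1 i 0 i32; rewrite setmE => <-; congr (r1 _); lia.
  pose r2 := upd r1 32 (s b 0 - j).
  have ag2 : agree (setm (st j) i 0 j) r2 by apply: agree_upd.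
  have bS' : setm (st j) i 0 j b 0 <= S by rewrite setm_neq ?stb // eq_sym.
  have [t2 [r3 [l2 R2 ag3]]] := IH _ _ _ (o ++ pt j) wfc h5 ag2 bS' wS.
  have r3i : r3 i = j.
    have := ag3 i 0 i32; rewrite exec_frame // setmE => <-; congr (r3 _); lia.
  exists (t + (2 + (t2 + 3))), (upd (upd r3 32 1) i j.+1); split.
  + by rewrite mulSn; lia.
  + apply: reach_trans R1 _; apply: (@reach_trans _ _ (Config (off + 5) r2 (o ++ pt j))).
      rewrite addn1; apply: (reachS s1); apply: (reachS s2).
      by rewrite /reach /= updE r1b r1i subn_gt0 jb.
    have -> : pt j.+1 = pt j ++ prints w b c (setm (st j) i 0 j).
      by rewrite /pt -addn1 iotaD map_cat flatten_cat /= cats0.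
    rewrite catA; apply: reach_trans R2 _.
    have e6 : off.+1.+4 + size P = off + 5 + size P by lia.
    rewrite e6 in s6 s7 s8.
    apply: (reachS s6); apply: (reachS s7); apply: (reachS s8).
    rewrite /reach /= upd_neq; last by lia.
    rewrite updE /=; congr (Config _ _ _).
    by rewrite [upd r3 32 1 i]upd_neq ?r3i ?addn1 //; lia.
  + have ag4 : agree (st j.+1) (upd r3 32 1) by apply: agree_upd.
    have := agree_set 0 j.+1 i32 ag4; rewrite muln0 add0n => ag5 a' k ha'.
    exact: ag5.
have [t [r1 [lt R1 ag1]]] := loop _ (leqnn _).
have r1b : r1 b = s b 0.
  have := ag1 b 0 b32; rewrite setm_neq 1?eq_sym // stb => <-.
  by congr (r1 _); lia.
have r1i : r1 i = s b 0.
  by have := ag1 i 0 i32; rewrite setmE => <-; congr (r1 _); lia.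
exists (t + 4), (upd (upd r1 32 0) 32 1); split.
+ rewrite expnS; apply: leq_trans (_ : 1 + S * (cost c * S.+1 ^ loop_depth c + 5) + 4 <= _).
    by rewrite leq_add2r; apply: leq_trans lt _; rewrite leq_add2l leq_mul2r bS orbT.
  have : 0 < S.+1 ^ loop_depth c by rewrite expn_gt0.
  by move: (S.+1 ^ _) (cost c) => x y; nia.
+ apply: reach_trans R1 _; rewrite addn1.
  apply: (reachS s1); apply: (reachS s2).
  rewrite /= updE r1b r1i subnn /=.
  apply: (reachS s3); apply: (reachS s4); rewrite /reach /=.
  by congr (Config _ _ _); rewrite /= size_cat /=; lia.
+ by do 2!apply: agree_upd => //.
Qed.

Lemma stmt_ok_print b S e : stmt_ok b S (Print e).
Proof.
move=> off s r o.
move=> /= wfe hc ag _ _.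
have [h1 h2] := code_at_cat hc.
have [r1 [R1 ag1 q1 f1]] := reach_expr o wfe h1 ag.
have [s2 _] := code_at_cons h2.
exists (size (cexpr 0 e ++ [:: iprint 32])), r1; split=> //.
  by rewrite muln1.
rewrite size_cat addnA; apply: reach_trans R1 _.
rewrite addn1; apply: (reachS s2).
by rewrite /reach /= -[32]/(32 + 0) q1 cats1.
Qed.

Lemma reach_stmt b S c : b < 32 -> stmt_ok b S c.
Proof.
move=> b32; elim: c => [|a e1 e2|a e|c1 IH1 c2 IH2|e c1 IH1 c2 IH2|i c IH|e].
- exact: stmt_ok_skip.
- exact: stmt_ok_assign.
- exact: stmt_ok_bitlen.
- exact: stmt_ok_seq.
- exact: stmt_ok_if.
- exact: stmt_ok_for.
- exact: stmt_ok_print.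
Qed.

End Machine.
End Language.

(** * The program *)

(* Every variable is an infinite array; scalars use its entry 0. *)
Notation vB := 0 (only parsing).
Notation vL := 1 (only parsing).
Notation vm := 2 (only parsing).
Notation vk := 3 (only parsing).
Notation vacc := 4 (only parsing).
Notation vx := 5 (only parsing).
Notation vy := 6 (only parsing).
Notation ibit := 7 (only parsing).
Notation ie := 8 (only parsing).
Notation jf := 9 (only parsing).
Notation ig := 10 (only parsing).
Notation iv := 11 (only parsing).
Notation va := 12 (only parsing).
Notation vb := 13 (only parsing).
Notation lab := 14 (only parsing).
Notation aX := 15 (only parsing).
Notation aY := 16 (only parsing).
Notation ca := 17 (only parsing).
Notation da := 18 (only parsing).
Notation dl := 19 (only parsing).
Notation par := 20 (only parsing).
Notation iit := 21 (only parsing).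
Notation ird := 22 (only parsing).
Notation cur := 23 (only parsing).
Notation vu := 24 (only parsing).
Notation xo := 25 (only parsing).
Notation istp := 26 (only parsing).
Notation vt := 27 (only parsing).
Notation ih := 28 (only parsing).

Definition V (a : nat) : expr := EGet a (EConst 0).
Definition Set1 (a : nat) (e : expr) : stmt := Assign a (EConst 0) e.
Definition ENeq (e1 e2 : expr) : expr := EAdd (ESub e1 e2) (ESub e2 e1).
Definition When (e : expr) (c : stmt) : stmt := If e c Skip.
Definition ForEdge (i : nat) (c : stmt) : stmt := For i (When (ESub (V vm) (V i)) c).
Fixpoint Block (cs : seq stmt) : stmt :=
  if cs is c :: cs' then Seq c (Block cs') else Skip.

(* Field [k] of edge [e]: the end points are fields 0 and 1, followed by the
   numerators and denominators of first_cost, low_cost and deviation. *)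
Definition EField (k : nat) (e : expr) : expr :=
  ERead (EAdd (EConst (3 + k)) (EAdd (EAdd (EAdd e e) (EAdd e e))
                                     (EAdd (EAdd e e) (EAdd e e)))).

(** Shift-and-add, one binary digit of [y] per round. The rounds are limited by the loop bound, so
    multipliers are always single input fields or [m + 2]; only the accumulator becomes long. *)
Definition Mul (y : expr) : stmt := Block
  [:: Set1 vx (V vacc); Set1 vy y; Set1 vacc (EConst 0);
      For ibit (Block
        [:: When (ESub (V vy) (EAdd (EHalf (V vy)) (EHalf (V vy))))
              (Set1 vacc (EAdd (V vacc) (V vx)));
            Set1 vx (EAdd (V vx) (V vx)); Set1 vy (EHalf (V vy))])].

Definition MulOthers : stmt :=
  ForEdge ih (When (ENeq (V ih) (V ie)) (Block
    [:: Mul (EField 3 (V ih)); Mul (EField 5 (V ih)); Mul (EField 7 (V ih))])).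

(* Costs are cleared of denominators, hence multiplied by the product of all of
   them, and scaled by [m + 2]. *)
Definition Costs : stmt :=
  ForEdge ie (Block
    [:: Set1 vacc (EField 2 (V ie)); Mul (EField 5 (V ie)); Mul (EField 7 (V ie));
        Mul (EAdd (V vm) (EConst 2)); MulOthers; Assign ca (V ie) (V vacc);
        Set1 vacc (EField 4 (V ie)); Mul (EField 7 (V ie)); Set1 vt (V vacc);
        Set1 vacc (EField 6 (V ie)); Mul (EField 5 (V ie));
        Set1 vacc (EAdd (V vacc) (V vt)); Mul (EField 3 (V ie));
        Mul (EAdd (V vm) (EConst 2)); MulOthers; Assign da (V ie) (V vacc)]).

Definition Labels (cond : expr) : stmt := Block
  [:: For iv (Assign lab (V iv) (V iv));
      ForEdge ig (When cond (Block
        [:: Set1 va (EGet lab (EField 0 (V ig)));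
            Set1 vb (EGet lab (EField 1 (V ig)));
            For iv (If (ENeq (EGet lab (V iv)) (V vb)) Skip
                       (Assign lab (V iv) (V va)))]))].

Definition Differ (f : nat) : expr :=
  ENeq (EGet lab (EField 0 (V f))) (EGet lab (EField 1 (V f))).

Definition Weight (f : nat) : expr := EAdd (EGet ca (V f)) (EGet da (V f)).

(** Adding 1 when [ig] precedes [ie] turns the strict comparison of weights into a weak one, so the
    labelled edges are those before [ie] by weight and then index. The expression [1 - (1 - x)] maps
    every positive value to 1. *)
Definition Mst : stmt :=
  ForEdge ie (Block
    [:: Labels (ESub (EAdd (Weight ie)
                  (ESub (EConst 1) (ESub (EAdd (V ig) (EConst 1)) (V ie))))
                (Weight ig));
        Assign aX (V ie) (ESub (EConst 1) (ESub (EConst 1) (Differ ie)));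
        Assign aY (V ie) (EGet aX (V ie))]).

(** The constant 1 charges one unit per arc against costs stored with the factor [m + 2]. *)
Definition Relax (src dst a b : expr) : stmt :=
  When (ESub (EAdd (EGet dl src) a) (EAdd (EAdd b (EConst 1)) (EGet dl dst)))
    (Block [:: Assign dl dst (ESub (EAdd (EGet dl src) a) (EAdd b (EConst 1)));
               Assign par dst src]).

Definition RelaxAll (cond src dst a b : expr) : stmt :=
  ForEdge jf (When cond (Relax src dst a b)).

Definition Without (a : nat) : expr :=
  ESub (EGet a (V ig)) (ESub (EConst 1) (ENeq (V ig) (V ie))).

(** The arcs are grouped by the removed edge [ie]: one labelling of a tree without it decides all
    possible insertions, so two labellings per edge suffice. *)
Definition SweepEdge : stmt := Block
  [:: Labels (Without aX);
      RelaxAll (Differ jf) (V jf) (V ie) (EGet ca (V ie)) (EGet ca (V jf));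
      Labels (Without aY);
      RelaxAll (Differ jf) (V ie) (V jf) (EGet da (V ie)) (EGet da (V jf));
      RelaxAll (ESub (EGet aY (V ie)) (EGet aX (V ie))) (V jf) (V ie)
        (EConst 0) (EConst 0)].

Definition Bellman : stmt := Block
  [:: For ie (Assign dl (V ie) (EConst 0)); For ird (ForEdge ie SweepEdge)].

Definition ArgMax : stmt := Block
  [:: Set1 cur (EConst 0);
      ForEdge ie (When (ESub (EGet dl (V ie)) (EGet dl (V cur)))
        (Set1 cur (V ie)))].

(** [xo] preserves the old [X], which decides on which side each exchange happens while [aX] is
    being changed. A zero distance marks the start of the path and makes the remaining rounds
    idle. *)
Definition Trace : stmt := Block
  [:: For ie (Assign xo (V ie) (EGet aX (V ie)));
      For istp (When (EGet dl (V cur)) (Block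
        [:: Set1 vu (EGet par (V cur));
            If (EGet xo (V cur))
              (Block [:: Assign aX (V cur) (EConst 0);
                         Assign aX (V vu) (EConst 1)])
              (Block [:: Assign aY (V vu) (EConst 0);
                         Assign aY (V cur) (EConst 1)]);
            Set1 cur (V vu)]))].

Definition Augment : stmt :=
  For iit (When (ESub (V vk) (V iit)) (Block [:: Bellman; ArgMax; Trace])).

Definition PrintSet (a : nat) : stmt := ForEdge ie (Print (EGet a (V ie))).

Definition Prologue : stmt := Block
  [:: Set1 vm (ERead (EConst 1)); Set1 vk (ERead (EConst 2));
      Set1 vL (EAdd (EConst 3) (EAdd
        (EAdd (EAdd (V vm) (V vm)) (EAdd (V vm) (V vm)))
        (EAdd (EAdd (V vm) (V vm)) (EAdd (V vm) (V vm)))))].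

Definition InputSize : stmt :=
  For ie (Block [:: BitLen vt (V ie); Set1 vB (EAdd (V vB) (V vt))]).

Definition Solve : stmt :=
  Block [:: Costs; Mst; Augment; PrintSet aX; PrintSet aY].

Lemma wf_Prologue : wf 31 Prologue. Proof. by []. Qed.
Lemma wf_InputSize : wf vL InputSize. Proof. by []. Qed.
Lemma wf_Solve : wf vB Solve. Proof. by []. Qed.

(** * Correctness of the program *)

Section Rules.
Variables (w : seq nat) (b : nat).
Implicit Types (s t : memory) (a i j : nat) (c : stmt) (e : expr).

Lemma exec_Block cs s :
  exec w b (Block cs) s = foldl (fun s c => exec w b c s) s cs.
Proof. by elim: cs s => //= c cs IH s; rewrite IH. Qed.

Lemma exec_Assign a e1 e2 s :
  exec w b (Assign a e1 e2) s = setm s a (eval w s e1) (eval w s e2).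
Proof. by []. Qed.

Lemma exec_Set1 a e s : exec w b (Set1 a e) s = setm s a 0 (eval w s e).
Proof. by []. Qed.

Lemma exec_If e c1 c2 s : exec w b (If e c1 c2) s =
  if 0 < eval w s e then exec w b c1 s else exec w b c2 s.
Proof. by []. Qed.

Lemma exec_When e c s :
  exec w b (When e c) s = if 0 < eval w s e then exec w b c s else s.
Proof. by []. Qed.

Definition execE := (exec_Assign, exec_Set1, exec_If, exec_When).

(** Invariants must ignore the counter cell, which is overwritten before each round and after the
    last one. *)
Lemma exec_forP i c s (P : nat -> memory -> Prop) :
    P 0 s ->
    (forall j t, j < s b 0 -> (forall a, a \notin i :: writes c -> t a = s a) ->
      P j t -> P j.+1 (exec w b c (setm t i 0 j))) ->
    (forall j t x, P j t -> P j (setm t i 0 x)) ->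
  P (s b 0) (exec w b (For i c) s).
Proof.
move=> P0 PS Pi; apply: Pi; pose F j t := exec w b c (setm t i 0 j).
rewrite -/F.
have fr j a : a \notin i :: writes c -> iteri j F s a = s a.
  rewrite inE negb_or => /andP[ai ac]; elim: j => //= j IHj.
  by rewrite /F exec_frame // setm_neq.
suff H j : j <= s b 0 -> P j (iteri j F s) by apply: H.
elim: j => //= j IHj jb; apply: PS => //; first exact: fr.
by apply: IHj; apply: ltnW.
Qed.

(** The loop still runs up to the common bound; rounds from [m] on are idle, which the invariant
    expresses by [minn]. *)
Lemma exec_forEdgeP i c s (P : nat -> memory -> Prop) :
    vm \notin i :: writes c -> s vm 0 <= s b 0 -> P 0 s ->
    (forall j t, j < s vm 0 -> (forall a, a \notin i :: writes c -> t a = s a) ->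
      P j t -> P j.+1 (exec w b c (setm t i 0 j))) ->
    (forall j t x, P j t -> P j (setm t i 0 x)) ->
  P (s vm 0) (exec w b (ForEdge i c) s).
Proof.
move=> nvm mB P0 PS Pi.
have := @exec_forP i (When (ESub (V vm) (V i)) c) s
  (fun j t => P (minn j (s vm 0)) t).
rewrite /= cats0 (minn_idPr mB); apply => //.
- by rewrite min0n.
- move=> j t jB fr; rewrite setmE.
  have -> : setm t i 0 j vm 0 = s vm 0.
    rewrite setm_neq ?fr //.
    by move: nvm; rewrite inE negb_or => /andP[].
  rewrite subn_gt0; case: ltnP => jm Pj; last first.
    by rewrite (minn_idPr (leqW jm)); apply: Pi.
  by rewrite (minn_idPl jm); apply: PS.
- by move=> j t x; apply: Pi.
Qed.

End Rules.

Arguments exec : simpl never.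
Arguments Block : simpl never.

Definition field (w : seq nat) (k e : nat) : nat := nth 0 w (3 + k + 8 * e).

Lemma eval_field w s k e : eval w s (EField k e) = field w k (eval w s e).
Proof. by rewrite /= /field; congr (nth 0 w _); lia. Qed.

Opaque EField.

Lemma exec_Mul w y s : eval w (setm s vx 0 (s vacc 0)) y = eval w s y ->
    eval w s y < 2 ^ s vB 0 ->
  exec w vB (Mul y) s vacc 0 = s vacc 0 * eval w s y.
Proof.
move=> ey ltB; rewrite /Mul exec_Block /= !execE /= ey; set s1 := setm _ 4 0 0.
pose P j (t : memory) := t vacc 0 + t vx 0 * t vy 0 = s vacc 0 * eval w s y /\
  t vy 0 < 2 ^ (s vB 0 - j).
have : P (s vB 0) (exec w vB (For ibit (Block
        [:: When (ESub (V vy) (EAdd (EHalf (V vy)) (EHalf (V vy))))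
              (Set1 vacc (EAdd (V vacc) (V vx)));
            Set1 vx (EAdd (V vx) (V vx)); Set1 vy (EHalf (V vy))])) s1).
  apply: (@exec_forP w vB ibit _ s1 P) => //; first by split; rewrite ?subn0.
  move=> j t jB _ [Pj ltj]; rewrite exec_Block /= !execE /=.
  have jB' : j < s vB 0 by [].
  have -> : setm t 7 0 j vy 0 = t vy 0 by [].
  have -> : (0 < t vy 0 - ((t vy 0)./2 + (t vy 0)./2)) = odd (t vy 0) by lia.
  have e2 : 2 ^ (s vB 0 - j) = 2 * 2 ^ (s vB 0 - j.+1).
    by rewrite -expnS; congr (2 ^ _); lia.
  case: ifP => od; rewrite /P /setm /=; (split; last by lia).
  - rewrite -Pj -[in RHS](odd_double_half (t vy 0)) od -muln2; nia.
  - rewrite -Pj -[in RHS](odd_double_half (t vy 0)) od -muln2; nia.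
by rewrite /P subnn expn0 => -[<-]; rewrite ltnS leqn0 => /eqP ->; rewrite muln0 addn0.
Qed.

(** * Integer costs *)

Section CostPhase.
Variables (w : seq nat) (m B : nat).
Hypothesis mB : m + 2 <= B.
Hypothesis fieldB : forall k e, e < m -> field w k e < 2 ^ B.

Definition edge_den (e : nat) : nat := field w 3 e * field w 5 e * field w 7 e.

Definition others_den (j e : nat) : nat :=
  \prod_(0 <= i < j | i != e) edge_den i.

Definition at_edge (i : nat) (t : memory) (e : nat) : Prop :=
  [/\ t vB 0 = B, t vm 0 = m & t i 0 = e].

Lemma at_edge_exec i c t e : vB \notin writes c -> vm \notin writes c ->
  i \notin writes c -> at_edge i t e -> at_edge i (exec w vB c t) e.
Proof. by move=> nB nm ni [tB tm ti]; split; rewrite exec_frame. Qed.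

Lemma exec_Mul_field k i t e : i \notin [:: vacc; vx; vy; ibit] -> e < m ->
  at_edge i t e -> exec w vB (Mul (EField k (V i))) t vacc 0 = t vacc 0 * field w k e.
Proof.
move=> ni em [tB tm ti].
have ei : eval w t (EField k (V i)) = field w k e by rewrite eval_field /= ti.
rewrite exec_Mul ?ei //; last by rewrite tB; apply: fieldB.
rewrite eval_field /= setm_neq ?ti //.
by move: ni; rewrite !inE !negb_or => /and4P[].
Qed.

Lemma exec_Mul_scale t : t vB 0 = B -> t vm 0 = m ->
  exec w vB (Mul (EAdd (V vm) (EConst 2))) t vacc 0 = t vacc 0 * (m + 2).
Proof.
move=> tB tm; rewrite exec_Mul //= ?tB tm //.
by apply: leq_ltn_trans mB _; apply: ltn_expl.
Qed.

Lemma exec_MulOthers s e : at_edge ie s e ->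
  exec w vB MulOthers s vacc 0 = s vacc 0 * others_den m e.
Proof.
move=> [sB sm se]; rewrite -{1}sm.
pose P j (t : memory) := t vacc 0 = s vacc 0 * others_den j e.
apply: (@exec_forEdgeP w vB ih _ s P) => //; rewrite ?sB ?sm //; first by lia.
- by rewrite /P /others_den big_geq // muln1.
move=> j t jm fr; rewrite /P exec_When => Pj.
have -> : eval w (setm t ih 0 j) (ENeq (V ih) (V ie)) = j - e + (e - j).
  by rewrite -se -(fr ie).
have -> : (0 < j - e + (e - j)) = (j != e) by lia.
rewrite /others_den big_mkcond big_nat_recr //= -big_mkcond -/(others_den _ _).
case: ifP => je; last by rewrite muln1.
rewrite exec_Block /=.
set t0 := setm t ih 0 j.
have a0 : at_edge ih t0 j by split; [rewrite -sB -(fr vB)|rewrite -sm -(fr vm)|].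
have a1 : at_edge ih (exec w vB (Mul (EField 3 (V ih))) t0) j by apply: at_edge_exec.
have a2 : at_edge ih (exec w vB (Mul (EField 5 (V ih)))
  (exec w vB (Mul (EField 3 (V ih))) t0)) j by apply: at_edge_exec.
rewrite (exec_Mul_field _ _ _ a2) // (exec_Mul_field _ _ _ a1) //.
rewrite (exec_Mul_field _ _ _ a0) // [t0 _ _](_ : _ = s vacc 0 * others_den j e) //.
by rewrite /edge_den -!mulnA.
Qed.

(** The cost times the product of all denominators, where those of the cost itself cancel. One
    factor common to all edges preserves the comparison of total costs. *)
Definition int_first (e : nat) : nat :=
  field w 2 e * field w 5 e * field w 7 e * others_den m e.
Definition int_second (e : nat) : nat :=
  (field w 6 e * field w 5 e + field w 4 e * field w 7 e) * field w 3 e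
    * others_den m e.

Lemma exec_Costs s e : s vB 0 = B -> s vm 0 = m -> e < m ->
  exec w vB Costs s ca e = (m + 2) * int_first e /\
  exec w vB Costs s da e = (m + 2) * int_second e.
Proof.
move=> sB sm; move: e.
pose P j (t : memory) := forall e, e < j -> t ca e = (m + 2) * int_first e /\
   t da e = (m + 2) * int_second e.
suff : P m (exec w vB Costs s) by [].
rewrite -[m]sm; apply: (@exec_forEdgeP w vB ie _ s P) => //; rewrite ?sB ?sm //.
  by lia.
move=> j t jm fr Pj; rewrite exec_Block /=.
set t0 := setm t ie 0 j.
have a0 : at_edge ie t0 j by split; [rewrite -sB -(fr vB)|rewrite -sm -(fr vm)|].
set t1 := exec w vB (Set1 vacc (EField 2 (V ie))) t0.
have a1 : at_edge ie t1 j by apply: at_edge_exec.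
have v1 : t1 vacc 0 = field w 2 j by rewrite /t1 exec_Set1 setmE eval_field.
set t2 := exec w vB (Mul (EField 5 (V ie))) t1.
have a2 : at_edge ie t2 j by apply: at_edge_exec.
set t3 := exec w vB (Mul (EField 7 (V ie))) t2.
have a3 : at_edge ie t3 j by apply: at_edge_exec.
set t4 := exec w vB (Mul (EAdd (V vm) (EConst 2))) t3.
have a4 : at_edge ie t4 j by apply: at_edge_exec.
set t5 := exec w vB MulOthers t4.
have a5 : at_edge ie t5 j by apply: at_edge_exec.
have v5 : t5 vacc 0 = (m + 2) * int_first j.
  rewrite /t5 (exec_MulOthers a4) /t4 exec_Mul_scale; try by case: a3.
  rewrite /t3 (exec_Mul_field _ _ _ a2) // /t2 (exec_Mul_field _ _ _ a1) // v1.
  by rewrite /int_first; ring.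
set t6 := exec w vB (Assign ca (V ie) (V vacc)) t5.
have a6 : at_edge ie t6 j by apply: at_edge_exec.
set t7 := exec w vB (Set1 vacc (EField 4 (V ie))) t6.
have a7 : at_edge ie t7 j by apply: at_edge_exec.
have v7 : t7 vacc 0 = field w 4 j.
  by rewrite /t7 exec_Set1 setmE eval_field /=; case: a6 => _ _ ->.
set t8 := exec w vB (Mul (EField 7 (V ie))) t7.
have a8 : at_edge ie t8 j by apply: at_edge_exec.
set t9 := exec w vB (Set1 vt (V vacc)) t8.
have a9 : at_edge ie t9 j by apply: at_edge_exec.
have v9 : t9 vt 0 = field w 4 j * field w 7 j.
  by rewrite /t9 exec_Set1 setmE /= /t8 (exec_Mul_field _ _ _ a7) // v7.
set t10 := exec w vB (Set1 vacc (EField 6 (V ie))) t9.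
have a10 : at_edge ie t10 j by apply: at_edge_exec.
have v10 : t10 vacc 0 = field w 6 j.
  by rewrite /t10 exec_Set1 setmE eval_field /=; case: a9 => _ _ ->.
set t11 := exec w vB (Mul (EField 5 (V ie))) t10.
have a11 : at_edge ie t11 j by apply: at_edge_exec.
set t12 := exec w vB (Set1 vacc (EAdd (V vacc) (V vt))) t11.
have a12 : at_edge ie t12 j by apply: at_edge_exec.
have v12 : t12 vacc 0 = field w 6 j * field w 5 j + field w 4 j * field w 7 j.
  rewrite /t12 exec_Set1 setmE /= /t11 (exec_Mul_field _ _ _ a10) // v10.
  by rewrite exec_frame // /t10 exec_frame // v9.
set t13 := exec w vB (Mul (EField 3 (V ie))) t12.
have a13 : at_edge ie t13 j by apply: at_edge_exec.
set t14 := exec w vB (Mul (EAdd (V vm) (EConst 2))) t13.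
have a14 : at_edge ie t14 j by apply: at_edge_exec.
set t15 := exec w vB MulOthers t14.
have a15 : at_edge ie t15 j by apply: at_edge_exec.
have v15 : t15 vacc 0 = (m + 2) * int_second j.
  rewrite /t15 (exec_MulOthers a14) /t14 exec_Mul_scale; try by case: a13.
  rewrite /t13 (exec_Mul_field _ _ _ a12) // v12.
  by rewrite /int_second; ring.
have e6 : t15 ca = t6 ca.
  rewrite /t15 exec_frame // /t14 exec_frame // /t13 exec_frame //.
  rewrite /t12 exec_frame // /t11 exec_frame // /t10 exec_frame //.
  by rewrite /t9 exec_frame // /t8 exec_frame // /t7 exec_frame.
have e15 : t15 da = t da.
  rewrite /t15 exec_frame // /t14 exec_frame // /t13 exec_frame //.
  rewrite /t12 exec_frame // /t11 exec_frame // /t10 exec_frame //.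
  rewrite /t9 exec_frame // /t8 exec_frame // /t7 exec_frame //.
  rewrite /t6 exec_frame // /t5 exec_frame // /t4 exec_frame //.
  by rewrite /t3 exec_frame // /t2 exec_frame // /t1 exec_frame.
have e5 : t5 ca = t ca.
  rewrite /t5 exec_frame // /t4 exec_frame //.
  by rewrite /t3 exec_frame // /t2 exec_frame // /t1 exec_frame.
move=> e; rewrite ltnS leq_eqVlt exec_Assign /= => ej.
have -> : t15 8 0 = j by case: a15.
rewrite v15 /setm /= e15 e6 /t6 exec_Assign /=.
have -> : t5 8 0 = j by case: a5.
rewrite v5 /setm /= e5.
by case: eqP ej => [-> //|_] /= /Pj.
Qed.

End CostPhase.

(** * Component labels and the initial tree *)

Section LabelPhase.
Variables (w : seq nat) (n m B : nat) (ends : 'I_m -> 'I_n * 'I_n).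
Hypothesis nB : n <= B.
Hypothesis mB : m <= B.
Hypothesis endsE : forall e : 'I_m,
  field w 0 e = (ends e).1 /\ field w 1 e = (ends e).2.

Lemma exec_Relabel s v : v < s vB 0 ->
  exec w vB (For iv (If (ENeq (EGet lab (V iv)) (V vb)) Skip
                        (Assign lab (V iv) (V va)))) s lab v =
  if s lab v == s vb 0 then s va 0 else s lab v.
Proof.
move=> vB'.
pose P j (t : memory) := forall v, t lab v =
  if (v < j) && (s lab v == s vb 0) then s va 0 else s lab v.
have : P (s vB 0) (exec w vB (For iv (If (ENeq (EGet lab (V iv)) (V vb)) Skip
                        (Assign lab (V iv) (V va)))) s).
  apply: (@exec_forP w vB iv _ s P) => // j t jB fr Pj x.
  rewrite exec_If exec_Assign /= -[setm t 11 0 j 13 0]/(t vb 0).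
  rewrite -[setm t 11 0 j 12 0]/(t va 0) -[setm t 11 0 j 11 0]/j.
  rewrite -[setm t 11 0 j 14 j]/(t lab j).
  have -> : (0 < t lab j - t vb 0 + (t vb 0 - t lab j)) = (t lab j != t vb 0) by lia.
  have tj : t lab j = s lab j by rewrite Pj ltnn.
  rewrite (fr vb) // (fr va) // tj ltnS leq_eqVlt.
  case: ifP => ne; rewrite /exec /setm /=; case: (eqVneq x j) => [-> |xj] /=.
  - by rewrite (negbTE ne) tj.
  - exact: Pj.
  - by move/negbFE: ne => ->.
  - exact: Pj.
by move=> /(_ v); rewrite vB'.
Qed.

Lemma exec_Labels cond s (Z : {set 'I_m}) :
    s vB 0 = B -> s vm 0 = m ->
    (forall (t : memory) (g : 'I_m),
       (forall a, a \notin [:: iv; ig; va; vb; lab] -> t a = s a) ->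
       t ig 0 = g -> (0 < eval w t cond) = (g \in Z)) ->
  forall u v : 'I_n, (exec w vB (Labels cond) s lab u ==
                      exec w vB (Labels cond) s lab v) = connect (adj ends Z) u v.
Proof.
move=> sB sm condP; rewrite /Labels exec_Block /=.
set s1 := exec w vB (For iv _) s.
have s1a a : a \notin [:: iv; lab] -> s1 a = s a by move=> na; apply: exec_frame.
have l1 v : v < B -> s1 lab v = v.
  pose P j (t : memory) := forall v, v < j -> t lab v = v.
  have : P (s vB 0) s1.
    apply: (@exec_forP w vB iv _ s P) => // j t _ _ Pj x; rewrite ltnS leq_eqVlt.
    by rewrite exec_Assign /setm /=; case: eqP => [-> //|_] /= /Pj.
  by rewrite sB => /(_ v).
set body := When cond _.
pose P j (t : memory) := forall u v : 'I_n, (t lab u == t lab v) =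
  connect (adj ends [set g in Z | g < j]) u v.
have s1m : s1 vm 0 = m by rewrite s1a.
suff : P (s1 vm 0) (exec w vB (ForEdge ig body) s1).
  rewrite s1m => h u v; rewrite h; congr (connect (adj ends _) u v).
  by apply/setP => g; rewrite inE ltn_ord andbT.
apply: (@exec_forEdgeP w vB ig body s1 P) => //.
- by rewrite s1a // sm s1a // sB.
- move=> u v; rewrite !l1 ?(leq_trans (ltn_ord _)) //.
  have -> : [set g in Z | g < 0] = set0 by apply/setP => g; rewrite !inE andbF.
  apply/eqP/idP => [/val_inj ->|]; first exact: connect0.
  by case/connectP => -[|x p] /=; [move=> _ ->|case/andP => /existsP[e]; rewrite inE].
rewrite s1m => j t jm fr Pj u v; rewrite /body exec_When.
pose g := Ordinal jm.
have fr' a : a \notin [:: iv; ig; va; vb; lab] -> t a = s a.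
  move=> na; rewrite fr ?s1a //; apply: contra na; rewrite !inE.
  - by case/orP => ->; rewrite ?orbT.
  - by do 4?[case/orP => [->|]]; rewrite ?orbT // => ->; rewrite ?orbT.
rewrite (condP _ g) //; last first.
  by move=> a na; rewrite setm_neq ?fr' //; move: na; rewrite !inE !negb_or => /and5P[].
have setS : [set h in Z | h < j.+1] =
    if g \in Z then g |: [set h in Z | h < j] else [set h in Z | h < j].
  apply/setP => h; rewrite !inE ltnS leq_eqVlt.
  have -> : (h == j :> nat) = (h == g) by [].
  case: ifP => gZ; rewrite !inE; case: (eqVneq h g) => [->|hg] //=.
    by rewrite gZ.
  by rewrite gZ.
rewrite setS; case: ifP => gZ; last exact: Pj.
have [f1 f2] := endsE g.
rewrite exec_Block /= !exec_Set1 /= !eval_field /=.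
set t1 := setm (setm _ va _ _) _ _ _.
have t1B : t1 vB 0 = B by rewrite -sB -(fr' vB).
have t1l : t1 lab = t lab by [].
have t1a : t1 va 0 = t lab (ends g).1 by rewrite -f1.
have t1b : t1 vb 0 = t lab (ends g).2 by rewrite -f2.
rewrite !exec_Relabel ?t1B ?(leq_trans (ltn_ord _)) //.
rewrite connect_setU1 -!Pj t1a t1b t1l.
move: (t lab u) (t lab v) (t lab (ends g).1) (t lab (ends g).2) => x y a b.
by case: ifP; case: ifP; lia.
Qed.

Lemma graph_cl_labels cond s (Z : {set 'I_m}) (e : 'I_m) :
    s vB 0 = B -> s vm 0 = m ->
    (forall (t : memory) (g : 'I_m),
       (forall a, a \notin [:: iv; ig; va; vb; lab] -> t a = s a) ->
       t ig 0 = g -> (0 < eval w t cond) = (g \in Z)) ->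
  forall t : memory, t lab = exec w vB (Labels cond) s lab ->
  forall f, t f 0 = e -> (0 < eval w t (Differ f)) = (e \notin graph_cl ends Z).
Proof.
move=> sB sm condP t tl f tf; have [f1 f2] := endsE e.
rewrite /Differ /ENeq /= !eval_field /= tf f1 f2 tl inE.
by rewrite -(exec_Labels sB sm condP); lia.
Qed.

Definition edge_set (a : nat) (t : memory) : {set 'I_m} := [set e : 'I_m | 0 < t a e].

Definition boolean_array (a : nat) (t : memory) : Prop := forall e : 'I_m, t a e <= 1.

Lemma exec_Mst (C D : 'I_m -> nat) s :
    s vB 0 = B -> s vm 0 = m ->
    (forall e : 'I_m, s ca e = (m + 2) * C e /\ s da e = (m + 2) * D e) ->
  let t := exec w vB Mst s in
  [/\ min_base (graph_cl ends) (fun e => Posz (C e + D e)) (edge_set aX t),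
      edge_set aY t = edge_set aX t, boolean_array aX t & boolean_array aY t].
Proof.
move=> sB sm cst t'.
(* Indices are below [m], so this number encodes the lexicographic order by weight and index that
   the program tests. *)
pose rk (e : 'I_m) := (C e + D e) * m + e.
pose bef e := e \notin graph_cl ends [set g | rk g < rk e].
pose P j (t : memory) := forall e : 'I_m, e < j -> t aX e = bef e /\ t aY e = bef e.
have : P (s vm 0) t'.
  apply: (@exec_forEdgeP w vB ie _ s P) => //; rewrite ?sm ?sB // => j t jm fr Pj.
  pose e := Ordinal jm.
  rewrite exec_Block /=; set t0 := setm t ie 0 j; set lb := Labels _.
  have t0B : t0 vB 0 = B by rewrite -sB -(fr vB).
  have t0m : t0 vm 0 = m by rewrite -sm -(fr vm).
  set t1 := exec w vB lb t0.
  have t1ie : t1 ie 0 = e by rewrite /t1 exec_frame.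
  have df : (0 < eval w t1 (Differ ie)) = bef e.
    rewrite /bef; apply: (graph_cl_labels (s := t0) t0B t0m) => // t2 g fr2 t2g.
    rewrite inE /=.
    have -> : t2 8 0 = j by rewrite fr2.
    have -> : t2 ca = s ca by rewrite fr2 // -(fr ca).
    have -> : t2 da = s da by rewrite fr2 // -(fr da).
    rewrite t2g -[j]/(nat_of_ord e).
    have [-> ->] := cst g; have [-> ->] := cst e; rewrite -!mulnDr /rk.
    have gm := ltn_ord g; have em := ltn_ord e.
    move: (C g + D g) (C e + D e) (nat_of_ord g) (nat_of_ord e) gm em => x y p q pm qm.
    have [xy|xy|->] := ltngtP x y.
    - have : (m + 2) * x.+1 <= (m + 2) * y by rewrite leq_mul2l xy orbT.
      have : x.+1 * m <= y * m by rewrite leq_mul2r xy orbT.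
      by rewrite mulnS mulSn; lia.
    - have : (m + 2) * y.+1 <= (m + 2) * x by rewrite leq_mul2l xy orbT.
      have : y.+1 * m <= x * m by rewrite leq_mul2r xy orbT.
      by rewrite mulnS mulSn; lia.
    - by lia.
  rewrite !exec_Assign /=.
  have -> : 1 - (1 - eval w t1 (Differ 8)) = bef e by rewrite -df; lia.
  have -> : t1 8 0 = j by [].
  have t1X : t1 aX = t aX by rewrite /t1 exec_frame.
  have t1Y : t1 aY = t aY by rewrite /t1 exec_frame.
  move=> f; rewrite /setm /= t1ie t1X t1Y eqxx ltnS leq_eqVlt.
  by case: (eqVneq f e) => [->|fe] /=; [rewrite eqxx|
     rewrite (_ : (f == j :> nat) = false) //=; [apply: Pj|apply/eqP => fj;
     case/eqP: fe; apply: val_inj]].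
rewrite sm => PB.
have tX (e : 'I_m) : t' aX e = bef e by have [] := PB e (ltn_ord e).
have tY (e : 'I_m) : t' aY e = bef e by have [] := PB e (ltn_ord e).
split.
- apply: (greedy_base (graph_pregeometry ends) (rk := rk)).
  + move=> e f /eqP; rewrite /rk => /eqP eq_rk; apply: val_inj => /=.
    have := congr1 (modn^~ m) eq_rk.
    by rewrite !modnMDl !modn_small.
  + move=> e f; rewrite /rk ltz_nat => lt.
    have : (C e + D e).+1 * m <= (C f + D f) * m by rewrite leq_mul2r lt orbT.
    by rewrite mulSn; have := ltn_ord e; lia.
  + by move=> f; rewrite inE tX lt0b.
- by apply/setP => e; rewrite !inE tX tY.
- by move=> e; rewrite tX leq_b1.
- by move=> e; rewrite tY leq_b1.
Qed.

End LabelPhase.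

Arguments edge_set {m} a t.

(** * Bellman-Ford and the augmentation loop *)

Section AugmentPhase.
Variables (w : seq nat) (n m B : nat) (ends : 'I_m -> 'I_n * 'I_n).
Hypothesis nB : n <= B.
Hypothesis mB : m <= B.
Hypothesis endsE : forall e : 'I_m,
  field w 0 e = (ends e).1 /\ field w 1 e = (ends e).2.
Variables C D : 'I_m -> nat.
Local Notation cl := (graph_cl ends).
Local Notation N := #|'I_m|.+2.

Definition trees (X Y : {set 'I_m}) (s : memory) : Prop :=
  [/\ edge_set aX s = X, edge_set aY s = Y, boolean_array m aX s
    & boolean_array m aY s].

Definition costs (s : memory) : Prop :=
  [/\ s vB 0 = B, s vm 0 = m
    & forall e : 'I_m, s ca e = N * C e /\ s da e = N * D e].

Lemma costs_frame s t :
  (forall a, a \in [:: vB; vm; ca; da] -> t a = s a) -> costs s -> costs t.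
Proof.
move=> fr [sB sm sc]; split=> [||e]; first by rewrite fr.
  by rewrite fr.
by rewrite !fr.
Qed.

Lemma trees_frame X Y s t :
  (forall a, a \in [:: aX; aY] -> t a = s a) -> trees X Y s -> trees X Y t.
Proof.
move=> fr [sX sY bX bY]; split.
- by rewrite -sX; apply/setP => e; rewrite !inE fr.
- by rewrite -sY; apply/setP => e; rewrite !inE fr.
- by move=> e; rewrite fr.
- by move=> e; rewrite fr.
Qed.

Section Distances.
Variables X Y : {set 'I_m}.
Local Notation arc := (exch_arc cl C D X Y).
Variable d : 'I_m -> nat.
Hypothesis fd : feasible cl C D X Y d.

(** Parents satisfy only an inequality, since the value of [u] may grow after the arc was relaxed.
    Once all values equal [d], feasibility turns it into tightness. *)
Definition relaxed (t : memory) : Prop :=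
  (forall v : 'I_m, t dl v <= d v) /\
  (forall v : 'I_m, 0 < t dl v -> exists u : 'I_m, t par v = u /\
     exists a b, arc u v a b /\ t dl v + N * b + 1 <= t dl u + N * a).

Lemma exec_Relax src dst ea eb t (u v : 'I_m) a b :
    eval w t src = u -> eval w t dst = v ->
    (forall x, eval w (setm t dl v x) src = u) ->
    (forall x, eval w (setm t dl v x) dst = v) ->
    eval w t ea = N * a -> eval w t eb = N * b -> arc u v a b -> relaxed t ->
  let t' := exec w vB (Relax src dst ea eb) t in
  [/\ relaxed t', forall x : 'I_m, t dl x <= t' dl x
    & t dl u + N * a <= t' dl v + N * b + 1].
Proof.
move=> esrc edst esrc' edst' eea eeb uv [le1 pr]; rewrite /Relax exec_When /=.
rewrite esrc edst eea eeb; set x := t 19 u + N * a - (N * b + 1).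
case: ifP => lt; last by split=> //; lia.
rewrite exec_Block /= !exec_Assign /= esrc edst eea eeb esrc' edst' -/x.
set t' := setm _ 20 _ _.
have t'd y : t' dl y = if y == v then x else t dl y.
  by rewrite /t' /setm /=.
have t'p y : t' par y = if y == v then nat_of_ord u else t par y.
  by rewrite /t' /setm /=.
have fuv := fd uv.
have mono (y : 'I_m) : t dl y <= t' dl y.
  by rewrite t'd; case: eqP => [->|//]; rewrite /x; lia.
split=> //; last by rewrite t'd eqxx /x; lia.
split=> y; rewrite t'd.
  case: eqP => [/val_inj ->|_]; last exact: le1.
  by rewrite /x; move: fuv (le1 u); move: (N * a) (N * b); lia.
case: eqP => [/val_inj ->|ne] y0.
  exists u; rewrite t'p eqxx; split=> //; exists a, b; split=> //.
  by have := mono u; rewrite /x; lia.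
have [u' [pu [a' [b' [ar h]]]]] := pr y y0.
exists u'; rewrite t'p; case: eqP => // _; split=> //; exists a', b'; split=> //.
by have := mono u'; lia.
Qed.

Lemma exec_RelaxAll cond src dst ea eb s (sf df : 'I_m -> 'I_m)
    (af bf : 'I_m -> nat) (cf : pred 'I_m) :
    s vB 0 = B -> s vm 0 = m -> relaxed s ->
    (forall (t : memory) (f : 'I_m),
      (forall a, a \notin [:: jf; dl; par] -> t a = s a) -> t jf 0 = f ->
      [/\ eval w t src = sf f, eval w t dst = df f, eval w t ea = N * af f,
          eval w t eb = N * bf f & (0 < eval w t cond) = cf f]) ->
    (forall f, cf f -> arc (sf f) (df f) (af f) (bf f)) ->
  let t := exec w vB (RelaxAll cond src dst ea eb) s in
  [/\ relaxed t, forall x : 'I_m, s dl x <= t dl x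
    & forall f, cf f -> s dl (sf f) + N * af f <= t dl (df f) + N * bf f + 1].
Proof.
move=> sB sm rs ev arcs.
pose P j (t : memory) := [/\ relaxed t, forall x : 'I_m, s dl x <= t dl x
  & forall f : 'I_m, f < j -> cf f ->
      s dl (sf f) + N * af f <= t dl (df f) + N * bf f + 1].
suff : P (s vm 0) (exec w vB (RelaxAll cond src dst ea eb) s).
  by rewrite sm => -[h1 h2 h3]; split=> // f; apply: h3.
apply: (@exec_forEdgeP w vB jf _ s P) => //; rewrite ?sB ?sm //.
move=> j t jm fr [rt mono done_]; pose f := Ordinal jm.
have fr0 a : a \notin [:: jf; dl; par] -> setm t jf 0 j a = s a.
  rewrite !inE !negb_or => /and3P[n1 n2 n3].
  by rewrite setm_neq // fr //= !inE !negb_or n1 n2 n3.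
have [e1 e2 e3 e4 e5] := ev (setm t jf 0 j) f fr0 erefl.
rewrite exec_When e5; case: ifP => cff; last first.
  split=> // g; rewrite ltnS leq_eqVlt => /orP[/eqP gj|gj].
    by have -> : g = f by [apply: val_inj]; rewrite cff.
  exact: done_.
have ev' x : let t1 := setm (setm t jf 0 j) dl (df f) x in
    eval w t1 src = sf f /\ eval w t1 dst = df f.
  move=> t1; have [||-> ->] // := ev t1 f.
  by move=> a na; rewrite /t1 setm_neq ?fr0 //; move: na; rewrite !inE !negb_or => /and3P[].
have rt' : relaxed (setm t jf 0 j) by [].
have [r1 m1 d1] := exec_Relax e1 e2 (fun x => (ev' x).1) (fun x => (ev' x).2)
  e3 e4 (arcs f cff) rt'.
split=> // [x|g]; first by apply: leq_trans (mono x) (m1 x).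
rewrite ltnS leq_eqVlt => /orP[/eqP gj|gj] cg.
  have -> : g = f by apply: val_inj.
  by apply: leq_trans d1; rewrite leq_add2r; apply: mono.
apply: leq_trans (done_ g gj cg) _.
by rewrite !leq_add2r; apply: m1.
Qed.

(** All arcs handled while [e] is the current edge. Values keep growing within a sweep, so the tails
    are measured by earlier values [d0]. *)
Definition swept (e : 'I_m) (d0 : 'I_m -> nat) (t : memory) : Prop :=
  [/\ forall f, f \notin cl (X :\ e) -> d0 f + N * C e <= t dl e + N * C f + 1,
      forall f, f \notin cl (Y :\ e) -> d0 e + N * D e <= t dl f + N * D f + 1
    & e \in Y :\: X -> forall f, d0 f <= t dl e + 1].

Lemma swept_mono e d0 d1 (t t' : memory) : (forall x, d0 x <= d1 x) ->
  (forall x : 'I_m, t dl x <= t' dl x) -> swept e d1 t -> swept e d0 t'.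
Proof.
move=> h0 h1 [s1 s2 s3]; split=> [f /s1|f /s2|/s3 h f].
- by have := h0 f; have := h1 e; lia.
- by have := h0 e; have := h1 f; lia.
- by have := h f; have := h0 f; have := h1 e; lia.
Qed.

Lemma exec_SweepEdge s (e : 'I_m) :
    costs s -> trees X Y s -> s ie 0 = e -> relaxed s ->
  let t := exec w vB SweepEdge s in
  [/\ relaxed t, forall x : 'I_m, s dl x <= t dl x
    & swept e (fun x => s dl x) t].
Proof.
move=> cs ts se rs; rewrite /SweepEdge exec_Block /=.
have without (t : memory) a Z : edge_set a t = Z -> boolean_array m a t ->
    a \notin [:: iv; ig; va; vb; lab] -> t ie 0 = e ->
    forall (t1 : memory) (g : 'I_m),
      (forall a, a \notin [:: iv; ig; va; vb; lab] -> t1 a = t a) ->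
      t1 ig 0 = g -> (0 < eval w t1 (Without a)) = (g \in Z :\ e).
  move=> <- bo na te t1 g fr t1g; rewrite !inE /= t1g fr //.
  rewrite (fr ie) // te; have := bo g; rewrite -(inj_eq val_inj) /=; lia.
set s1 := exec w vB (Labels (Without aX)) s.
have c1 : costs s1.
  by apply: costs_frame cs => a; rewrite !inE => /or4P[]/eqP->; rewrite /s1 exec_frame.
have t1 : trees X Y s1.
  by apply: trees_frame ts => a; rewrite !inE => /orP[]/eqP->; rewrite /s1 exec_frame.
have e1 : s1 ie 0 = e by rewrite /s1 exec_frame.
have d1 : s1 dl = s dl by rewrite /s1 exec_frame.
have r1 : relaxed s1 by rewrite /relaxed d1 /s1 exec_frame.
set s2 := exec w vB _ s1.
have [r2 m2 sw2] : [/\ relaxed s2, forall x : 'I_m, s1 dl x <= s2 dl x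
  & forall f, f \notin cl (X :\ e) ->
      s1 dl f + N * C e <= s2 dl e + N * C f + 1].
  case: (c1) => sB sm sc.
  apply: (@exec_RelaxAll _ _ _ _ _ s1 id (fun=> e) (fun=> C e) C
            (fun f => f \notin cl (X :\ e))) => //; last by move=> f h; apply: Or31.
  move=> t f fr tf; have te : t ie 0 = e by rewrite fr.
  have tc : t ca = s1 ca by rewrite fr.
  have df : (0 < eval w t (Differ jf)) = (f \notin cl (X :\ e)).
    case: cs => sB' sm' _; case: ts => sX _ bX _.
    apply: (graph_cl_labels nB mB endsE (s := s) sB' sm'
              (without s aX X sX bX isT se)) => //.
    by rewrite fr.
  split=> //=.
  - by rewrite te tc; case: (sc e).
  - by rewrite tf tc; case: (sc f).
have c2 : costs s2.
  by apply: costs_frame c1 => a; rewrite !inE => /or4P[]/eqP->; rewrite /s2 exec_frame.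
have t2 : trees X Y s2.
  by apply: trees_frame t1 => a; rewrite !inE => /orP[]/eqP->; rewrite /s2 exec_frame.
have e2 : s2 ie 0 = e by rewrite /s2 exec_frame.
set s3 := exec w vB (Labels (Without aY)) s2.
have c3 : costs s3.
  by apply: costs_frame c2 => a; rewrite !inE => /or4P[]/eqP->; rewrite /s3 exec_frame.
have t3 : trees X Y s3.
  by apply: trees_frame t2 => a; rewrite !inE => /orP[]/eqP->; rewrite /s3 exec_frame.
have e3 : s3 ie 0 = e by rewrite /s3 exec_frame.
have d3 : s3 dl = s2 dl by rewrite /s3 exec_frame.
have r3 : relaxed s3 by rewrite /relaxed d3 /s3 exec_frame.
set s4 := exec w vB _ s3.
have [r4 m4 sw4] : [/\ relaxed s4, forall x : 'I_m, s3 dl x <= s4 dl x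
  & forall f, f \notin cl (Y :\ e) ->
      s3 dl e + N * D e <= s4 dl f + N * D f + 1].
  case: (c3) => sB sm sc.
  apply: (@exec_RelaxAll _ _ _ _ _ s3 (fun=> e) id (fun=> D e) D
            (fun f => f \notin cl (Y :\ e))) => //; last by move=> f h; apply: Or32.
  move=> t f fr tf; have te : t ie 0 = e by rewrite fr.
  have tc : t da = s3 da by rewrite fr.
  have df : (0 < eval w t (Differ jf)) = (f \notin cl (Y :\ e)).
    case: c2 => sB' sm' _; case: t2 => _ sY _ bY.
    apply: (graph_cl_labels nB mB endsE (s := s2) sB' sm'
              (without s2 aY Y sY bY isT e2)) => //.
    by rewrite fr.
  split=> //=.
  - by rewrite te tc; case: (sc e).
  - by rewrite tf tc; case: (sc f).
have c4 : costs s4.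
  by apply: costs_frame c3 => a; rewrite !inE => /or4P[]/eqP->; rewrite /s4 exec_frame.
have t4 : trees X Y s4.
  by apply: trees_frame t3 => a; rewrite !inE => /orP[]/eqP->; rewrite /s4 exec_frame.
have e4 : s4 ie 0 = e by rewrite /s4 exec_frame.
set s5 := exec w vB _ s4.
have [r5 m5 sw5] : [/\ relaxed s5, forall x : 'I_m, s4 dl x <= s5 dl x
  & forall f : 'I_m, e \in Y :\: X -> s4 dl f + N * 0 <= s5 dl e + N * 0 + 1].
  case: (c4) => sB sm sc; case: (t4) => sX sY bX bY.
  apply: (@exec_RelaxAll _ _ _ _ _ s4 id (fun=> e) (fun=> 0) (fun=> 0)
            (fun f => e \in Y :\: X)) => //; last by move=> f h; apply: Or33.
  move=> t f fr tf; have te : t ie 0 = e by rewrite fr.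
  split=> //=; rewrite ?muln0 // te !fr //.
  rewrite -sX -sY !inE; have := bX e; have := bY e; lia.
have mm (x : 'I_m) : s dl x <= s2 dl x by rewrite -d1; apply: m2.
have mm4 (x : 'I_m) : s2 dl x <= s4 dl x by rewrite -d3; apply: m4.
split=> // [x|]; first by have := mm x; have := mm4 x; have := m5 x; lia.
split=> [f /sw2|f /sw4|eYX f].
- by rewrite d1; have := mm4 e; have := m5 e; lia.
- by rewrite d3; have := mm e; have := m5 f; lia.
- by have := sw5 f eYX; have := mm f; have := mm4 f; lia.
Qed.

Lemma exec_Sweep s : costs s -> trees X Y s -> relaxed s ->
  let t := exec w vB (ForEdge ie SweepEdge) s in
  [/\ relaxed t, forall x : 'I_m, s dl x <= t dl x
    & forall u v a b, arc u v a b -> s dl u + N * a <= t dl v + N * b + 1].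
Proof.
move=> cs ts rs; case: (cs) => sB sm sc.
pose P j (t : memory) := [/\ relaxed t, forall x : 'I_m, s dl x <= t dl x
  & forall e : 'I_m, e < j -> swept e (fun x => s dl x) t].
suff : P (s vm 0) (exec w vB (ForEdge ie SweepEdge) s).
  rewrite sm => -[h1 h2 h3]; split=> // u v a b.
  case=> -[ar -> ->]; [have [h _ _] := h3 v (ltn_ord v)|
    have [_ h _] := h3 u (ltn_ord u)|have [_ _ h] := h3 v (ltn_ord v)].
  - exact: h.
  - exact: h.
  - by rewrite !muln0 !addn0; apply: h.
apply: (@exec_forEdgeP w vB ie SweepEdge s P) => //; rewrite ?sB ?sm //.
move=> j t jm fr [rt mono sw]; pose e := Ordinal jm.
set t0 := setm t ie 0 j.
have c0 : costs t0.
  by apply: costs_frame cs => a; rewrite !inE => /or4P[]/eqP->; apply: fr.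
have tr0 : trees X Y t0.
  by apply: trees_frame ts => a; rewrite !inE => /orP[]/eqP->; apply: fr.
have [r1 m1 sw1] := @exec_SweepEdge t0 e c0 tr0 erefl rt.
split=> // [x|f]; first by apply: leq_trans (mono x) (m1 x).
rewrite ltnS leq_eqVlt => /orP[/eqP fj|fj].
  have -> : f = e by apply: val_inj.
  by apply: swept_mono sw1.
by apply: swept_mono (sw f fj).
Qed.

Lemma exec_Bellman dl0 lam s :
    certificate cl C D X Y dl0 lam -> longest cl C D X Y dl0 d ->
    costs s -> trees X Y s ->
  let t := exec w vB Bellman s in
  (forall v : 'I_m, t dl v = d v) /\
  (forall v : 'I_m, 0 < d v -> exists2 u : 'I_m, t par v = u & tight cl C D X Y d u v).
Proof.
move=> ct ld cs ts; have [h [hm h0 hS]] := longest_sweeps (graph_pregeometry ends) ct ld.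
rewrite /Bellman exec_Block /=; set s1 := exec w vB (For ie _) s.
have s1d (v : 'I_m) : s1 dl v = 0.
  pose P j (t : memory) := forall v, v < j -> t dl v = 0.
  have : P (s vB 0) s1.
    apply: (@exec_forP w vB ie _ s P) => // j t _ _ Pj x; rewrite ltnS leq_eqVlt.
    by rewrite exec_Assign /setm /=; case: eqP => [-> //|_] /= /Pj.
  by case: cs => -> _ _; apply; apply: leq_trans mB.
have c1 : costs s1.
  by apply: costs_frame cs => a; rewrite !inE => /or4P[]/eqP->; rewrite /s1 exec_frame.
have t1 : trees X Y s1.
  by apply: trees_frame ts => a; rewrite !inE => /orP[]/eqP->; rewrite /s1 exec_frame.
pose P j (t : memory) := relaxed t /\ (forall v : 'I_m, h v <= j -> t dl v = d v).
have : P (s1 vB 0) (exec w vB (For ird (ForEdge ie SweepEdge)) s1).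
  apply: (@exec_forP w vB ird _ s1 P) => //.
    split; last by move=> v; rewrite leqn0 => /eqP /h0 ->.
    by split=> v; rewrite s1d.
  move=> j t _ fr [rt ht]; set t0 := setm t ird 0 j.
  have c2 : costs t0.
    by apply: costs_frame c1 => a; rewrite !inE => /or4P[]/eqP->; apply: fr.
  have t2 : trees X Y t0.
    by apply: trees_frame t1 => a; rewrite !inE => /orP[]/eqP->; apply: fr.
  have [r1 m1 sw1] := exec_Sweep c2 t2 (rt : relaxed t0).
  split=> // v hv; apply/eqP; rewrite eqn_leq r1.1 /=.
  case: (posnP (h v)) => [/h0 -> //|hv0].
  have [u [a [b [ar tt hu]]]] := hS v hv0.
  have hu' : h u <= j by lia.
  have := sw1 _ _ _ _ ar; have -> : t0 dl u = d u by apply: ht.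
  by move: tt; move: (N * a) (N * b); lia.
set t := exec _ _ _ _; case: c1 => -> _ _ [[le1 pr] hd].
have dE (v : 'I_m) : t dl v = d v.
  by apply: hd; have := hm v; rewrite card_ord; lia.
split=> // v dv; have [|u [pu [a [b [ar tt]]]]] := pr v; first by rewrite dE.
exists u => //; exists a, b; split=> //; rewrite !dE in tt.
by have := fd ar; move: tt; move: (N * a) (N * b); lia.
Qed.

End Distances.

Lemma exec_ArgMax s : s vB 0 = B -> s vm 0 = m -> 0 < m ->
  exists2 es : 'I_m, exec w vB ArgMax s cur 0 = es &
                     forall v : 'I_m, s dl v <= s dl es.
Proof.
move=> sB sm m0; rewrite /ArgMax exec_Block /=; set s1 := exec w vB (Set1 _ _) s.
pose P j (t : memory) := exists2 es : 'I_m, t cur 0 = es &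
                     forall v : 'I_m, v < j -> s dl v <= s dl es.
have [] : P (s1 vm 0) (exec w vB (ForEdge ie (When (ESub (EGet dl (V ie)) (EGet dl (V cur)))
        (Set1 cur (V ie)))) s1).
- apply: (@exec_forEdgeP w vB ie _ s1 P) => //.
  + by rewrite -[s1 vm 0]/(s vm 0) sm -[s1 vB 0]/(s vB 0) sB.
  + by exists (Ordinal m0).
  rewrite -[s1 vm 0]/(s vm 0) sm => j t jm fr [es tes le1].
  have td : t dl = s dl by rewrite fr.
  rewrite exec_When exec_Set1 /= -[setm t 8 0 j 19]/(t dl) td.
  rewrite -[setm t 8 0 j 23 0]/(t cur 0) tes -[setm t 8 0 j 8 0]/j subn_gt0.
  case: ltnP => lt; [exists (Ordinal jm)|exists es] => // v; rewrite ltnS leq_eqVlt.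
    by move=> /orP[/eqP -> //|/le1 le2]; apply: leq_trans le2 (ltnW lt).
  by move=> /orP[/eqP -> //|/le1].
by move=> es e1 le1; exists es => // v; apply: le1; rewrite -[s1 vm 0]/(s vm 0) sm.
Qed.

Lemma edge_set_upd a (t : memory) (v : 'I_m) x : edge_set a (setm t a v x) =
  if 0 < x then v |: edge_set a t else edge_set a t :\ v.
Proof.
apply/setP => e; rewrite inE /setm eqxx /=.
have -> : (e == v :> nat) = (e == v) by [].
by case x0: (0 < x) => /=; rewrite !inE; case: (e =P v) => //= _; rewrite x0.
Qed.

Lemma boolean_array_upd a (t : memory) i x :
  x <= 1 -> boolean_array m a t -> boolean_array m a (setm t a i x).
Proof. by move=> x1 bt e; rewrite /setm eqxx /=; case: ifP. Qed.

Lemma exec_Trace X Y s (pr : 'I_m -> 'I_m) (es : 'I_m) r :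
    s vB 0 = B -> trees X Y s -> s cur 0 = es -> r <= m ->
    (forall v : 'I_m, 0 < s dl v -> s par v = pr v) ->
    (forall i, i < r -> 0 < s dl (iter i pr es)) -> s dl (iter r pr es) = 0 ->
  trees (foldl (@swap 'I_m) X (path_swapsX X pr es r))
        (foldl (@swap 'I_m) Y (path_swapsY X pr es r)) (exec w vB Trace s).
Proof.
move=> sB ts scur rm prP pos zero; rewrite /Trace exec_Block /=.
set s1 := exec w vB (For ie _) s.
have s1x (v : 'I_m) : s1 xo v = s aX v.
  pose P j (t : memory) := forall v, v < j -> t xo v = s aX v.
  have : P (s vB 0) s1.
    apply: (@exec_forP w vB ie _ s P) => // j t _ fr Pj x; rewrite ltnS leq_eqVlt.
    rewrite exec_Assign /setm /= -/(t aX) (fr aX) //.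
    by case: eqP => [-> //|_] /= /Pj.
  by rewrite sB; apply; apply: leq_trans mB.
pose P j (t : memory) := t cur 0 = iter (minn j r) pr es /\
  trees (foldl (@swap 'I_m) X (path_swapsX X pr es (minn j r)))
        (foldl (@swap 'I_m) Y (path_swapsY X pr es (minn j r))) t.
set lp := For istp _.
suff : P (s1 vB 0) (exec w vB lp s1).
  have -> : s1 vB 0 = B by rewrite /s1 exec_frame.
  by rewrite /P (minn_idPr (leq_trans rm mB)) => -[].
apply: (@exec_forP w vB istp _ s1 P) => //.
  rewrite /P min0n; split; first by rewrite /s1 exec_frame.
  by apply: trees_frame ts => a; rewrite !inE => /orP[]/eqP->; rewrite /s1 exec_frame.
move=> j t _ fr [tc tt]; rewrite exec_When.
have td : t dl = s dl by rewrite fr // /s1 exec_frame.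
have tp : t par = s par by rewrite fr // /s1 exec_frame.
have tx (v : 'I_m) : t xo v = s aX v by rewrite fr.
have -> : eval w (setm t istp 0 j) (EGet dl (V cur)) = s dl (iter (minn j r) pr es).
  by rewrite /= -td -tc.
case: (ltnP j r) => jr; last first.
  rewrite (minn_idPr jr) in tc tt; rewrite zero.
  by rewrite /P (minn_idPr (leqW jr)).
rewrite (minn_idPl (ltnW jr)) in tc tt; rewrite pos //.
rewrite /P (minn_idPl jr).
set v := iter j pr es in tc; have sv : 0 < s dl v by apply: pos.
rewrite exec_Block /=; set t0 := setm t istp 0 j.
have uE : exec w vB (Set1 vu (EGet par (V cur))) t0 = setm t0 vu 0 (pr v).
  by rewrite exec_Set1 /= -[t0 par]/(t par) -[t0 cur 0]/(t cur 0) tc tp prP.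
rewrite uE; set t1 := setm t0 vu 0 _; rewrite exec_If.
have -> : eval w t1 (EGet xo (V cur)) = s aX v by rewrite -tx -tc.
have vX : (0 < s aX v) = (v \in X) by case: ts => <- _ _ _; rewrite inE.
rewrite vX; case: tt => tX tY bX bY.
have filtX : path_swapsX X pr es j.+1 = path_swapsX X pr es j ++
    (if v \in X then [:: (v, pr v)] else [::]).
  by rewrite /path_swapsX -addn1 iotaD filter_cat map_cat /= add0n -/v; case: (v \in X).
have filtY : path_swapsY X pr es j.+1 = path_swapsY X pr es j ++
    (if v \in X then [::] else [:: (pr v, v)]).
  by rewrite /path_swapsY -addn1 iotaD filter_cat map_cat /= add0n -/v; case: (v \in X).
rewrite filtX filtY !foldl_cat.
have e1 : t1 cur 0 = v by [].
have t1X : edge_set aX t1 = edge_set aX t :> {set 'I_m} by [].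
have t1Y : edge_set aY t1 = edge_set aY t :> {set 'I_m} by [].
have eu : t1 vu 0 = pr v by [].
have b1X : boolean_array m aX t1 by [].
have b1Y : boolean_array m aY t1 by [].
clearbody t1.
case: ifP => _; rewrite exec_Block /= !exec_Assign /= ?e1 ?eu.
- set t2 := setm t1 15 v 0; have -> : t2 24 0 = pr v by rewrite -eu.
  set t3 := setm t2 15 (pr v) 1; have -> : t3 24 0 = pr v by rewrite -eu.
  split; first by rewrite setmE.
  have t3X : edge_set aX t3 = pr v |: (edge_set aX t1 :\ v).
    by rewrite edge_set_upd /t2 edge_set_upd.
  split; rewrite -?tY -?t1Y -?tX -?t1X //.
  by do 2!apply: boolean_array_upd => //.
- set t2 := setm t1 16 (pr v) 0; have -> : t2 23 0 = v by rewrite -e1.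
  set t3 := setm t2 16 v 1; have -> : t3 24 0 = pr v by rewrite -eu.
  split; first by rewrite setmE.
  have t3Y : edge_set aY t3 = v |: (edge_set aY t1 :\ pr v).
    by rewrite edge_set_upd /t2 edge_set_upd.
  split; rewrite -?tY -?t1Y -?tX -?t1X //.
  by do 2!apply: boolean_array_upd => //.
Qed.

Definition optimal_for (j : nat) (X Y : {set 'I_m}) : Prop :=
  exists dl0 lam, certificate cl C D X Y dl0 lam /\
    (#|Y :\: X| = j \/ #|Y :\: X| <= j /\ lam = 0).

Lemma exec_Augment X Y s k : s vk 0 = k -> k <= B -> costs s -> trees X Y s ->
    optimal_for 0 X Y ->
  exists X' Y', trees X' Y' (exec w vB Augment s) /\ optimal_for k X' Y'.
Proof.
move=> sk kB cs ts op.
pose P j (t : memory) :=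
  exists X' Y', trees X' Y' t /\ optimal_for (minn j k) X' Y'.
suff : P (s vB 0) (exec w vB Augment s).
  by case: (cs) => -> _ _; rewrite /P (minn_idPr kB).
apply: (@exec_forP w vB iit _ s P) => //; first by exists X, Y; rewrite min0n.
move=> j t _ fr [X' [Y' [tt opt]]]; set t0 := setm t iit 0 j.
rewrite exec_When.
have -> : eval w t0 (ESub (V vk) (V iit)) = k - j by rewrite /= -sk -(fr vk).
rewrite subn_gt0; case: ltnP => jk; last first.
  by exists X', Y'; split=> //; rewrite (minn_idPr (leqW jk)); rewrite (minn_idPr jk) in opt.
rewrite (minn_idPl (ltnW jk)) in opt; rewrite /P (minn_idPl jk).
have c0 : costs t0.
  by apply: costs_frame cs => a; rewrite !inE => /or4P[]/eqP->; apply: fr.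
have tr0 : trees X' Y' t0 by [].
case: opt => dl0 [lam [ct hcard]].
have [d ld] := longest_exists (graph_pregeometry ends) ct.
rewrite exec_Block /=; set t1 := exec w vB Bellman t0.
have fd : feasible cl C D X' Y' d by case: ld.
have [t1d t1p] := exec_Bellman fd ct ld c0 tr0; rewrite -/t1 in t1d t1p.
have c1 : costs t1.
  by apply: costs_frame c0 => a; rewrite !inE => /or4P[]/eqP->; rewrite /t1 exec_frame.
have tr1 : trees X' Y' t1.
  by apply: trees_frame tr0 => a; rewrite !inE => /orP[]/eqP->; rewrite /t1 exec_frame.
case: (c1) => t1B t1m _.
set t2 := exec w vB ArgMax t1.
have tr2 : trees X' Y' t2.
  by apply: trees_frame tr1 => a; rewrite !inE => /orP[]/eqP->; rewrite /t2 exec_frame.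
have t2B : t2 vB 0 = B by rewrite /t2 exec_frame.
have t2d : t2 dl = t1 dl by rewrite /t2 exec_frame.
have t2p : t2 par = t1 par by rewrite /t2 exec_frame.
(* Without edges there is no candidate for the maximum; all edge sets coincide, and [lam] may be
   taken to be 0. *)
case: (posnP m) => [m0|m0].
  have e0 (A A' : {set 'I_m}) : A = A'.
    by apply/setP => -[i im]; exfalso; rewrite m0 in im.
  have e1 (Q : 'I_m -> Prop) i : Q i by case: i => i im; exfalso; rewrite m0 in im.
  exists X', Y'; split; first by split; by [exact: e0|exact: e1].
  exists dl0, 0; split; first by case: ct => h1 h2 _ _ _; split=> //; exact: e1.
  by right; rewrite (e0 (Y' :\: X') set0) cards0.
have [es t2c mes] := exec_ArgMax t1B t1m m0.
have {}mes v : d v <= d es by rewrite -!t1d.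
pose pr (v : 'I_m) : 'I_m := insubd v (t1 par v).
have prE (v : 'I_m) : 0 < d v -> t1 par v = pr v /\ tight cl C D X' Y' d (pr v) v.
  by move=> /t1p[u pu tu]; rewrite /pr pu valKd.
have prP (v : 'I_m) : 0 < t2 dl v -> t2 par v = pr v.
  by rewrite t2d t2p t1d => /prE[].
case: (posnP (d es)) => [d0|d0].
  (* All distances vanish: the trace changes nothing, and the same pair receives a certificate with
     [lam = 0]. *)
  have [dl' ct'] := longest_stop (graph_pregeometry ends) ct ld mes d0.
  exists X', Y'; split; last by exists dl', 0; split=> //; right; case: hcard => [|[]]; lia.
  by have := exec_Trace t2B tr2 t2c (leq0n m) prP; apply=> //=; rewrite t2d t1d.
have [r [rm pos zero [dl' [lam' [ct' card']]]]] :=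
  longest_augment (graph_pregeometry ends) ct ld (fun v h => (prE v h).2) mes d0.
do 2!eexists; split.
  apply: (exec_Trace t2B tr2 t2c _ prP); last 2 first.
  - by move=> i /pos; rewrite t2d t1d.
  - by rewrite t2d t1d zero.
  - by rewrite -[m]card_ord ltnW.
exists dl', lam'; split; first exact: ct'.
(* A pair already certified with [lam = 0] has only zero distances, so an actual augmentation starts
   from a pair with [#|Y' :\: X'|] exactly [j]. *)
left; rewrite card'; case: hcard => [-> //|[_ l0]].
by rewrite (longest_le0 ct ld es l0) in d0.
Qed.

End AugmentPhase.

(** * Printed output and layout of the input *)

Fixpoint silent (c : stmt) : bool :=
  match c with
  | Print _ => false
  | Seq c1 c2 | If _ c1 c2 => silent c1 && silent c2
  | For _ c => silent c
  | _ => true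
  end.

Lemma prints_silent w b c s : silent c -> prints w b c s = [::].
Proof.
elim: c s => //= [c1 IH1 c2 IH2|e c1 IH1 c2 IH2|i c IH] s.
- by case/andP => /IH1 -> /IH2 ->.
- by case/andP => h1 h2; case: ifP => _; rewrite ?IH1 ?IH2.
- by move=> h; elim: (iota _ _) => //= j l ->; rewrite IH.
Qed.

Lemma prints_PrintSet w s m a : s vm 0 = m -> m <= s vB 0 -> a != ie ->
  prints w vB (PrintSet a) s = [seq s a (val e) | e <- enum 'I_m].
Proof.
move=> sm mB aie; rewrite /PrintSet /ForEdge /When.
set c := If _ _ _.
have ce t : exec w vB c t = t by rewrite /c exec_If; case: ifP.
have st j a' : a' != ie ->
    iteri j (fun j t => exec w vB c (setm t ie 0 j)) s a' = s a'.
  by move=> ne; elim: j => //= j IH; rewrite ce setm_neq.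
have -> : prints w vB (For ie c) s =
    flatten [seq (if j < m then [:: s a j] else [::]) | j <- iota 0 (s vB 0)].
  rewrite /=; congr flatten; apply: eq_map => j.
  set t := setm _ ie 0 j.
  have tm : t vm 0 = m by rewrite /t setm_neq // st.
  have tj : t ie 0 = j by rewrite /t setmE.
  have ta : t a = s a by rewrite /t setm_neq // st.
  by rewrite -[t 2 0]/(t vm 0) tm -[t 8 0]/(t ie 0) tj subn_gt0 ta.
rewrite -(subnKC mB) iotaD map_cat flatten_cat add0n.
have -> : flatten [seq (if j < m then [:: s a j] else [::]) | j <- iota m (s vB 0 - m)] = [::].
  have : all (leq m) (iota m (s vB 0 - m)).
    by apply/allP => j; rewrite mem_iota => /andP[].
  elim: (iota _ _) => //= j l IH /andP[mj /IH ->].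
  by rewrite ltnNge mj.
rewrite cats0 map_comp val_enum_ord.
have : all (fun j => j < m) (iota 0 m).
  by apply/allP => j; rewrite mem_iota.
by elim: (iota 0 m) => //= j l IH /andP[-> /IH ->].
Qed.

Lemma nth_flatten_block (T : Type) (x0 : T) (U : Type) (y0 : U) (f : U -> seq T)
    (l : seq U) K i k :
    (forall u, size (f u) = K) -> i < size l -> k < K ->
  nth x0 (flatten [seq f u | u <- l]) (K * i + k) = nth x0 (f (nth y0 l i)) k.
Proof.
move=> fK; elim: l i => //= u l IH [|i] il kK; rewrite nth_cat fK.
  by rewrite muln0 add0n kK.
rewrite ltnNge mulnS -addnA leq_addr /= addKn; exact: IH.
Qed.

Lemma exec_Prologue w s : let t := exec w 31 Prologue s in
  [/\ t vm 0 = nth 0 w 1, t vk 0 = nth 0 w 2, t vL 0 = 3 + 8 * nth 0 w 1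
    & t vB 0 = s vB 0].
Proof.
rewrite /Prologue exec_Block /= !exec_Set1 /=; split=> //.
by rewrite setmE /setm /=; lia.
Qed.

Lemma exec_InputSize w s : exec w vL InputSize s vB 0 =
  s vB 0 + \sum_(0 <= i < s vL 0) bit_length (nth 0 w i).
Proof.
pose P j (t : memory) :=
  t vB 0 = s vB 0 + \sum_(0 <= i < j) bit_length (nth 0 w i).
apply: (@exec_forP w vL ie _ s P) => //; first by rewrite /P big_geq ?addn0.
move=> j t _ _ Pj; rewrite /P big_nat_recr //= addnA -Pj exec_Block /= exec_Set1 /=.
by rewrite /setm.
Qed.

Section Input.
Variable I : rr_instance.
Let n := nv I.
Let m := ne I.
Let w := encode_instance I.

Definition edge_block (e : 'I_m) : seq nat :=
  [:: nat_of_ord (ends e).1; nat_of_ord (ends e).2]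
    ++ encode_rat (first_cost e) ++ encode_rat (low_cost e)
    ++ encode_rat (deviation e).

Lemma input_field k (e : 'I_m) : k < 8 -> field w k e = nth 0 (edge_block e) k.
Proof.
move=> k8; have em := ltn_ord e.
have -> : field w k e = nth 0 w (8 * e + k).+3 by congr (nth 0 w _); lia.
rewrite /w /encode_instance /= (nth_flatten_block 0 e (f := edge_block) (K := 8)) //.
  by rewrite nth_ord_enum.
by rewrite size_enum_ord.
Qed.

Lemma size_input : size w = 3 + 8 * m.
Proof.
rewrite /w /encode_instance size_cat size_flatten /shape -map_comp.
rewrite (eq_map (g := fun=> 8)) //; congr (_ + _).
by rewrite -(size_enum_ord m); elim: (enum _) => //= e l ->; rewrite mulnS.
Qed.

Let B := input_size w.

Lemma size_input_le : size w <= B.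
Proof.
rewrite /B /input_size -sum1_size; apply: leq_sum => x _.
by rewrite /bit_length.
Qed.

Lemma nth_input_lt i : nth 0 w i < 2 ^ B.
Proof.
have [iw|iw] := ltnP i (size w); last by rewrite nth_default // expn_gt0.
apply: leq_trans (@trunc_log_ltn 2 (nth 0 w i) isT) _; apply: leq_pexp2l => //.
rewrite /B /input_size (big_nth 0) big_mkord (bigD1 (Ordinal iw)) //=.
by rewrite /bit_length leq_addr.
Qed.

Lemma vertices_le : n <= m.+1.
Proof. exact: connected_card (@graph_connected I). Qed.

Let s1 := exec w 31 Prologue (fun _ _ => 0).
Let s2 := exec w vL InputSize s1.

Lemma prologueE : [/\ s1 vm 0 = m, s1 vk 0 = rec_param I, s1 vL 0 = size w
  & s1 vB 0 = 0].
Proof.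
have [h1 h2 h3 h4] := exec_Prologue w (fun _ _ => 0).
by rewrite /s1 h1 h2 h3 h4 size_input.
Qed.

Lemma input_sizeE : [/\ s2 vB 0 = B, s2 vm 0 = m & s2 vk 0 = rec_param I].
Proof.
have [sm sk sL sB] := prologueE.
split; last 2 first.
- by rewrite /s2 exec_frame.
- by rewrite /s2 exec_frame.
rewrite /s2 exec_InputSize sB sL add0n /B /input_size [RHS](big_nth 0).
by [].
Qed.

Definition first_int (e : 'I_m) : nat := int_first w m e.
Definition second_int (e : 'I_m) : nat := int_second w m e.

Lemma solveE : exists X Y : {set 'I_m},
  [/\ prints w vB Solve s2 = encode_set X ++ encode_set Y,
      base (graph_cl (@ends I)) X, base (graph_cl (@ends I)) Y,
      #|Y :\: X| <= rec_param I
    & forall X' Y', base (graph_cl (@ends I)) X' -> base (graph_cl (@ends I)) Y' ->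
        #|Y' :\: X'| <= rec_param I ->
        \sum_(e in X) first_int e + \sum_(e in Y) second_int e <=
        \sum_(e in X') first_int e + \sum_(e in Y') second_int e].
Proof.
have [sB sm sk] := input_sizeE.
have wB := size_input_le; rewrite size_input in wB.
have mB : m <= B by lia.
have m2B : m + 2 <= B by lia.
have nB : n <= B by have := vertices_le; lia.
have kB : rec_param I <= B by have := rec_param_lt I; rewrite -/n; lia.
have fB k e : e < m -> field w k e < 2 ^ B by move=> _; apply: nth_input_lt.
have endsE (e : 'I_m) : field w 0 e = (ends e).1 /\ field w 1 e = (ends e).2.
  by rewrite !input_field.
set s3 := exec w vB Costs s2.
have s3B : s3 vB 0 = B by rewrite /s3 exec_frame.
have s3m : s3 vm 0 = m by rewrite /s3 exec_frame.
have s3c (e : 'I_m) : s3 ca e = (m + 2) * first_int e /\ s3 da e = (m + 2) * second_int e.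
  exact: (exec_Costs m2B fB sB sm (ltn_ord e)).
set s4 := exec w vB Mst s3.
have [mb eYX bX bY] := exec_Mst nB mB endsE s3B s3m s3c.
rewrite -/s4 in mb eYX bX bY.
have c4 : costs B first_int second_int s4.
  split; try by rewrite /s4 exec_frame.
  have fr a : a \notin writes Mst -> s4 a = s3 a by apply: exec_frame.
  have e2 : #|'I_m|.+2 = m + 2 by rewrite card_ord addn2.
  by move=> e; rewrite !fr // e2; apply: s3c.
have [X [Y [tr op]]] : exists X Y : {set 'I_m},
    trees X Y (exec w vB Augment s4) /\
    optimal_for (@ends I) first_int second_int (rec_param I) X Y.
  apply: (exec_Augment nB mB endsE (X := edge_set aX s4) (Y := edge_set aX s4)) => //.
    by rewrite /s4 exec_frame // /s3 exec_frame.
  exists (fun e => \max_f second_int f - second_int e), (\max_f second_int f).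
  split; last by left; rewrite setDv cards0.
  exact: (@certificate_init _ _ (graph_pregeometry (@ends I)) first_int second_int _ mb).
exists X, Y; set s5 := exec w vB Augment s4 in tr *.
have s5m : s5 vm 0 = m by rewrite /s5 exec_frame // /s4 exec_frame.
have s5B : s5 vB 0 = B by rewrite /s5 exec_frame // /s4 exec_frame.
case: tr => tX tY tbX tbY; case: op => dl0 [lam [ct hc]].
split.
- have -> : prints w vB Solve s2 = prints w vB Costs s2 ++ prints w vB Mst s3 ++
      prints w vB Augment s4 ++ prints w vB (PrintSet aX) s5 ++
      prints w vB (PrintSet aY) (exec w vB (PrintSet aX) s5) ++ [::] by [].
  rewrite !(@prints_silent w vB Costs) // !(@prints_silent w vB Mst) //.
  rewrite !(@prints_silent w vB Augment) // cats0 !cat0s.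
  have s6m : exec w vB (PrintSet aX) s5 vm 0 = m by rewrite exec_frame.
  rewrite (@prints_PrintSet w s5 m) ?s5B // (prints_PrintSet _ s6m) //; last first.
    by rewrite exec_frame ?s5B.
  rewrite exec_frame // /encode_set.
  congr (_ ++ _); apply: eq_map => e.
  + by rewrite -tX inE; have := tbX e; case: (s5 _ _) => [|[|]].
  + by rewrite -tY inE; have := tbY e; case: (s5 _ _) => [|[|]].
- by case: ct => [[]].
- by case: ct => _ [].
- by case: hc => [->|[]].
- move=> X' Y' bX' bY' ck; apply: (certificate_optimal ct) bX' bY' ck => //.
  case: hc => [h|[_ l0]]; [by left|by right].
Qed.

Definition den_prod : nat := \prod_(e < m) edge_den w e.

Lemma den_prodE (e : 'I_m) : den_prod = edge_den w e * others_den w m e.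
Proof. by rewrite /den_prod (bigD1 e) //= /others_den big_mkord. Qed.

Lemma absz_numq (x : rat) : (0 <= x)%R ->
  (`|numq x|%N%:R = x * `|denq x|%N%:R :> rat)%R.
Proof.
move=> x0; have := numqE x; rewrite -[numq x]gez0_abs ?numq_ge0 //.
by rewrite -[denq x]gez0_abs ?denq_ge0 // => ->.
Qed.

Lemma edge_fields (e : 'I_m) :
  [/\ (field w 2 e)%:R = first_cost e * (field w 3 e)%:R :> rat,
      (field w 4 e)%:R = low_cost e * (field w 5 e)%:R :> rat
    & (field w 6 e)%:R = deviation e * (field w 7 e)%:R :> rat]%R.
Proof.
rewrite !input_field //= !absz_numq //.
- exact: deviation_ge0.
- exact: low_cost_ge0.
- exact: first_cost_ge0.
Qed.

Lemma first_intE (e : 'I_m) :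
  ((first_int e)%:R = first_cost e * den_prod%:R :> rat)%R.
Proof.
have [h1 _ _] := edge_fields e.
by rewrite (den_prodE e) /first_int /int_first /edge_den !natrM h1; ring.
Qed.

Lemma second_intE (e : 'I_m) :
  ((second_int e)%:R = (low_cost e + deviation e) * den_prod%:R :> rat)%R.
Proof.
have [_ h2 h3] := edge_fields e.
rewrite (den_prodE e) /second_int /int_second /edge_den.
by rewrite !(natrM, natrD) h2 h3; ring.
Qed.

Lemma den_prod_gt0 : 0 < den_prod.
Proof.
rewrite /den_prod prodn_gt0 // => e; rewrite /edge_den !input_field //=.
by rewrite !muln_gt0 !absz_gt0 !denq_neq0.
Qed.

End Input.

(** * Robust costs *)

Section Reduction.
Variables (R : realType) (I : rr_instance).
Local Notation m := (ne I).
Local Notation cl := (graph_cl (@ends I)).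
Implicit Types (X Y : {set 'I_m}) (S : 'I_m -> R).
Local Open Scope ring_scope.

Lemma PhiP X : Phi X <-> base cl X.
Proof. exact: spanning_treeP (@graph_connected I). Qed.

Definition top_scenario : 'I_m -> R :=
  fun e => ratr (low_cost e) + ratr (deviation e).

Lemma top_scenarioP : scenarios top_scenario.
Proof.
move=> e; rewrite lexx andbT lerDl ler0q; exact: deviation_ge0.
Qed.

Lemma second_stage_le_top S Y :
  scenarios S -> second_stage_cost S Y <= second_stage_cost top_scenario Y.
Proof. by move=> sS; apply: ler_sum => e _; case/andP: (sS e). Qed.

Lemma recovery_self X : Phi X -> recovery_set X X.
Proof. by move=> pX; split=> //; rewrite setDv cards0. Qed.

Lemma recovery_costP X S Y :
    recovery_set X Y ->
    (forall Y', recovery_set X Y' -> second_stage_cost S Y <= second_stage_cost S Y') ->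
  recovery_cost X S = second_stage_cost S Y.
Proof.
move=> rY minY; apply/eqP; rewrite eq_le; apply/andP; split.
  apply: ge_inf; last by exists Y.
  by exists (second_stage_cost S Y) => x [Y' rY' <-]; apply: minY.
apply: lb_le_inf; first by exists (second_stage_cost S Y); exists Y.
by move=> x [Y' rY' <-]; apply: minY.
Qed.

Lemma recovery_exists X S : Phi X -> exists2 Y, recovery_set X Y &
  forall Y', recovery_set X Y' -> second_stage_cost S Y <= second_stage_cost S Y'.
Proof.
move=> pX; pose P Y := boolp.asbool (recovery_set X Y).
have PX : P X by apply/boolp.asboolP; apply: recovery_self.
case: (arg_minP (second_stage_cost S) PX) => Y /boolp.asboolP rY minY.
by exists Y => // Y' rY'; apply: minY; apply/boolp.asboolP.
Qed.

Lemma recovery_cost_le X S Y :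
  Phi X -> recovery_set X Y -> recovery_cost X S <= second_stage_cost S Y.
Proof.
move=> pX rY; have [Y0 rY0 minY0] := recovery_exists S pX.
by rewrite (recovery_costP rY0 minY0); apply: minY0.
Qed.

Lemma worst_case_top X : Phi X -> worst_case X top_scenario.
Proof.
move=> pX; split; first exact: top_scenarioP.
move=> S sS; have [Y rY minY] := recovery_exists top_scenario pX.
rewrite (recovery_costP rY minY).
exact: le_trans (recovery_cost_le S pX rY) (second_stage_le_top _ sS).
Qed.

Lemma robust_costE X : Phi X ->
  robust_cost R X = first_stage_cost R X + recovery_cost X top_scenario.
Proof.
move=> pX; congr (_ + _); have [sT wT] := worst_case_top pX.
apply/eqP; rewrite eq_le; apply/andP; split.
  apply: ge_sup; first by exists (recovery_cost X top_scenario); exists top_scenario.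
  by move=> x [S sS <-]; apply: wT.
apply: ub_le_sup; last by exists top_scenario.
by exists (recovery_cost X top_scenario) => x [S sS <-]; apply: wT.
Qed.

Lemma total_cost_le X Y X' Y' :
  (\sum_(e in X) first_int e + \sum_(e in Y) second_int e <=
   \sum_(e in X') first_int e + \sum_(e in Y') second_int e)%N ->
  first_stage_cost R X + second_stage_cost top_scenario Y <=
  first_stage_cost R X' + second_stage_cost top_scenario Y'.
Proof.
have P0 : 0 < (den_prod I)%:R :> R by rewrite ltr0n den_prod_gt0.
have scale X1 Y1 : (first_stage_cost R X1 + second_stage_cost top_scenario Y1)
    * (den_prod I)%:R =
    (\sum_(e in X1) first_int e + \sum_(e in Y1) second_int e)%N%:R.
  rewrite natrD !natr_sum mulrDl !mulr_suml; congr (_ + _); apply: eq_bigr => e _.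
    by rewrite -[RHS]ratr_nat first_intE rmorphM /= ratr_nat.
  by rewrite -[RHS]ratr_nat second_intE rmorphM rmorphD /= ratr_nat.
by move=> le1; rewrite -(ler_pM2r P0) !scale ler_nat.
Qed.

Lemma rr_solutionP X Y :
    base cl X -> base cl Y -> (#|Y :\: X| <= rec_param I)%N ->
    (forall X' Y', base cl X' -> base cl Y' -> (#|Y' :\: X'| <= rec_param I)%N ->
      (\sum_(e in X) first_int e + \sum_(e in Y) second_int e <=
       \sum_(e in X') first_int e + \sum_(e in Y') second_int e)%N) ->
  @rr_solution R I (encode_set X ++ encode_set Y).
Proof.
move=> bX bY ck opt; have pX : Phi X by apply/PhiP.
have rY : recovery_set X Y by split=> //; apply/PhiP.
have minY Y' : recovery_set X Y' ->
    second_stage_cost top_scenario Y <= second_stage_cost top_scenario Y'.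
  move=> [/PhiP bY' ck']; have := total_cost_le (opt _ _ bX bY' ck').
  by rewrite lerD2l.
exists X, Y; split=> //.
- split=> // X' pX'; rewrite !robust_costE // (recovery_costP rY minY).
  have [Y' rY' minY'] := recovery_exists top_scenario pX'.
  rewrite (recovery_costP rY' minY'); case: rY' => /PhiP bY' ck'.
  by apply: total_cost_le; apply: opt => //; apply/PhiP.
- by exists top_scenario; apply: worst_case_top.
- move=> S [sS wS]; split=> // Y' rY'.
  (* Under another worst case [S], the cost of [Y] is at most its cost in the top scenario, which is
     the largest recovery cost and hence equal to the optimum under [S]. *)
  apply: le_trans (second_stage_le_top Y sS) _.
  rewrite -(recovery_costP rY minY); apply: le_trans (wS _ top_scenarioP) _.
  exact: recovery_cost_le.
Qed.

End Reduction.

(** * Assembly of the program and its time bound *)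

Definition chain (b0 : nat) (c0 : stmt) (b1 : nat) (c1 : stmt) (b2 : nat)
    (c2 : stmt) : program :=
  let p0 := cstmt b0 0 c0 in
  let p1 := cstmt b1 (size p0) c1 in
  p0 ++ p1 ++ cstmt b2 (size p0 + size p1) c2.

Lemma chain_run w b0 c0 b1 c1 b2 c2 (S := input_size w)
    (s0 : memory := fun _ _ => 0) (s1 := exec w b0 c0 s0) (s2 := exec w b1 c1 s1) :
    b0 < 32 -> b1 < 32 -> b2 < 32 -> wf b0 c0 -> wf b1 c1 -> wf b2 c2 ->
    silent c0 -> silent c1 -> s1 b1 0 <= S -> s2 b2 0 <= S ->
  exists t, t <= cost c0 * S.+1 ^ loop_depth c0 + cost c1 * S.+1 ^ loop_depth c1 +
                 cost c2 * S.+1 ^ loop_depth c2 /\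
    outputs_within (chain b0 c0 b1 c1 b2 c2) w t (prints w b2 c2 s2).
Proof.
move=> h0 h1 h2 wf0 wf1 wf2 sil0 sil1 hL hB; set p := chain _ _ _ _ _ _.
pose p0 := cstmt b0 0 c0; pose p1 := cstmt b1 (size p0) c1.
pose p2 := cstmt b2 (size p0 + size p1) c2.
have hc : code_at p 0 (p0 ++ p1 ++ p2) by exists [::], [::]; rewrite cats0.
have [k0 hc1] := code_at_cat hc; have [k1 k2] := code_at_cat hc1.
rewrite add0n in k1 k2.
have a0 : agree s0 (fun=> 0) by [].
have [t0 [r0 [l0 R0 a1]]] :=
  @reach_stmt p w b0 S c0 h0 0 s0 (fun=> 0) [::] wf0 k0 a0 (leq0n _) (leqnn _).
have [t1 [r1 [l1 R1 a2]]] :=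
  @reach_stmt p w b1 S c1 h1 (size p0) s1 r0 [::] wf1 k1 a1 hL (leqnn _).
have [t2 [r2 [l2 R2 a3]]] :=
  @reach_stmt p w b2 S c2 h2 (size p0 + size p1) s2 r1 [::] wf2 k2 a2 hB (leqnn _).
exists (t0 + t1 + t2); split; first by rewrite !leq_add.
rewrite (prints_silent _ _ _ sil0) cats0 in R0.
rewrite (prints_silent _ _ _ sil1) cats0 in R1.
have := reach_trans (reach_trans R0 R1) R2.
rewrite /outputs_within /reach /init_config => ->; split=> //.
by rewrite /halted /p /chain !size_cat addnA.
Qed.

(* The prologue has no loops, hence 31 is a dummy bound. *)
Definition solver : program := chain 31 Prologue vL InputSize vB Solve.

(** Since [S] is positive, [S.+1] is at most twice [S]; this is the origin of the power of 2. *)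
Lemma poly_bound K1 d1 K2 d2 K3 d3 S t : 0 < S ->
    t <= K1 * S.+1 ^ d1 + K2 * S.+1 ^ d2 + K3 * S.+1 ^ d3 ->
  t <= (K1 + K2 + K3) * 2 ^ (d1 + d2 + d3) * S ^ (d1 + d2 + d3)
       + (K1 + K2 + K3) * 2 ^ (d1 + d2 + d3).
Proof.
move=> S0 le1; apply: leq_trans le1 _; apply: leq_trans (leq_addr _ _).
have le2 d : d <= d1 + d2 + d3 -> S.+1 ^ d <= 2 ^ (d1 + d2 + d3) * S ^ (d1 + d2 + d3).
  move=> dd; rewrite -expnMn; apply: leq_trans (_ : S.+1 ^ (d1 + d2 + d3) <= _).
    exact: leq_pexp2l.
  elim: (d1 + d2 + d3) => // k IH; rewrite !expnS leq_mul //; lia.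
rewrite -mulnA !mulnDl; apply: leq_add; first apply: leq_add;
  apply: leq_mul => //; apply: le2; lia.
Qed.

Theorem theorem1 (R : realType) :
  poly_time_solvable encode_instance (@rr_solution R).
Proof.
exists solver.
exists ((cost Prologue + cost InputSize + cost Solve) *
        2 ^ (loop_depth Prologue + loop_depth InputSize + loop_depth Solve)).
exists (loop_depth Prologue + loop_depth InputSize + loop_depth Solve) => I.
have [X [Y [out bX bY ck opt]]] := solveE I.
have [_ _ sL _] := prologueE I; have [sB _ _] := input_sizeE I.
have := @chain_run (encode_instance I) 31 Prologue vL InputSize vB Solve
  isT isT isT wf_Prologue wf_InputSize wf_Solve isT isT.
rewrite sL sB => /(_ (size_input_le I) (leqnn _))[t [lt run]].
exists t, (encode_set X ++ encode_set Y); split.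
- apply: poly_bound lt; apply: leq_trans (size_input_le I).
  by rewrite size_input.
- by rewrite -out.
- exact: rr_solutionP.
Qed.
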